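(* For every fixed integer $m\geq 3$, \[\mathbf N_{\mathcal P}(n,C_{2m+1})=2m\left(\frac{n}{m}\right)^m+O_m\!\left(n^{m-1/5}\right),\] where the implied constant depends only on $m$.
   Context: All graphs are finite and simple. $C_k$ denotes the cycle on $k$ vertices. For graphs $G$ and $H$, $\mathbf N(G,H)$ denotes the number of unlabeled, not necessarily induced copies of $H$ in $G$ (i.e. the number of subgraphs of $G$ isomorphic to $H$). For a planar graph $H$, $\mathbf N_{\mathcal P}(n,H)=\max\{\mathbf N(G,H): G\text{ is an }n\text{-vertex planar graph}\}$. *)

(* Defs.v *)
From HB Require Import structures.
From mathcomp Require Import all_boot all_order all_algebra.
From mathcomp Require Import all_classical all_reals all_analysis.

Set Implicit Arguments.
Unset Strict Implicit.
Unset Printing Implicit Defensive.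

Import Order.TTheory GRing.Theory Num.Theory.
Import numFieldNormedType.Exports.

Local Open Scope ring_scope.

Record sgraph (V : finType) := SGraph {
  edges : {set {set V}};
  edgesP : [forall e in edges, #|e| == 2%N]
}.

HB.instance Definition _ (V : finType) := [isSub for @edges V].
HB.instance Definition _ (V : finType) := [Finite of sgraph V by <:].

(* For k < 3 the loop or the double edge is discarded or merged, so this is
   the cycle C_k only when 3 <= k. *)
Definition cycle_edges (k : nat) : {set {set 'I_k}} :=
  [set [set i; ordS i] | i : 'I_k & i != ordS i].

Lemma cycle_edgesP (k : nat) : [forall e in cycle_edges k, #|e| == 2%N].
Proof.
by apply/forall_inP => e /imsetP[i]; rewrite inE => ni ->; rewrite cards2 ni.
Qed.

Definition cycle_graph (k : nat) : sgraph 'I_k := SGraph (cycle_edgesP k).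

(* A subgraph is a pair of a vertex set and an edge set. *)
Definition is_subgraph (V : finType) (G : sgraph V)
    (S : {set V} * {set {set V}}) : bool :=
  (S.2 \subset edges G) && [forall e in S.2, e \subset S.1].

Definition is_copy (V W : finType) (H : sgraph W)
    (S : {set V} * {set {set V}}) : bool :=
  [exists f : {ffun W -> V},
    [&& injectiveb f,
        S.1 == f @: [set: W] &
        S.2 == [set f @: e | e : {set W} in edges H]]].

Definition num_copies (V W : finType) (G : sgraph V) (H : sgraph W) : nat :=
  #|[set S : {set V} * {set {set V}} | is_subgraph G S & is_copy H S]|.

(* R * R is the Euclidean plane as far as its topology is concerned.  Each
   edge is drawn as a Jordan arc (an injective continuous image of [0, 1])
   joining its two ends; the last two clauses say that an arc passes through
   no vertex other than its ends and that two arcs meet only at common ends. *)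
Definition is_plane_drawing (R : realType) (V : finType) (G : sgraph V)
    (pt : V -> R * R) (arc : {set V} -> R -> R * R) : Prop :=
  [/\ injective pt,
      forall e, e \in edges G ->
        [/\ {within `[0, 1], continuous (arc e)}%classic,
            {in `[0, 1] &, injective (arc e)} &
            exists u v, [/\ e = [set u; v], arc e 0 = pt u & arc e 1 = pt v]],
      forall e, e \in edges G ->
        forall (t : R) (v : V), t \in `]0, 1[ -> arc e t <> pt v &
      forall e f, e \in edges G -> f \in edges G -> e != f ->
        forall s t : R, s \in `]0, 1[ -> t \in `]0, 1[ -> arc e s <> arc f t].

Definition planar (R : realType) (V : finType) (G : sgraph V) : Prop :=
  exists (pt : V -> R * R) (arc : {set V} -> R -> R * R),
    is_plane_drawing G pt arc.

Definition max_planar_copies (R : realType) (n : nat) (W : finType)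
    (H : sgraph W) : nat :=
  \max_(G : sgraph 'I_n | `[< planar R G >]) num_copies G H.

(* Main.v *)
(* Upper bound. A planar graph has no K_{3,3} minor: sample the arcs finely
   and perturb the samples into general position; independent edges of a
   K_{3,3} drawn with polygonal chains cross an odd number of times in total.
   Nothing else about planarity is used. Minor-closed sparsity leaves O(K)
   vertices of degree at least K^4, where K^5 ~ n, and all but O(n^m / K)
   copies of C_{2m+1} alternate between such hubs and vertices of low degree,
   with one edge of the cycle missing the hubs. Let w(b, c) be the number of
   vertices whose only hubs are b and c, up to a small error; then the sum of
   w over all ordered pairs is at most 2n + O(K^4), and at most 2 w(b, c)
   edges of the graph join a neighbour of b to a neighbour of c, both of low
   degree, since otherwise contracting some of these edges yields a K_{3,3}
   minor. Hence the copies are bounded by sums of products of w over closed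
   and open walks of distinct hubs, and these sums are controlled by x <= exp
   (x - 1) applied to the degrees outside the walk, after averaging over the
   rotations of a closed walk.

   Lower bound. Arrange m hubs cyclically, give each pair of consecutive hubs
   about n/m - 1 common neighbours, and join these neighbours by a path. The
   copies counted are those that alternate between hubs and such neighbours,
   except for one edge of a path. *)

Require Import Defs.
From mathcomp Require Import all_boot all_order all_algebra zify ring lra.

Set Implicit Arguments.
Unset Strict Implicit.
Unset Printing Implicit Defensive.

(** The exponent comes from one balance. With |V| at most K^5 there are O(K) vertices of degree at
    least K^4, hence O(K^3) triples of them. A K_{3,3} minor lets a triple be served by only O(K)
    vertices, so the vertices that spoil the weights number O(K^4), which is also the order of n /
    K. Both errors cost n^(m-1) K^4, that is n^(m-1/5).

    The obstacle is that one weight must dominate two counts, the common neighbours of b and c and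
    half of the rungs between them, while its total over ordered pairs stays near 2n. So a vertex
    may be charged to one pair only, and most of the work on weights goes into bounding the vertices
    for which this fails.

    Main term: after scaling the total weight to 2m, the extremal weights are 1 on the edges of an
    m-cycle. A path around this cycle is built backwards, and at each step the weight from its first
    vertex to the outside is exactly 1, where x <= exp (x - 1) is an equality. *)

Section Steps.

Variables (R : Type) (idx : R) (op : Monoid.com_law idx) (V : Type).

Definition steps (s : seq V) : seq (V * V) := zip s (behead s).

Lemma big_steps_cons2 (F : V -> V -> R) x y s :
  \big[op/idx]_(p <- steps [:: x, y & s]) F p.1 p.2 =
  op (F x y) (\big[op/idx]_(p <- steps (y :: s)) F p.1 p.2).
Proof. by rewrite big_cons. Qed.

Lemma big_steps1 (F : V -> V -> R) x :
  \big[op/idx]_(p <- steps [:: x]) F p.1 p.2 = idx.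
Proof. by rewrite big_nil. Qed.

Lemma big_steps_rcons2 (F : V -> V -> R) s x y :
  \big[op/idx]_(p <- steps (rcons (rcons s x) y)) F p.1 p.2 =
  op (\big[op/idx]_(p <- steps (rcons s x)) F p.1 p.2) (F x y).
Proof.
elim: s => [|z [|z' s] IH] /=; first by rewrite big_steps_cons2 !big_steps1 Monoid.mulmC.
  by rewrite !big_steps_cons2 !big_steps1 !Monoid.mulm1.
by rewrite !big_steps_cons2 [X in op _ X]IH Monoid.mulmA.
Qed.

Lemma big_steps_rev (F : V -> V -> R) s : (forall x y, F x y = F y x) ->
  \big[op/idx]_(p <- steps (rev s)) F p.1 p.2 = \big[op/idx]_(p <- steps s) F p.1 p.2.
Proof.
move=> symF; elim: s => [|x [|y s] IH] //.
rewrite !rev_cons big_steps_rcons2 big_steps_cons2 -rev_cons IH.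
by rewrite Monoid.mulmC symF.
Qed.

Lemma big_steps_nth x0 (F : V -> V -> R) s n : size s = n.+1 ->
  \big[op/idx]_(p <- steps s) F p.1 p.2 =
  \big[op/idx]_(k < n) F (nth x0 s k) (nth x0 s k.+1).
Proof.
elim: n s => [|n IH] [|x [|y s]] // sz; first by rewrite big_steps1 big_ord0.
have sz' : size (y :: s) = n.+1 by case: sz => /= ->.
by rewrite big_steps_cons2 big_ord_recl -(IH _ sz').
Qed.

End Steps.

Section TupleSums.

Variables (R : Type) (idx : R) (op : Monoid.com_law idx) (V : finType).

Lemma big_tuple_cons n (P : pred (seq V)) (F : seq V -> R) :
  \big[op/idx]_(t : n.+1.-tuple V | P t) F t =
  \big[op/idx]_(t : n.-tuple V) \big[op/idx]_(x | P (x :: t)) F (x :: t).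
Proof.
rewrite pair_big_dep /= (reindex (fun p : n.-tuple V * V => cons_tuple p.2 p.1)) //=.
exists (fun t : n.+1.-tuple V => (behead_tuple t, thead t)) => [[t x] _|t _] /=.
  by congr (_, _); apply: val_inj.
by rewrite [RHS]tuple_eta; apply: val_inj.
Qed.

Lemma big_tuple_rev n (P : pred (seq V)) (F : seq V -> R) :
  \big[op/idx]_(t : n.-tuple V | P t) F t =
  \big[op/idx]_(t : n.-tuple V | P (rev t)) F (rev t).
Proof.
rewrite (reindex (fun t : n.-tuple V => rev_tuple t)) //=.
by exists (fun t : n.-tuple V => rev_tuple t) => t _; apply: val_inj; rewrite /= revK.
Qed.

Lemma big_tuple_rot n k (P : pred (seq V)) (F : seq V -> R) :
  \big[op/idx]_(t : n.-tuple V | P t) F t =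
  \big[op/idx]_(t : n.-tuple V | P (rot k t)) F (rot k t).
Proof.
rewrite (reindex (fun t : n.-tuple V => rot_tuple k t)) //=.
by exists (fun t : n.-tuple V => rotr_tuple k t) => t _; apply: val_inj; rewrite /= ?rotK ?rotrK.
Qed.

End TupleSums.


(** * Crossing parities of polygonal chains *)

Section Orientation.

Import Order.TTheory GRing.Theory Num.Theory.
Local Open Scope ring_scope.

Variable R : realFieldType.

Definition det3 (a b c : R * R) : R :=
  (b.1 - a.1) * (c.2 - a.2) - (b.2 - a.2) * (c.1 - a.1).

(** False for collinear triples as well as for clockwise ones, so [crossing] and [inside] have their
    geometric meaning only in general position. *)
Definition ccw (a b c : R * R) : bool := 0 < det3 a b c.

Definition crossing (p q r s : R * R) : bool :=
  (ccw p q r != ccw p q s) && (ccw r s p != ccw r s q).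

Definition inside (p q r s : R * R) : bool :=
  (ccw p q s == ccw q r s) && (ccw q r s == ccw r p s).

Lemma det3_rot a b c : det3 b c a = det3 a b c.
Proof. by rewrite /det3; ring. Qed.

Lemma ccw_rot a b c : ccw b c a = ccw a b c.
Proof. by rewrite /ccw det3_rot. Qed.

Lemma ccw_swap a b c : det3 a b c != 0 -> ccw b a c = ~~ ccw a b c.
Proof.
rewrite /ccw (_ : det3 b a c = - det3 a b c); last by rewrite /det3; ring.
by rewrite oppr_gt0 => n0; case: ltgtP n0; rewrite ?eqxx.
Qed.

Lemma ccw_swap23 a b c : det3 a b c != 0 -> ccw a c b = ~~ ccw a b c.
Proof. by move=> n0; rewrite -[LHS]ccw_rot ccw_swap ?(det3_rot a b c) // (ccw_rot a b c). Qed.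

(** The four signed areas satisfy a linear relation with alternating signs, so the four signed terms
    cannot all have the same sign. *)
Lemma ccw4 a b c d :
  det3 b c d != 0 -> det3 a c d != 0 -> det3 a b d != 0 -> det3 a b c != 0 ->
  [&& ccw b c d, ~~ ccw a c d, ccw a b d & ~~ ccw a b c] ||
  [&& ~~ ccw b c d, ccw a c d, ~~ ccw a b d & ccw a b c] = false.
Proof.
have : det3 b c d - det3 a c d + det3 a b d - det3 a b c = 0 by rewrite /det3; ring.
rewrite /ccw; move: (det3 b c d) (det3 a c d) (det3 a b d) (det3 a b c) => x y z t E.
by case: (ltgtP 0 x) => // ? _; case: (ltgtP 0 y) => // ? _; case: (ltgtP 0 z) => // ? _;
  case: (ltgtP 0 t) => // ? _; first [done | exfalso; lra].
Qed.

(** The three-term Grassmann-Pluecker relation at the point [a]: three signed products with sum zero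
    cannot share a sign. *)
Lemma ccw5 a b c d e :
  det3 a b c != 0 -> det3 a d e != 0 -> det3 a b d != 0 -> det3 a c e != 0 ->
  det3 a b e != 0 -> det3 a c d != 0 ->
  [&& ccw a b c == ccw a d e, ccw a b d != ccw a c e & ccw a b e == ccw a c d] ||
  [&& ccw a b c != ccw a d e, ccw a b d == ccw a c e & ccw a b e != ccw a c d] = false.
Proof.
have : det3 a b c * det3 a d e - det3 a b d * det3 a c e + det3 a b e * det3 a c d = 0.
  by rewrite /det3; ring.
have sg (x y : R) : x != 0 -> y != 0 ->
    ((0 < x) == (0 < y)) && (0 < x * y) || ((0 < x) != (0 < y)) && (x * y < 0).
  move=> x0 y0; case: (ltgtP 0 x) x0 => // x0 _; case: (ltgtP 0 y) y0 => // y0 _ /=.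
  - by rewrite mulr_gt0.
  - by rewrite pmulr_rlt0.
  - by rewrite pmulr_llt0.
  - by rewrite nmulr_rgt0 // y0.
rewrite /ccw => E h1 h2 h3 h4 h5 h6; move: E (sg _ _ h1 h2) (sg _ _ h3 h4) (sg _ _ h5 h6).
by case: (_ == _) => /= E p1; case: (_ == _) => /= p2; case: (_ == _) => //= p3;
  first [done | exfalso; rewrite ?orbF in p1 p2 p3; lra].
Qed.

Section FivePoints.

Variables p1 p2 p3 p4 p5 : R * R.
Hypotheses (n123 : det3 p1 p2 p3 != 0) (n124 : det3 p1 p2 p4 != 0)
  (n125 : det3 p1 p2 p5 != 0) (n134 : det3 p1 p3 p4 != 0) (n135 : det3 p1 p3 p5 != 0)
  (n145 : det3 p1 p4 p5 != 0) (n234 : det3 p2 p3 p4 != 0) (n235 : det3 p2 p3 p5 != 0)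
  (n245 : det3 p2 p4 p5 != 0) (n345 : det3 p3 p4 p5 != 0).

(** The chirotope conditions on the ten orientations of five points: [ccw4] for each quadruple and
    [ccw5] at each point. They reduce the parity identities below to a check of 2^10 sign
    vectors. *)
Definition sign_vector_ok (b123 b124 b125 b134 b135 b145 b234 b235 b245 b345 : bool) : bool :=
  let bad4 x y z t := [&& x, ~~ y, z & ~~ t] || [&& ~~ x, y, ~~ z & t] in
  let bad5 x x' y y' z z' := [&& x == x', y != y' & z == z'] || [&& x != x', y == y' & z != z'] in
  ~~ [|| bad4 b234 b134 b124 b123, bad4 b235 b135 b125 b123, bad4 b245 b145 b125 b124,
      bad4 b345 b145 b135 b134, bad4 b345 b245 b235 b234,
      bad5 b123 b145 b124 b135 b125 b134,
      bad5 (~~ b123) b245 (~~ b124) b235 (~~ b125) b234,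
      bad5 b123 b345 (~~ b134) (~~ b235) (~~ b135) (~~ b234),
      bad5 b124 (~~ b345) b134 (~~ b245) (~~ b145) b234 |
      bad5 b125 b345 b135 b245 b145 b235].

Lemma sign_vectorP : sign_vector_ok (ccw p1 p2 p3) (ccw p1 p2 p4) (ccw p1 p2 p5)
  (ccw p1 p3 p4) (ccw p1 p3 p5) (ccw p1 p4 p5) (ccw p2 p3 p4) (ccw p2 p3 p5)
  (ccw p2 p4 p5) (ccw p3 p4 p5).
Proof.
have nsw a b c : det3 a b c != 0 -> det3 b a c != 0.
  by rewrite (_ : det3 b a c = - det3 a b c) ?oppr_eq0 // /det3; ring.
have nrot a b c : det3 a b c != 0 -> det3 b c a != 0.
  by rewrite (_ : det3 b c a = det3 a b c) // /det3; ring.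
have := ccw4 n234 n134 n124 n123; have := ccw4 n235 n135 n125 n123.
have := ccw4 n245 n145 n125 n124; have := ccw4 n345 n145 n135 n134.
have := ccw4 n345 n245 n235 n234.
have := ccw5 n123 n145 n124 n135 n125 n134.
have := ccw5 (nsw _ _ _ n123) n245 (nsw _ _ _ n124) n235 (nsw _ _ _ n125) n234.
have := ccw5 (nrot _ _ _ (nrot _ _ _ n123)) n345 (nsw _ _ _ n134) (nsw _ _ _ n235)
  (nsw _ _ _ n135) (nsw _ _ _ n234).
have := ccw5 (nrot _ _ _ (nrot _ _ _ n124)) (nsw _ _ _ n345)
  (nrot _ _ _ (nrot _ _ _ n134)) (nsw _ _ _ n245) (nsw _ _ _ n145) (nrot _ _ _ (nrot _ _ _ n234)).
have := ccw5 (nrot _ _ _ (nrot _ _ _ n125)) (nrot _ _ _ (nrot _ _ _ n345))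
  (nrot _ _ _ (nrot _ _ _ n135)) (nrot _ _ _ (nrot _ _ _ n245))
  (nrot _ _ _ (nrot _ _ _ n145)) (nrot _ _ _ (nrot _ _ _ n235)).
rewrite -(ccw_rot p3 p1 p2) -(ccw_rot p4 p1 p2) -(ccw_rot p5 p1 p2) -(ccw_rot p4 p1 p3).
rewrite -(ccw_rot p5 p1 p3) -(ccw_rot p5 p1 p4) -(ccw_rot p4 p2 p3) -(ccw_rot p5 p2 p3).
rewrite -(ccw_rot p5 p2 p4) -(ccw_rot p5 p3 p4).
rewrite (ccw_swap n123) (ccw_swap n124) (ccw_swap n125) (ccw_swap n134) (ccw_swap n135).
rewrite (ccw_swap n145) (ccw_swap n234) (ccw_swap n235) (ccw_swap n245) (ccw_swap n345).
rewrite /sign_vector_ok /=.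
by do 10! [move=> ->].
Qed.

Let ccwE := (esym (ccw_rot p3 p1 p2), esym (ccw_rot p4 p1 p2), esym (ccw_rot p5 p1 p2),
  esym (ccw_rot p4 p1 p3), esym (ccw_rot p5 p1 p3), esym (ccw_rot p5 p1 p4),
  esym (ccw_rot p4 p2 p3), esym (ccw_rot p5 p2 p3), esym (ccw_rot p5 p2 p4),
  esym (ccw_rot p5 p3 p4), ccw_rot p1 p2 p3, ccw_rot p1 p2 p4, ccw_rot p1 p2 p5,
  ccw_rot p1 p3 p4, ccw_rot p1 p3 p5, ccw_rot p1 p4 p5, ccw_rot p2 p3 p4,
  ccw_rot p2 p3 p5, ccw_rot p2 p4 p5, ccw_rot p3 p4 p5).

Let ccwS := ((ccw_swap n123, ccw_swap n124, ccw_swap n125, ccw_swap n134, ccw_swap n135),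
  (ccw_swap n145, ccw_swap n234, ccw_swap n235, ccw_swap n245, ccw_swap n345),
  (ccw_swap23 n123, ccw_swap23 n124, ccw_swap23 n125, ccw_swap23 n134, ccw_swap23 n135),
  (ccw_swap23 n145, ccw_swap23 n234, ccw_swap23 n235, ccw_swap23 n245, ccw_swap23 n345)).

Lemma ccw321 : ((ccw p3 p2 p1 = ~~ ccw p1 p2 p3) * (ccw p4 p2 p1 = ~~ ccw p1 p2 p4) *
  (ccw p5 p2 p1 = ~~ ccw p1 p2 p5) * (ccw p4 p3 p1 = ~~ ccw p1 p3 p4) *
  (ccw p5 p3 p1 = ~~ ccw p1 p3 p5) * (ccw p5 p4 p1 = ~~ ccw p1 p4 p5) *
  (ccw p4 p3 p2 = ~~ ccw p2 p3 p4) * (ccw p5 p3 p2 = ~~ ccw p2 p3 p5) *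
  (ccw p5 p4 p2 = ~~ ccw p2 p4 p5) * (ccw p5 p4 p3 = ~~ ccw p3 p4 p5))%type.
Proof.
have key a b c : det3 a b c != 0 -> ccw c b a = ~~ ccw a b c.
  by move=> n; rewrite -[LHS]ccw_rot ccw_swap.
by do !split; apply: key.
Qed.

Lemma triangle_crossings :
  crossing p1 p2 p4 p5 (+) crossing p2 p3 p4 p5 (+) crossing p3 p1 p4 p5 =
  inside p1 p2 p3 p4 (+) inside p1 p2 p3 p5.
Proof.
move: sign_vectorP; rewrite /crossing /inside ?ccw321 ?ccwS ?ccwE.
move: (ccw p1 p2 p3) (ccw p1 p2 p4) (ccw p1 p2 p5) (ccw p1 p3 p4) (ccw p1 p3 p5).
move: (ccw p1 p4 p5) (ccw p2 p3 p4) (ccw p2 p3 p5) (ccw p2 p4 p5) (ccw p3 p4 p5).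
by do 10! case.
Qed.

(** Among the three ways to pair four points in general position one gives a crossing exactly when
    the points are in convex position. *)
Let convex a b c d : bool := crossing a b c d (+) crossing a c b d (+) crossing a d b c.

(** The right side separates into a function of [p4] and the same function of [p5]. Over the three
    pairs among three such points these values cancel and three negations remain, so the crossing
    parity of a straight K_{3,3} is odd. *)
Lemma K23_crossings :
  crossing p1 p4 p2 p5 (+) crossing p1 p5 p2 p4 (+)
  (crossing p1 p4 p3 p5 (+) crossing p1 p5 p3 p4) (+)
  (crossing p2 p4 p3 p5 (+) crossing p2 p5 p3 p4) =
  ~~ ((convex p1 p2 p3 p4 (+) inside p1 p2 p3 p4) (+) (convex p1 p2 p3 p5 (+) inside p1 p2 p3 p5)).
Proof.
move: sign_vectorP; rewrite /convex /crossing /inside ?ccw321 ?ccwS ?ccwE.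
move: (ccw p1 p2 p3) (ccw p1 p2 p4) (ccw p1 p2 p5) (ccw p1 p3 p4) (ccw p1 p3 p5).
move: (ccw p1 p4 p5) (ccw p2 p3 p4) (ccw p2 p3 p5) (ccw p2 p4 p5) (ccw p3 p4 p5).
by do 10! case.
Qed.

End FivePoints.

End Orientation.

Section Chains.

Variables (R : realFieldType) (I : eqType) (P : I -> R * R).
Hypothesis generic : forall i j k, uniq [:: i; j; k] -> det3 (P i) (P j) (P k) != 0%R.

Let X i j k l : bool := crossing (P i) (P j) (P k) (P l).

Definition chain_crossings (s t : seq I) : bool :=
  \big[addb/false]_(p <- steps s) \big[addb/false]_(q <- steps t) X p.1 p.2 q.1 q.2.

Let edge_crossings x y t : bool := \big[addb/false]_(q <- steps t) X x y q.1 q.2.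

Let XC i j k l : X k l i j = X i j k l.
Proof. by rewrite /X /crossing andbC. Qed.

Let X_swap i j k l : uniq [:: i; j; k; l] -> X j i k l = X i j k l.
Proof.
rewrite /= !inE !negb_or => /and4P[/and3P[ij ik il] /andP[jk jl] kl _].
have d1 : det3 (P i) (P j) (P k) != 0%R by apply: generic; rewrite /= !inE negb_or ij ik jk.
have d2 : det3 (P i) (P j) (P l) != 0%R by apply: generic; rewrite /= !inE negb_or ij il jl.
rewrite /X /crossing (ccw_swap d1) (ccw_swap d2).
by rewrite [ccw (P k) (P l) (P j) == _]eq_sym; do 2 case: (ccw (P i) _ _).
Qed.

Let uniq5 i j k l n : uniq [:: i; j; k; l; n] ->
  [/\ det3 (P i) (P j) (P k) != 0%R, det3 (P i) (P j) (P l) != 0%R,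
      det3 (P i) (P j) (P n) != 0%R, det3 (P i) (P k) (P l) != 0%R &
      det3 (P i) (P k) (P n) != 0%R] /\
  [/\ det3 (P i) (P l) (P n) != 0%R, det3 (P j) (P k) (P l) != 0%R,
      det3 (P j) (P k) (P n) != 0%R, det3 (P j) (P l) (P n) != 0%R &
      det3 (P k) (P l) (P n) != 0%R].
Proof.
rewrite /= !inE !negb_or => /and5P[/and4P[ij ik il ijn] /and3P[jk jl jn] /andP[kl kn] ln _].
by split; split; apply: generic; rewrite /= !inE negb_or ?ij ?ik ?il ?ijn ?jk ?jl ?jn ?kl ?kn ?ln.
Qed.

Lemma chain_crossingsC s t : chain_crossings s t = chain_crossings t s.
Proof.
rewrite /chain_crossings exchange_big; apply: eq_bigr => p _; apply: eq_bigr => q _.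
exact: XC.
Qed.

Let chain2 x y t : chain_crossings [:: x; y] t = edge_crossings x y t.
Proof. by rewrite /chain_crossings big_cons big_nil addbF. Qed.

Let edge_triangle x y z u t : uniq [:: x, y, z, u & t] ->
  edge_crossings x y (u :: t) (+) edge_crossings y z (u :: t) (+) edge_crossings z x (u :: t)
  = inside (P x) (P y) (P z) (P u) (+) inside (P x) (P y) (P z) (P (last u t)).
Proof.
elim: t u => [|v t IH] u un.
  by rewrite /edge_crossings !big_nil [RHS]addbb.
have unv : uniq [:: x, y, z, v & t].
  by apply: (subseq_uniq (cat_subseq (subseq_refl [:: x; y; z]) (subseq_cons (v :: t) u)) un).
have un5 : uniq [:: x; y; z; u; v].
  by apply: subseq_uniq un; rewrite /= !eqxx sub0seq.
have [[? ? ? ? ?] [? ? ? ? ?]] := uniq5 un5.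
have tr : X x y u v (+) X y z u v (+) X z x u v =
    inside (P x) (P y) (P z) (P u) (+) inside (P x) (P y) (P z) (P v).
  exact: triangle_crossings.
have := IH v unv; rewrite /edge_crossings !big_steps_cons2 /=.
move: tr.
move: (X x y u v) (X y z u v) (X z x u v) => c1 c2 c3.
move: (\big[addb/false]_(p <- _) _) (\big[addb/false]_(p <- _) _) (\big[addb/false]_(p <- _) _) => d1 d2 d3.
case: (inside _ _ _ (P u)); case: (inside _ _ _ (P v)); case: (inside _ _ _ (P (last v t)));
  by case: c1; case: c2; case: c3; case: d1; case: d2; case: d3.
Qed.

(** The correction that appears when the chain [x :: s] is replaced by the segment between its
    ends. *)
Definition fan x (s : seq I) v : bool :=
  \big[addb/false]_(p <- steps s) inside (P x) (P p.1) (P p.2) (P v).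

Let edge_swap x z t : uniq [:: x, z & t] -> edge_crossings z x t = edge_crossings x z t.
Proof.
elim: t => [|u [|v t] IH] un; try by rewrite /edge_crossings !big_nil.
rewrite /edge_crossings !big_steps_cons2 /= X_swap; last first.
  by apply: subseq_uniq un; rewrite /= !eqxx sub0seq.
congr (_ (+) _); apply: IH.
by apply: (subseq_uniq (cat_subseq (subseq_refl [:: x; z]) (subseq_cons (v :: t) u)) un).
Qed.

(* Cutting off the triangles of a fan with apex [x]. *)
Lemma chain_fan x y s u t : uniq ([:: x, y & s] ++ u :: t) ->
  chain_crossings [:: x, y & s] (u :: t) =
  edge_crossings x (last y s) (u :: t) (+) (fan x (y :: s) u (+) fan x (y :: s) (last u t)).
Proof.
elim/last_ind: s => [|s z IH] un.
  by rewrite chain2 /fan !big_nil /= addbF.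
have E : [:: x, y & rcons s z] = rcons (rcons (belast x (y :: s)) (last y s)) z.
  by rewrite -[in RHS]lastI.
have E' : y :: rcons s z = rcons (rcons (belast y s) (last y s)) z by rewrite -lastI.
have stepE v : fan x (y :: rcons s z) v =
    fan x (y :: s) v (+) inside (P x) (P (last y s)) (P z) (P v).
  rewrite /fan E' (big_steps_rcons2 _ (fun a b => inside (P x) (P a) (P b) (P v))) /=.
  by rewrite -lastI.
have crE : chain_crossings [:: x, y & rcons s z] (u :: t) =
    chain_crossings [:: x, y & s] (u :: t) (+) edge_crossings (last y s) z (u :: t).
  rewrite /chain_crossings E.
  rewrite (big_steps_rcons2 _ (fun a b => \big[addb/false]_(q <- steps (u :: t)) X a b q.1 q.2)) /=.
  by rewrite -lastI.
rewrite crE !stepE last_rcons IH; last first.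
  apply: (subseq_uniq _ un); apply: (@cat_subseq _ [:: x, y & s] (u :: t) [:: x, y & rcons s z]) => //.
  by rewrite -!rcons_cons subseq_rcons.
have un4 : uniq [:: x, last y s, z, u & t].
  have sl : subseq [:: last y s; z] (y :: rcons s z) by rewrite E' -!cats1 -catA suffix_subseq.
  have sx : subseq [:: x; last y s; z] [:: x, y & rcons s z].
    exact: (@cat_subseq _ [:: x] [:: last y s; z] [:: x] (y :: rcons s z)).
  exact: (subseq_uniq (cat_subseq sx (subseq_refl (u :: t))) un).
have zx : edge_crossings z x (u :: t) = edge_crossings x z (u :: t).
  apply: edge_swap.
  exact: (subseq_uniq (cat_subseq (subseq_refl [:: x]) (subseq_cons [:: z, u & t] (last y s))) un4).
have := edge_triangle un4; rewrite zx.
case: (inside _ _ _ (P u)); case: (inside _ _ _ (P (last u t)));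
  case: (edge_crossings x z _); case: (edge_crossings x (last y s) _);
  case: (edge_crossings (last y s) z _) => //= _;
  by case: (fan _ _ u); case: (fan _ _ (last u t)).
Qed.

Variables (a b : 'I_3 -> I) (s : 'I_3 -> 'I_3 -> seq I).
Hypothesis s_end : forall i j, s i j != [::] /\ last (a i) (s i j) = b j.
Hypothesis s_uniq : forall i j k l, i != k -> j != l ->
  uniq ((a i :: s i j) ++ (a k :: s k l)).

Let F i j v := fan (a i) (s i j) v.

Let ends_subseq i j : subseq [:: a i; b j] (a i :: s i j).
Proof.
have [] := s_end i j; case: (s i j) => // y t _ /= <-.
apply: (@cat_subseq _ [:: a i] [:: last y t] [:: a i] (y :: t)) => //.
by rewrite sub1seq mem_last.
Qed.

(** The first chain is straightened against the second by [chain_fan], then the second against the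
    resulting segment. Each leaves its fan, tested at both ends of the other chain. *)
Let chain_straight i j k l : i != k -> j != l ->
  chain_crossings (a i :: s i j) (a k :: s k l) =
  X (a i) (b j) (a k) (b l) (+) ((F i j (a k) (+) F i j (b l)) (+) (F k l (a i) (+) F k l (b j))).
Proof.
move=> ik jl; have un := s_uniq ik jl; have [] := s_end i j; have [] := s_end k l.
have unC : uniq ((a k :: s k l) ++ [:: a i; b j]).
  rewrite uniq_catC; apply: (subseq_uniq _ un).
  by apply: cat_subseq => //; exact: ends_subseq.
move: un unC; rewrite /F; case: (s i j) => // y t; case: (s k l) => // y' t' un unC.
move=> _ lk _ li; rewrite chain_fan // (_ : last y t = b j) // (_ : last (a k) (y' :: t') = b l) //.
rewrite -chain2 chain_crossingsC chain_fan // (_ : last y' t' = b l) //=.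
rewrite -chain2 /chain_crossings !(big_cons, big_nil) /= !addbF XC.
by case: (X _ _ _ _); do 4 case: (fan _ _ _).
Qed.

Let xor6 x1 y1 x2 y2 x3 y3 x4 y4 x5 y5 x6 y6 :
  ((x1 (+) y1) (+) (x2 (+) y2)) (+) ((x3 (+) y3) (+) (x4 (+) y4)) (+) ((x5 (+) y5) (+) (x6 (+) y6)) =
  ((x1 (+) x2) (+) (x3 (+) x4) (+) (x5 (+) x6)) (+) ((y1 (+) y2) (+) (y3 (+) y4) (+) (y5 (+) y6)).
Proof. 
rewrite (addbACA x1 y1 x2 y2) (addbACA x3 y3 x4 y4) (addbACA x5 y5 x6 y6).
by rewrite (addbACA (x1 (+) x2)) (addbACA ((x1 (+) x2) (+) _)).
Qed.

Let xor9 f0 f1 f2 c01 c10 c02 c20 c12 c21 :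
  (f0 (+) c01) (+) (f1 (+) c10) (+) ((f0 (+) c02) (+) (f2 (+) c20)) (+) ((f1 (+) c12) (+) (f2 (+) c21))
  = (c01 (+) c02) (+) (c10 (+) c12) (+) (c20 (+) c21).
Proof. by move: f0 f1 f2 c01 c10 c02 c20 c12 c21; do 9 case. Qed.

Let xor9' g0 g1 g2 d01 d10 d02 d20 d12 d21 :
  (g1 (+) d10) (+) (g0 (+) d01) (+) ((g2 (+) d20) (+) (g0 (+) d02)) (+) ((g2 (+) d21) (+) (g1 (+) d12))
  = (d01 (+) d02) (+) (d10 (+) d12) (+) (d20 (+) d21).
Proof. by move: g0 g1 g2 d01 d10 d02 d20 d12 d21; do 9 case. Qed.

Let xor9s x1 x2 x3 y1 y2 y3 z1 z2 z3 :
  (x1 (+) x2 (+) x3) (+) (y1 (+) y2 (+) y3) (+) (z1 (+) z2 (+) z3) =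
  (x1 (+) y1 (+) z1) (+) (x2 (+) y2 (+) z2) (+) (x3 (+) y3 (+) z3).
Proof. by move: x1 x2 x3 y1 y2 y3 z1 z2 z3; do 9 case. Qed.

(** If no independent chains crossed oddly, the parity of each straight pair would be a sum of fan
    terms. These cancel in the total over the 18 independent pairs, while [K23_crossings] makes that
    total odd. *)
Theorem K33_chains_cross : exists i j k l,
  [/\ i != k, j != l & chain_crossings (a i :: s i j) (a k :: s k l)].
Proof.
case: (boolP [exists i, exists j, exists k, exists l,
    [&& i != k, j != l & chain_crossings (a i :: s i j) (a k :: s k l)]]).
  case/existsP => i /existsP[j /existsP[k /existsP[l /and3P[ik jl cr]]]].
  by exists i, j, k, l.
move=> no; exfalso.
have XE i j k l : i != k -> j != l -> X (a i) (b j) (a k) (b l) =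
    (F i j (a k) (+) F i j (b l)) (+) (F k l (a i) (+) F k l (b j)).
  move=> ik jl; have : chain_crossings (a i :: s i j) (a k :: s k l) = false.
    apply: contraNF no => cr; apply/existsP; exists i; apply/existsP; exists j.
    by apply/existsP; exists k; apply/existsP; exists l; rewrite ik jl.
  by rewrite chain_straight //; move: (F i j (a k) (+) _) (F k l _ (+) _); case: (X _ _ _ _) => -[] [].
pose o0 : 'I_3 := inord 0; pose o1 : 'I_3 := inord 1; pose o2 : 'I_3 := inord 2.
have [d01 d02 d12] : [/\ o0 != o1, o0 != o2 & o1 != o2].
  by rewrite /o0 /o1 /o2; split; rewrite -val_eqE /= !inordK.
have d10 : o1 != o0 by rewrite eq_sym.
have d20 : o2 != o0 by rewrite eq_sym.
have d21 : o2 != o1 by rewrite eq_sym.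
(* A fan term tested at some [a k] occurs for both admissible [l] and cancels. The terms tested at
   the [b l] depend on [i] alone, so the three pairs of indices [i], [k] contribute every [Bs i]
   twice. *)
pose Bs i := (F i o0 (b o1) (+) F i o0 (b o2)) (+) (F i o1 (b o0) (+) F i o1 (b o2)) (+)
  (F i o2 (b o0) (+) F i o2 (b o1)).
pose u i k j l := X (a i) (b j) (a k) (b l) (+) X (a i) (b l) (a k) (b j).
have uE i k : i != k -> u i k o0 o1 (+) u i k o0 o2 (+) u i k o1 o2 = Bs i (+) Bs k.
  move=> ik; rewrite /u /Bs !XE //.
  rewrite xor6 (xor9 (F i o0 (a k))); congr (_ (+) _); exact: xor9'.
have a_inj i k : i != k -> a i != a k.
  move=> ik; have := s_uniq ik d01; rewrite cat_uniq => /and3P[_ /hasPn/(_ (a k)) + _].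
  by rewrite mem_head => /(_ isT); rewrite inE negb_or eq_sym => /andP[].
have b_in i j : b j \in s i j.
  by have [] := s_end i j; case: (s i j) => // y t _ /= <-; exact: mem_last.
have b_inj j l : j != l -> b j != b l.
  move=> jl; have := s_uniq d01 jl; rewrite cat_uniq => /and3P[_ /hasPn/(_ (b l)) + _].
  rewrite inE b_in orbT => /(_ isT); apply: contraNneq => <-.
  by rewrite inE b_in orbT.
have ab i j : a i != b j.
  have [k ik] : exists k, i != k.
    by have [->|n0] := eqVneq i o0; [exists o1|exists o0].
  have [l jl] : exists l, j != l.
    by have [->|n0] := eqVneq j o0; [exists o1|exists o0].
  have := s_uniq ik jl; rewrite cat_uniq => /and3P[/andP[+ _] _ _].
  by apply: contraNneq => ->.
pose phi j := crossing (P (a o0)) (P (a o1)) (P (a o2)) (P (b j)) (+)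
  crossing (P (a o0)) (P (a o2)) (P (a o1)) (P (b j)) (+)
  crossing (P (a o0)) (P (b j)) (P (a o1)) (P (a o2)) (+)
  inside (P (a o0)) (P (a o1)) (P (a o2)) (P (b j)).
have phiE j l : j != l -> u o0 o1 j l (+) u o0 o2 j l (+) u o1 o2 j l = ~~ (phi j (+) phi l).
  move=> jl; have un5 : uniq [:: a o0; a o1; a o2; b j; b l].
    by rewrite /= !inE !negb_or !a_inj // !ab b_inj.
  have [[? ? ? ? ?] [? ? ? ? ?]] := uniq5 un5.
  exact: K23_crossings.
have := xor9s (u o0 o1 o0 o1) (u o0 o2 o0 o1) (u o1 o2 o0 o1) (u o0 o1 o0 o2) (u o0 o2 o0 o2)
  (u o1 o2 o0 o2) (u o0 o1 o1 o2) (u o0 o2 o1 o2) (u o1 o2 o1 o2).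
rewrite !phiE // !uE //.
by case: (phi o0); case: (phi o1); case: (phi o2); case: (Bs o0); case: (Bs o1); case: (Bs o2).
Qed.

End Chains.

(** * Perturbation into general position *)

Section Perturbation.

Import Order.TTheory GRing.Theory Num.Theory.
Local Open Scope ring_scope.

Variable R : realFieldType.

(** By Cramer's rule p - r is the combination of p - q and r - s with coefficients a / (a - b) and c
    / (a - b). Since a, b and c, d have opposite signs and c - d = b - a, both coefficients are at
    most 1 in absolute value. *)
Lemma crossing_close (p q r s : R * R) : crossing p q r s ->
  `|p.1 - r.1| <= `|p.1 - q.1| + `|r.1 - s.1| /\ `|p.2 - r.2| <= `|p.2 - q.2| + `|r.2 - s.2|.
Proof.
move=> /andP[cpq crs].
pose a := det3 r s p; pose b := det3 r s q; pose c := det3 p q r; pose d := det3 p q s.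
have ab : (0 < a) != (0 < b) by [].
have cd : (0 < c) != (0 < d) by [].
have dE : c - d = b - a by rewrite /a /b /c /d /det3; ring.
have ab0 : 0 < `|a - b|.
  rewrite normr_gt0 subr_eq0; apply: contraNneq ab => ->; exact: eqxx.
have opp (x y : R) : (0 < x) != (0 < y) -> `|x| <= `|x - y|.
  case: (ltrP 0 x) => x0; case: (ltrP 0 y) => y0 // _.
    by rewrite gtr0_norm // ger0_norm; lra.
  by rewrite ler0_norm // ltr0_norm; lra.
have la := opp _ _ ab; have lc := opp _ _ cd; rewrite dE (distrC b a) in lc.
have key (x y z t : R) : (a - b) * (x - z) = a * (x - y) + c * (z - t) ->
    `|x - z| <= `|x - y| + `|z - t|.
  move=> E; rewrite -(ler_pM2l ab0) -normrM E.
  apply: le_trans (ler_normD _ _) _; rewrite (normrM a) (normrM c) mulrDr.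
  by apply: lerD; apply: ler_wpM2r.
by split; apply: key; rewrite /a /b /c /det3; ring.
Qed.

(** The offsets lie on a parabola, which has no three collinear points. They depend on the index and
    not on the base point, so coinciding base points are separated too. *)
Definition perturb (I : finType) (base : I -> R * R) (delta : R) (i : I) : R * R :=
  let k := (enum_rank i)%:R in ((base i).1 + delta * k, (base i).2 + delta * k ^+ 2).

(* For three distinct points the determinant is a polynomial in [delta] whose
   leading coefficient is a Vandermonde determinant. *)
Lemma generic_perturbation (I : finType) (base : I -> R * R) eps : 0 < eps ->
  exists delta, [/\ 0 < delta, delta < eps & forall i j k, uniq [:: i; j; k] ->
    det3 (perturb base delta i) (perturb base delta j) (perturb base delta k) != 0].
Proof.
move=> e0; pose rk (i : I) : R := (enum_rank i)%:R.
pose a0 (t : I * I * I) := det3 (base t.1.1) (base t.1.2) (base t.2).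
pose a2 (t : I * I * I) := (rk t.1.2 - rk t.1.1) * (rk t.2 - rk t.1.1) * (rk t.2 - rk t.1.2).
pose a1 (t : I * I * I) :=
  ((base t.1.2).1 - (base t.1.1).1) * (rk t.2 ^+ 2 - rk t.1.1 ^+ 2) +
  (rk t.1.2 - rk t.1.1) * ((base t.2).2 - (base t.1.1).2) -
  ((base t.1.2).2 - (base t.1.1).2) * (rk t.2 - rk t.1.1) -
  (rk t.1.2 ^+ 2 - rk t.1.1 ^+ 2) * ((base t.2).1 - (base t.1.1).1).
pose pol t := (a0 t)%:P + a1 t *: 'X + a2 t *: 'X^2.
pose p := \prod_(t : I * I * I | uniq [:: t.1.1; t.1.2; t.2]) pol t.
have polE t delta : (pol t).[delta] = det3 (perturb base delta t.1.1)
    (perturb base delta t.1.2) (perturb base delta t.2).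
  by rewrite /pol !hornerE /a0 /a1 /a2 /det3 /perturb /=; ring.
have rk_inj : injective rk by move=> i j /eqP; rewrite eqr_nat => /eqP/val_inj/enum_rank_inj.
have p0 : p != 0.
  apply/prodf_neq0 => -[[i j] k] /=; rewrite !inE !negb_or => /and3P[/andP[ij ik] jk _].
  apply/eqP => /(congr1 (fun q : {poly R} => q`_2)) /eqP.
  rewrite /pol !coefD coefC !coefZ coefX coefXn /= mulr0 mulr1 !add0r coef0.
  by rewrite /a2 !mulf_eq0 !subr_eq0 !(inj_eq rk_inj) ![_ == i]eq_sym
    (negbTE ij) (negbTE ik) [k == j]eq_sym (negbTE jk).
(* There are [size p] distinct candidates and fewer roots; the denominators n + 2 keep the
   candidates strictly below [eps]. *)
pose rs := [seq eps / n.+2%:R | n <- iota 0 (size p)].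
have [n np] : exists n : nat, p.[eps / n.+2%:R] != 0.
  have : ~~ all (root p) rs.
    apply/negP => ar; have := max_poly_roots p0 ar.
    rewrite size_map size_iota ltnn => h; suff : false by []; apply: h.
    rewrite map_inj_uniq ?iota_uniq // => x y /(mulfI (lt0r_neq0 e0))/invr_inj/eqP.
    by rewrite eqr_nat => /eqP[].
  by case/allPn => _ /mapP[n _ ->]; exists n.
exists (eps / n.+2%:R); split.
- by rewrite divr_gt0.
- by rewrite ltr_pdivrMr // ltr_pMr // ltr1n.
move=> i j k un; rewrite -(polE (i, j, k)); apply: contraNneq np => z.
by rewrite /p (bigD1 (i, j, k)) //= hornerM z mul0r.
Qed.

End Perturbation.

(** * Graphs without a K33 minor *)

Section Blocks.

Variables (V : finType) (e : rel V).

Definition rel_within (A : {set V}) : rel V :=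
  [rel x y | [&& e x y, x \in A & y \in A]].

Definition connected_in (A : {set V}) : bool :=
  [forall x in A, forall y in A, connect (rel_within A) x y].

Definition touches (A B : {set V}) : bool :=
  [exists x in A, exists y in B, e x y].

Definition disjoint_sets (A B : {set V}) : bool := [disjoint A & B].

(** The six sets are the branch sets of a K_{3,3} minor. The empty set passes [connected_in], but
    [touches] forces them to be nonempty. *)
Definition K33_free : Prop := forall s t : seq {set V},
  size s = 3 -> size t = 3 -> all connected_in (s ++ t) ->
  pairwise disjoint_sets (s ++ t) -> allrel touches s t -> False.

Lemma connected_inP (A : {set V}) :
  reflect {in A &, forall x y, connect (rel_within A) x y} (connected_in A).
Proof.
apply: (iffP forall_inP) => [h x y xA yA|h x xA].
  by move/forall_inP: (h x xA); apply.
by apply/forall_inP => y yA; apply: h.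
Qed.

Lemma touchesP (A B : {set V}) :
  reflect (exists x y, [/\ x \in A, y \in B & e x y]) (touches A B).
Proof.
apply: (iffP exists_inP) => [[x xA /exists_inP[y yB exy]]|[x [y [xA yB exy]]]].
  by exists x, y.
by exists x => //; apply/exists_inP; exists y.
Qed.

Lemma touches_sub (A A' B B' : {set V}) :
  A \subset A' -> B \subset B' -> touches A B -> touches A' B'.
Proof.
move=> /subsetP sA /subsetP sB /touchesP[x [y [xA yB exy]]].
by apply/touchesP; exists x, y; split; [apply: sA|apply: sB|].
Qed.

Lemma connect_within_sub (A B : {set V}) x y :
  A \subset B -> connect (rel_within A) x y -> connect (rel_within B) x y.
Proof.
move=> /subsetP sAB; apply: connect_sub => {}x {}y /and3P[exy xA yA].
by apply: connect1; apply/and3P; split=> //; apply: sAB.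
Qed.

Lemma connected_in0 : connected_in set0.
Proof. by apply/connected_inP => x y; rewrite inE. Qed.

Lemma connected_in1 x : connected_in [set x].
Proof. by apply/connected_inP => y z /set1P-> /set1P->; exact: connect0. Qed.

Lemma touches1 x y : touches [set x] [set y] = e x y.
Proof.
apply/touchesP/idP => [[x' [y' [/set1P-> /set1P->]]] //|exy].
by exists x, y; rewrite !inE.
Qed.

Lemma connected_in_center c (A : {set V}) : symmetric e ->
  {in A, forall x, connect (rel_within A) c x} -> connected_in A.
Proof.
move=> symE h; apply/connected_inP => x y xA yA.
apply: connect_trans (h y yA); rewrite sym_connect_sym ?h // => u v.
by rewrite /rel_within /= symE [(u \in A) && _]andbC.
Qed.

Lemma K33_free_points a b c x y z : K33_free ->
  uniq [:: a; b; c; x; y; z] ->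
  allrel e [:: a; b; c] [:: x; y; z] -> False.
Proof.
move=> K33 un adj.
apply: (K33 (map set1 [:: a; b; c]) (map set1 [:: x; y; z])) => //.
- by rewrite -map_cat all_map; apply/allP => u _; exact: connected_in1.
- rewrite -map_cat pairwise_map.
  move: un; rewrite uniq_pairwise; apply: sub_pairwise => u v /= uv.
  by rewrite /disjoint_sets disjoints1 inE.
by rewrite allrel_mapl allrel_mapr; apply: sub_allrel adj => u v; rewrite touches1.
Qed.

End Blocks.

Section Minor.

Variables (I V : finType) (e : rel V) (e' : rel I) (h : I -> {set V}).
Hypothesis h_connected : forall i, connected_in e (h i).
Hypothesis h_disjoint : forall i j, i != j -> [disjoint h i & h j].
Hypothesis h_touches : forall i j, e' i j -> touches e (h i) (h j).

Let hull (S : {set I}) := \bigcup_(i in S) h i.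

Let hull_connected S : connected_in e' S -> connected_in e (hull S).
Proof.
move=> /connected_inP cS; apply/connected_inP => x y /bigcupP[i iS xi] /bigcupP[j jS yj].
have /connectP[p] := cS i j iS jS.
elim: p i x iS xi => [|k p IH] i x iS xi /=.
  move=> _ ji; subst j; move/connected_inP: (h_connected i) => /(_ x y xi yj).
  by apply: connect_within_sub; exact: bigcup_sup.
case/andP => /and3P[eik _ kS] pp lp.
have /touchesP[u [v [ui vk euv]]] := h_touches eik.
apply: (connect_trans (y := u)).
  move/connected_inP: (h_connected i) => /(_ x u xi ui).
  by apply: connect_within_sub; exact: bigcup_sup.
apply: (connect_trans (y := v)); last exact: IH kS vk pp lp.
by apply: connect1; apply/and3P; split=> //; apply/bigcupP; [exists i|exists k].
Qed.

(** Branch sets pull back to the unions of their images under [h]. An empty [h i] is allowed and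
    amounts to deleting [i]. *)
Lemma minor_K33_free : K33_free e -> K33_free e'.
Proof.
move=> K33 s t ss st cn dj tc.
apply: (K33 (map hull s) (map hull t)); rewrite ?size_map //.
- by rewrite -map_cat all_map; apply: sub_all cn => S; exact: hull_connected.
- rewrite -map_cat pairwise_map; apply: sub_pairwise dj => S T dST.
  rewrite /= /disjoint_sets -setI_eq0; apply/eqP/setP => x; rewrite in_setI in_set0.
  apply/negP => /andP[/bigcupP[i iS xi] /bigcupP[j jT xj]].
  have [ij|ij] := eqVneq i j.
    by move: (disjointFr dST iS); rewrite ij jT.
  by move: (disjointFr (h_disjoint ij) xi); rewrite xj.
- rewrite allrel_mapl allrel_mapr; apply: sub_allrel tc => S T.
  move=> /touchesP[i [j [iS jT eij]]].
  by apply: touches_sub (h_touches eij); exact: bigcup_sup.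
Qed.

End Minor.

(** * Linear edge bound by deletion and contraction *)

Section EdgeCount.

Variable V : finType.

(** Ordered pairs, hence twice the number of edges inside [S]. *)
Definition num_adj (e : rel V) (S : {set V}) : nat :=
  \sum_(x in S) \sum_(y in S) e x y.

Definition degree_in (e : rel V) (S : {set V}) x : nat := \sum_(y in S) e x y.

Lemma degree_inE (e : rel V) (S : {set V}) x : degree_in e S x = #|[set y in S | e x y]|.
Proof.
rewrite -sum1_card [RHS]big_mkcond /degree_in [LHS]big_mkcond; apply: eq_bigr => y _.
by rewrite inE; case: (y \in S); case: (e x y).
Qed.

Lemma num_adjD1 (e : rel V) (S : {set V}) x : symmetric e -> irreflexive e -> x \in S ->
  num_adj e S = num_adj e (S :\ x) + 2 * degree_in e (S :\ x) x.
Proof.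
move=> symE irrE xS; rewrite /num_adj (big_setD1 x) //=.
rewrite (big_setD1 x) //= irrE add0n.
have -> : \sum_(y in S :\ x) \sum_(z in S) e y z =
  \sum_(y in S :\ x) (e y x + \sum_(z in S :\ x) e y z).
  by apply: eq_bigr => y _; rewrite (big_setD1 x).
rewrite big_split /= -/(degree_in e (S :\ x) x).
have -> : \sum_(y in S :\ x) e y x = degree_in e (S :\ x) x.
  by apply: eq_bigr => y _; rewrite symE.
by lia.
Qed.

Lemma degree_in_ltn (e : rel V) (S : {set V}) x : irreflexive e -> x \in S ->
  degree_in e S x < #|S|.
Proof.
move=> irrE xS; rewrite degree_inE; apply: proper_card; apply/properP; split.
  by apply/subsetP => y; rewrite inE => /andP[].
by exists x; rewrite // inE irrE andbF.
Qed.

End EdgeCount.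

Section Contraction.

Variables (V : finType) (e : rel V).
Hypotheses (e_sym : symmetric e) (e_irr : irreflexive e).

(** The vertex [b] is merged into [a] and survives as an isolated vertex, so the type of vertices
    does not change along an induction. *)
Definition contract (a b : V) : rel V :=
  [rel x y | [&& x != b, y != b, x != y &
    [|| e x y, (x == a) && e b y | (y == a) && e b x]]].

Lemma contract_sym a b : symmetric (contract a b).
Proof.
move=> x y; rewrite /contract /= eq_sym e_sym andbCA [(x == a) && _ || _]orbC.
by rewrite [y == x]eq_sym.
Qed.

Lemma contract_irr a b : irreflexive (contract a b).
Proof. by move=> x; rewrite /contract /= eqxx !andbF. Qed.

Lemma contract_K33_free a b : e a b -> K33_free e -> K33_free (contract a b).
Proof.
move=> eab; pose h x := if x == b then set0 else if x == a then [set a; b] else [set x].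
have nab : a != b by apply: contraTneq eab => ->; rewrite e_irr.
apply: (@minor_K33_free _ _ _ _ h) => [x|x y xy|x y /and4P[xb yb xy exy]].
- rewrite /h; case: eqP => _; first exact: connected_in0.
  case: eqP => _; last exact: connected_in1.
  apply: (@connected_in_center _ _ a) => // y /set2P[]->; first exact: connect0.
  by apply: connect1; rewrite /rel_within /= eab !inE !eqxx orbT.
- rewrite -setI_eq0; apply/eqP/setP => z; rewrite !inE.
  apply: contra_neqF xy => /andP[].
  have hP u : z \in h u -> (u != b) && ((z == u) || (u == a) && (z == b)).
    rewrite /h; case: eqP => _; first by rewrite inE.
    by case: eqP => [->|_]; rewrite !inE ?orbF.
  move=> /hP/andP[xb /orP[/eqP zx|/andP[/eqP xa /eqP zb]]];
    move=> /hP/andP[yb /orP[/eqP zy|/andP[/eqP ya /eqP zb']]].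
  + by rewrite -zx.
  + by rewrite -zx zb' eqxx in xb.
  + by rewrite -zy zb eqxx in yb.
  + by rewrite xa.
- have hx z : z != b -> z \in h z.
    by move=> zb; rewrite /h (negbTE zb); case: eqP => [->|_]; rewrite !inE eqxx.
  have hb : b \in h a by rewrite /h (negbTE nab) eqxx !inE eqxx orbT.
  apply/touchesP; case/or3P: exy => [exy|/andP[/eqP xa eby]|/andP[/eqP ya ebx]].
  + by exists x, y; split=> //; apply: hx.
  + by exists b, y; split=> //; [rewrite xa|apply: hx].
  + by exists x, b; split=> //; [apply: hx|rewrite ya|rewrite e_sym].
Qed.

Definition common_in (S : {set V}) a b : nat := \sum_(y in S) (e a y && e b y).

(** Contraction loses the edge [a b] and one edge for each common neighbour, every loss being
    counted in both orders. *)
Lemma num_adj_contract (S : {set V}) a b : a \in S -> b \in S -> e a b ->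
  num_adj e S = num_adj (contract a b) (S :\ b) + 2 + 2 * common_in S a b.
Proof.
move=> aS bS eab; have nab : a != b by apply: contraTneq eab => ->; rewrite e_irr.
have aSb : a \in S :\ b by rewrite !inE nab.
rewrite (num_adjD1 e_sym e_irr bS) (num_adjD1 e_sym e_irr aSb).
rewrite (num_adjD1 (contract_sym a b) (contract_irr a b) aSb).
set T := S :\ b :\ a.
have TP y : y \in T -> (y != a) && (y != b) by rewrite !inE => /and3P[-> ->].
have -> : num_adj (contract a b) T = num_adj e T.
  apply: eq_bigr => x /TP/andP[xa xb]; apply: eq_bigr => y /TP/andP[ya yb].
  rewrite /contract /= xb yb (negbTE xa) (negbTE ya) /= orbF.
  by case: eqVneq => [->|//]; rewrite e_irr.
have -> : degree_in (contract a b) T a = \sum_(y in T) (e a y || e b y).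
  apply: eq_bigr => y /TP/andP[ya yb].
  by rewrite /contract /= nab yb eq_sym ya eqxx (negbTE ya) orbF.
have -> : degree_in e (S :\ b) b = 1 + degree_in e T b.
  by rewrite /degree_in (big_setD1 a aSb) /= e_sym eab.
have -> : common_in S a b = \sum_(y in T) (e a y && e b y).
  rewrite /common_in (big_setD1 b bS) /= e_irr andbF (big_setD1 a aSb) /=.
  by rewrite e_irr.
have : \sum_(y in T) (e a y || e b y) + \sum_(y in T) (e a y && e b y) =
  degree_in e T a + degree_in e T b.
  by rewrite /degree_in -!big_split; apply: eq_bigr => y _; case: (e a y); case: (e b y).
rewrite -/T; lia.
Qed.

End Contraction.

(* Count the paths of length two inside [N]. *)
Lemma three_common (V : finType) (e : rel V) (N : {set V}) :
  symmetric e -> N != set0 -> #|N| <= 13 ->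
  {in N, forall y, 6 <= degree_in e N y} ->
  exists u v, [/\ u \in N, v \in N, u != v & 3 <= common_in e N u v].
Proof.
move=> symE N0 N13 deg6.
case: (boolP [exists u in N, exists v in N, (u != v) && (3 <= common_in e N u v)]).
  by move=> /exists_inP[u uN /exists_inP[v vN /andP[uv c]]]; exists u, v.
move=> /exists_inPn no.
(* Each centre [w] has at least 6 * 5 ordered pairs of neighbours. If all pairs had at most 2 common
   neighbours, the total would be at most 12 * 2 per vertex [u]. *)
have cherries w : w \in N ->
    30 <= \sum_(u in N) \sum_(v in N | u != v) (e u w && e v w).
  move=> wN.
  have -> : \sum_(u in N) \sum_(v in N | u != v) (e u w && e v w) =
            \sum_(u in N) (e u w : nat) * (degree_in e N w).-1.
    apply: eq_bigr => u uN; case euw: (e u w); last by rewrite big1 // => v _.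
    rewrite mul1n /degree_in (big_setD1 u uN) /= symE euw add1n /=.
    by apply: eq_big => [v|v _]; [rewrite !inE eq_sym andbC|rewrite symE].
  rewrite -big_distrl /=.
  have -> : \sum_(u in N) (e u w : nat) = degree_in e N w.
    by apply: eq_bigr => u _; rewrite symE.
  by have := deg6 w wN; nia.
have : \sum_(w in N) 30 <= \sum_(w in N) \sum_(u in N) \sum_(v in N | u != v) (e u w && e v w).
  by apply: leq_sum => w; exact: cherries.
rewrite sum_nat_const exchange_big /=.
have : \sum_(u in N) \sum_(w in N) \sum_(v in N | u != v) (e u w && e v w)
   <= \sum_(u in N) 24.
  apply: leq_sum => u uN; rewrite exchange_big /=.
  have -> : 24 = 12 * 2 by [].
  apply: (leq_trans (n := \sum_(v in N | u != v) 2)).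
    apply: leq_sum => v /andP[vN uv].
    have /exists_inPn/(_ v vN) := no u uN; rewrite uv -ltnNge ltnS; apply.
  rewrite sum_nat_const leq_mul2r /=.
  rewrite -ltnS; apply: leq_trans N13.
  apply: proper_card; apply/properP; split; first by apply/subsetP => v /andP[].
  by exists u => //; rewrite /in_mem /= eqxx andbF.
rewrite sum_nat_const.
have : 0 < #|N| by rewrite card_gt0.
lia.
Qed.

(** In a minimal counterexample deletion excludes degrees below 7, and contraction puts every edge
    in at least 6 triangles. The neighbourhood of a vertex [x] of degree at most 13 then has minimum
    degree 6, so [three_common] yields [u], [v] and three common neighbours in it, which form a
    K_{3,3} with [x], [u], [v]. *)
Theorem num_adj_linear (V : finType) (e : rel V) (S : {set V}) :
  symmetric e -> irreflexive e -> K33_free e -> num_adj e S <= 12 * #|S|.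
Proof.
move: {2}#|S| (leqnn #|S|) => n; elim: n e S => [|n IH] e S leS symE irrE K33.
  move: leS; rewrite leqn0 cards_eq0 => /eqP->.
  by rewrite /num_adj big_set0.
rewrite leqNgt; apply/negP => big.
have cS x : x \in S -> #|S| = (#|S :\ x|).+1 by move=> xS; rewrite (cardsD1 x) xS.
have degE x : x \in S -> degree_in e (S :\ x) x = degree_in e S x.
  by move=> xS; rewrite [RHS]/degree_in (big_setD1 x) //= irrE.
have del x : x \in S -> 12 * #|S| < 12 * #|S| - 12 + 2 * degree_in e S x.
  move=> xS; have := IH e (S :\ x) _ symE irrE K33.
  move: leS big; rewrite (num_adjD1 symE irrE xS) (degE x xS) (cS x xS); lia.
(* With at most 13 vertices all degrees are at most 12 and the bound holds outright. *)
have S14 : 14 <= #|S|.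
  rewrite leqNgt; apply/negP => lt14; move: big.
  suff : num_adj e S <= \sum_(x in S) 12 by rewrite sum_nat_const; lia.
  by apply: leq_sum => x xS; have := degree_in_ltn irrE xS; rewrite /degree_in; lia.
(* For a vertex of minimum degree d, deletion gives |S| d <= 12 (|S| - 1) + 2 d, which excludes d >=
   14 once |S| >= 14. *)
have [x xS x13] : exists2 x, x \in S & degree_in e S x <= 13.
  have S0 : 0 < #|S| by lia.
  have [x0 x0S] : exists x0, x0 \in S by apply/set0Pn; rewrite -card_gt0.
  case: (arg_minnP (degree_in e S) x0S) => x xS xmin.
  exists x => //; rewrite leqNgt; apply/negP => d14.
  have : \sum_(y in S) degree_in e S x <= num_adj e S by apply: leq_sum => y /xmin.
  have := IH e (S :\ x) _ symE irrE K33.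
  rewrite sum_nat_const.
  move: leS big; rewrite (num_adjD1 symE irrE xS) (degE x xS) (cS x xS).
  by rewrite (cS x xS) in S14; nia.
pose N := [set y in S | e x y].
have cN : #|N| = degree_in e S x by rewrite degree_inE.
have xN : x \notin N by rewrite inE irrE andbF.
have [||y yN|u [v [uN vN uv c3]]] := @three_common V e N symE.
- by have := del x xS; rewrite -card_gt0 cN; lia.
- by rewrite cN.
- have [yS exy] : y \in S /\ e x y by move: yN; rewrite inE => /andP.
  have := num_adj_contract symE irrE xS yS exy.
  have := IH (contract e x y) (S :\ y) _ (contract_sym symE x y)
    (contract_irr _ x y) (contract_K33_free symE irrE exy K33).
  move: leS big; rewrite (cS y yS) => leS big /(_ leS) b1 eq.
  suff <- : common_in e S x y = degree_in e N y by lia.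
  rewrite /common_in /degree_in [RHS]big_mkcond [LHS]big_mkcond; apply: eq_bigr => z _.
  by rewrite inE; case: (z \in S); case: (e x z).
have cE : common_in e N u v = #|[set y in N | e u y && e v y]|.
  rewrite -sum1_card /common_in [RHS]big_mkcond [LHS]big_mkcond; apply: eq_bigr => y _.
  by rewrite inE; case: (y \in N); case: (e u y && _).
move: c3; rewrite cE cardE => c3.
case E: (enum _) c3 => [|a [|b [|c s]]] // _.
have abcP y : y \in [:: a; b; c] -> [&& y \in N, e u y & e v y].
  move=> yabc; have : y \in enum [set y in N | e u y && e v y].
    by rewrite E !inE; move: yabc; rewrite !inE => /or3P[] ->; rewrite ?orbT.
  by rewrite mem_enum inE.
have NE y : (y \in N) -> e x y by rewrite inE => /andP[].
have [/and3P[aN ua va] /and3P[bN ub vb] /and3P[cN' uc vc]] :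
  [/\ [&& a \in N, e u a & e v a], [&& b \in N, e u b & e v b] & [&& c \in N, e u c & e v c]].
  by split; apply: abcP; rewrite !inE eqxx ?orbT.
apply: (@K33_free_points V e x u v a b c K33); last first.
  by rewrite /allrel /= !NE // ua ub uc va vb vc.
have : uniq (enum [set y in N | e u y && e v y]) by exact: enum_uniq.
rewrite E /= !inE !negb_or => /and4P[/and3P[ab ac _] /andP[bc _] _ _].
have neN y : y \in N -> x != y by apply: contraTneq => <-.
have neE z y : e z y -> z != y by apply: contraTneq => <-; rewrite irrE.
by rewrite !neN ?uv ?ab ?ac ?bc // !neE.
Qed.

(** * Degeneracy orders and disjoint connectors *)

Section SparseGraphs.

Variables (V : finType) (e : rel V).
Hypotheses (e_sym : symmetric e) (e_irr : irreflexive e) (e_K33 : K33_free e).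

Definition nbrs (v : V) : {set V} := [set u | e v u].

Lemma card_bigcup_le (I T : finType) (A : {set I}) (F : I -> {set T}) :
  #|\bigcup_(i in A) F i| <= \sum_(i in A) #|F i|.
Proof.
elim/big_rec2: _ => [|i n B _ le]; first by rewrite cards0.
by rewrite (leq_trans (leq_card_setU _ _)) // leq_add2l.
Qed.

Lemma card_bigcup_const (I T : finType) (A : {set I}) (F : I -> {set T}) k :
  {in A, forall i, #|F i| <= k} -> #|\bigcup_(i in A) F i| <= #|A| * k.
Proof.
move=> h; apply: leq_trans (card_bigcup_le _ _) _.
by rewrite -sum_nat_const; apply: leq_sum.
Qed.

Lemma hubs_card D : D * #|[set v | D <= #|nbrs v|]| <= 12 * #|V|.
Proof.
have := num_adj_linear [set: V] e_sym e_irr e_K33; rewrite cardsT; apply: leq_trans.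
rewrite mulnC -sum_nat_const [X in _ <= X]big_mkcond [X in X <= _]big_mkcond.
apply: leq_sum => v _; rewrite !inE; case: ifP => // le.
apply: leq_trans le _; rewrite -sum1_card [X in X <= _]big_mkcond.
rewrite [X in _ <= X]big_mkcond; apply: leq_sum => u _.
by rewrite !inE; case: (e v u).
Qed.

(** A degeneracy order: the edge bound gives a vertex of degree at most 12, which is put first
    before the rest is ordered by induction. *)
Lemma sparse_order_in (S : {set V}) : exists r : V -> nat,
  {in S &, injective r} /\
  {in S, forall v, #|[set u in S | e v u && (r v < r u)]| <= 12}.
Proof.
move: {2}#|S| (leqnn #|S|) => n; elim: n S => [|n IH] S leS.
  move: leS; rewrite leqn0 cards_eq0 => /eqP->.
  by exists (fun=> 0); split=> [x y|x]; rewrite inE.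
have [->|/set0Pn[x0 x0S]] := eqVneq S set0.
  by exists (fun=> 0); split=> [x y|x]; rewrite inE.
case: (arg_minnP (degree_in e S) x0S) => x x_in xmin; have xS : x \in S by [].
have x12 : degree_in e S x <= 12.
  have S0 : 0 < #|S| by apply/card_gt0P; exists x.
  rewrite -(leq_pmul2r S0); apply: leq_trans (num_adj_linear S e_sym e_irr e_K33).
  by rewrite mulnC -sum_nat_const; apply: leq_sum => y /xmin.
have [|r [rinj r12]] := IH (S :\ x); first by rewrite (cardsD1 x) xS in leS.
exists (fun v => if v == x then 0 else (r v).+1); split=> [u v uS vS|v vS].
  case: (eqVneq u x) => [->|ux]; case: (eqVneq v x) => [->|vx] //= -[].
  by apply: rinj; rewrite !inE ?ux ?vx.
have [->|vx] := eqVneq v x.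
  apply: leq_trans x12; rewrite degree_inE; apply: subset_leq_card.
  by apply/subsetP => u; rewrite !inE => /and3P[-> -> _].
apply: leq_trans (r12 v _); last by rewrite !inE vx.
apply: subset_leq_card; apply/subsetP => u; rewrite !inE => /and3P[uS evu].
by case: eqVneq => //= _; rewrite ltnS uS evu.
Qed.

Lemma sparse_order : exists2 r : V -> nat, injective r &
  forall v, #|[set u | e v u && (r v < r u)]| <= 12.
Proof.
have [r [rinj r12]] := sparse_order_in [set: V].
exists r => [u v|v]; first by apply: rinj; rewrite inE.
apply: leq_trans (r12 v _); last by rewrite inE.
by apply: subset_leq_card; apply/subsetP => u; rewrite !inE.
Qed.

Lemma common_le2 a b c : uniq [:: a; b; c] ->
  #|[set v | [&& e v a, e v b & e v c]]| <= 2.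
Proof.
move=> un; rewrite leqNgt cardE; apply/negP.
case E: (enum _) => [|x [|y [|z s]]] // _.
have xyzP v : v \in [:: x; y; z] -> [&& e v a, e v b & e v c].
  move=> vxyz; have : v \in enum [set v | [&& e v a, e v b & e v c]].
    by rewrite E !inE; move: vxyz; rewrite !inE => /or3P[] ->; rewrite ?orbT.
  by rewrite mem_enum inE.
have [/and3P[xa xb xc] /and3P[ya yb yc] /and3P[za zb zc]] :
  [/\ [&& e x a, e x b & e x c], [&& e y a, e y b & e y c] & [&& e z a, e z b & e z c]].
  by split; apply: xyzP; rewrite !inE eqxx ?orbT.
apply: (@K33_free_points V e x y z a b c e_K33); last first.
  by rewrite /allrel /= xa xb xc ya yb yc za zb zc.
have : uniq (enum [set v | [&& e v a, e v b & e v c]]) by exact: enum_uniq.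
rewrite E /= !inE !negb_or => /and4P[/and3P[xy xz _] /andP[yz _] _ _].
have neE u v : e u v -> u != v by apply: contraTneq => <-; rewrite e_irr.
move: un; rewrite /= !inE !negb_or xy xz yz => /and3P[/andP[-> ->] -> _].
by rewrite (neE _ _ xa) (neE _ _ xb) (neE _ _ xc) (neE _ _ ya) (neE _ _ yb)
  (neE _ _ yc) (neE _ _ za) (neE _ _ zb) (neE _ _ zc).
Qed.

(** Greedy choice: one set meets at most s * k of the sets, so two chosen indices exclude at most 2
    * s * k candidates for the third. *)
Lemma disjoint_three (I : finType) (D : {set I}) (S : I -> {set V}) s k :
  {in D, forall i, S i != set0} -> {in D, forall i, #|S i| <= s} ->
  (forall z, #|[set i in D | z \in S i]| <= k) -> 2 * s * k < #|D| ->
  exists i j l, [/\ [&& i \in D, j \in D & l \in D], [disjoint S i & S j],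
    [disjoint S i & S l] & [disjoint S j & S l]].
Proof.
move=> S0 Ss Sk big.
pose M i := [set j in D | ~~ [disjoint S i & S j]].
have cM i : i \in D -> #|M i| <= s * k.
  move=> iD; apply: (@leq_trans #|\bigcup_(z in S i) [set j in D | z \in S j]|).
    apply: subset_leq_card; apply/subsetP => j; rewrite inE => /andP[jD].
    rewrite -setI_eq0 => /set0Pn[z /setIP[zi zj]].
    by apply/bigcupP; exists z; rewrite // inE jD.
  apply: leq_trans (card_bigcup_const (k := k) _) _ => [z _|]; first exact: Sk.
  by rewrite leq_mul2r Ss ?orbT.
have pick (X : {set I}) : #|X| < #|D| -> exists2 i, i \in D & i \notin X.
  move=> lt; case: (boolP (D \subset X)) => [/subset_leq_card|/subsetPn[i iD iX]].
    by rewrite leqNgt lt.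
  by exists i.
have [|i iD _] := pick set0; first by rewrite cards0; lia.
have := cM i iD => ci.
have [|j jD jM] := pick (M i); first by nia.
have := cM j jD => cj.
have [|l lD] := pick (M i :|: M j).
  by apply: leq_ltn_trans (leq_card_setU _ _) _; nia.
rewrite !inE lD /= negb_or !negbK => /andP[il jl].
exists i, j, l; split; rewrite ?iD ?jD //.
by move: jM; rewrite inE jD negbK.
Qed.

(* Three disjoint connected sets that all touch [b], [c] and [d] form a
   K_{3,3} with these three vertices. *)
Lemma connectors_card (I : finType) (D : {set I}) (S : I -> {set V}) s k b c d :
  uniq [:: b; c; d] ->
  {in D, forall i, connected_in e (S i)} ->
  {in D, forall i x, x \in [:: b; c; d] -> (x \notin S i) /\ exists2 y, y \in S i & e y x} ->
  {in D, forall i, #|S i| <= s} ->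
  (forall z, #|[set i in D | z \in S i]| <= k) -> #|D| <= 2 * s * k.
Proof.
move=> un cn tc Ss Sk; rewrite leqNgt; apply/negP => big.
have S0 : {in D, forall i, S i != set0}.
  move=> i iD; apply/set0Pn.
  by have [|_ [y yS _]] := tc i iD b; [rewrite inE eqxx|exists y].
have [i [j [l [/and3P[iD jD lD] ij il jl]]]] := disjoint_three S0 Ss Sk big.
apply: (e_K33 (s := [:: S i; S j; S l]) (t := map set1 [:: b; c; d])) => //.
- by rewrite /= !cn // !connected_in1.
- have out x y : x \in D -> y \in [:: b; c; d] -> [disjoint S x & [set y]].
    by move=> xD yb; rewrite disjoint_sym disjoints1; have [] := tc x xD y yb.
  rewrite /= /disjoint_sets ij il jl !out ?inE ?eqxx ?orbT //= !disjoints1 !inE.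
  by move: un; rewrite /= !inE !negb_or => /and3P[/andP[-> ->] -> _].
- have tch x y : x \in D -> y \in [:: b; c; d] -> touches e (S x) [set y].
    move=> xD yb; have [_ [z zS ezy]] := tc x xD y yb.
    by apply/touchesP; exists z, y; rewrite inE.
  by rewrite /allrel /= !tch // !inE eqxx ?orbT.
Qed.

End SparseGraphs.

Lemma num_adj_ltn (V : finType) (e e' : rel V) (S : {set V}) x y :
  (forall u v, e u v -> e' u v) -> x \in S -> y \in S -> ~~ e x y -> e' x y ->
  num_adj e S < num_adj e' S.
Proof.
move=> sub xS yS exy exy'; rewrite /num_adj (big_setD1 x xS) [X in _ < X](big_setD1 x xS) /=.
rewrite (big_setD1 y yS) [\sum_(_ in S) e' x _](big_setD1 y yS) /= (negbTE exy) exy'.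
have le u v : e u v <= e' u v by case E: (e u v) => //; rewrite sub.
rewrite add0n add1n addSn ltnS leq_add //; apply: leq_sum => u _ //.
by apply: leq_sum.
Qed.

(** * Vertices with three neighbours in a small set *)

Section ThreeNeighbours.

Variables (V : finType) (e : rel V).
Hypotheses (e_sym : symmetric e) (e_irr : irreflexive e) (e_K33 : K33_free e).
Variables (P Q : {set V}).
Hypothesis QP : [disjoint Q & P].
Hypothesis Q3 : {in Q, forall q, 3 <= #|nbrs e q :&: P|}.

(* [f] contracts [q] into [f q] when [f q] lies in [P]. *)
Let valid (f : {ffun V -> V}) := [forall q in Q, (f q \in P) ==> e q (f q)].

Let h (f : {ffun V -> V}) (p : V) : {set V} :=
  if p \in P then p |: [set q in Q | f q == p] else set0.

Let H (f : {ffun V -> V}) : rel V :=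
  [rel x y | (x != y) && touches e (h f x) (h f y)].

Let H_sym f : symmetric (H f).
Proof.
suff tr x y : H f x y -> H f y x by move=> x y; apply/idP/idP; exact: tr.
case/andP=> xy /touchesP[u [v [ux vy euv]]]; rewrite /H /= eq_sym xy.
by apply/touchesP; exists v, u; rewrite e_sym.
Qed.

Let H_irr f : irreflexive (H f).
Proof. by move=> x; rewrite /H /= eqxx. Qed.

Let H_K33 f : valid f -> K33_free (H f).
Proof.
move=> /forall_inP vf; apply: (@minor_K33_free _ _ e _ (h f)) => // [p|p p' pp'|p p' /andP[]//].
- rewrite /h; case: ifP => pP; last exact: connected_in0.
  apply: (@connected_in_center _ _ p) => // q; rewrite !inE.
  case/orP => [/eqP->|/andP[qQ /eqP fq]]; first exact: connect0.
  apply: connect1; rewrite /rel_within /= !inE eqxx qQ fq eqxx orbT /= andbT e_sym.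
  by rewrite -fq (implyP (vf q qQ)) // fq.
- rewrite -setI_eq0; apply/eqP/setP => z; rewrite in_setI in_set0 /h.
  case: ifP => pP; last by rewrite inE.
  case: ifP => pP'; last by rewrite [z \in set0]inE andbF.
  rewrite !inE; apply/negP => /andP[/orP[/eqP zp|/andP[zQ /eqP fz]]].
    rewrite zp (negbTE pp') /= => /andP[pQ _].
    by move: (disjointFr QP pQ); rewrite pP.
  rewrite fz (negbTE pp') andbF orbF => /eqP zp'.
  by move: (disjointFr QP zQ); rewrite zp' pP'.
Qed.

(** The factor 2 makes a single new adjacency inside [P] outweigh the loss of one uncontracted
    vertex. *)
Let key (f : {ffun V -> V}) := 2 * num_adj (H f) P + #|[set q in Q | f q \notin P]|.

(** At a maximum of [key] the neighbours in [P] of an uncontracted vertex are pairwise adjacent in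
    [H f], as contracting the vertex would otherwise pay off. Since [H f] is 12-degenerate, that
    vertex is a common neighbour of its lowest neighbour [p] and of two of the at most 12 higher
    neighbours of [p]: at most 12 * 12 * 2 = 288 vertices per [p]. The edges of [H f] give the
    remaining 2 * 12 of the constant, and the map that contracts nothing shows that the maximum is
    at least |Q|. *)
Lemma degree3_card : #|Q| <= 312 * #|P|.
Proof.
pose id0 : {ffun V -> V} := [ffun v => v].
have v0 : valid id0.
  apply/forall_inP => q qQ; rewrite ffunE.
  by rewrite (disjointFr QP qQ).
case: (arg_maxnP key v0) => f vf fmax.
have fkey : #|Q| <= key f.
  apply: leq_trans (fmax _ v0); rewrite /key.
  suff -> : [set q in Q | id0 q \notin P] = Q by lia.
  by apply/setP => q; rewrite !inE ffunE; case qQ: (q \in Q) => //; rewrite (disjointFr QP qQ).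
set Q0 := [set q in Q | f q \notin P] in fkey *.
have tri q p p' : q \in Q0 -> e q p -> e q p' -> p \in P -> p' \in P -> p != p' ->
    H f p p'.
  rewrite inE => /andP[qQ fq] eqp eqp' pP pP' pp'; apply/negPn/negP => nH.
  pose f' : {ffun V -> V} := [ffun v => if v == q then p else f v].
  have vf' : valid f'.
    apply/forall_inP => v vQ; rewrite ffunE; case: eqP => [->|_].
      by rewrite eqp implybT.
    by move/forall_inP: vf; apply.
  have hsub x : h f x \subset h f' x.
    apply/subsetP => v; rewrite /h; case: ifP => // xP; rewrite !inE ffunE.
    case/orP => [->//|/andP[vQ /eqP fv]]; rewrite vQ; case: (v =P q) => [vq|_].
      by rewrite -vq fv xP in fq.
    by rewrite fv eqxx orbT.
  have lt : num_adj (H f) P < num_adj (H f') P.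
    apply: (num_adj_ltn _ pP pP' nH) => [x y /andP[xy]|].
      by rewrite /H /= xy; apply: touches_sub.
    rewrite /H /= pp'; apply/touchesP; exists q, p'; split=> //.
      by rewrite /h pP !inE qQ ffunE !eqxx orbT.
    by rewrite /h pP' !inE eqxx.
  have := fmax _ vf'; rewrite /key -/Q0.
  apply/negP; rewrite -ltnNge.
  suff lt' : #|Q0| <= #|[set q0 in Q | f' q0 \notin P]|.+1.
    have ar (i j k l : nat) : i < j -> k <= l.+1 -> 2 * i + k < 2 * j + l by clear; lia.
    exact: ar lt lt'.
  rewrite (cardsD1 q Q0) -add1n leq_add ?leq_b1 //; apply: subset_leq_card.
  by apply/subsetP => v; rewrite !inE ffunE => /andP[/negbTE->].
have [r rinj r12] := sparse_order (H_sym f) (H_irr f) (H_K33 vf).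
pose N p := [set u | H f p u && (r p < r u)].
pose K p := \bigcup_(u in N p) \bigcup_(v in N p :\ u) [set q | [&& e q p, e q u & e q v]].
have cK p : #|K p| <= 288.
  apply: leq_trans (card_bigcup_const (k := 24) _) _ => [u uN|].
    apply: leq_trans (card_bigcup_const (k := 2) _) _ => [v vN|].
      apply: common_le2 => //=; move: uN vN; rewrite !inE => /andP[/andP[pu _] _].
      by case/and3P=> vu /andP[pv _] _; rewrite negb_or pu pv eq_sym vu.
    have : #|N p :\ u| <= #|N p| by rewrite [X in _ <= X](cardsD1 u) leq_addl.
    by have := r12 p; rewrite -/(N p); lia.
  by have := r12 p; rewrite -/(N p); lia.
suff sub : Q0 \subset \bigcup_(p in P) K p.
  have := leq_trans (subset_leq_card sub) (card_bigcup_const (k := 288) (fun p _ => cK p)).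
  have := num_adj_linear P (H_sym f) (H_irr f) (H_K33 vf).
  by move: fkey; rewrite /key -/Q0; lia.
apply/subsetP => q qQ0; have qQ : q \in Q by move: qQ0; rewrite inE => /andP[].
have /card_gt0P[p0 p0N] : 0 < #|nbrs e q :&: P| by have := Q3 qQ; lia.
case: (arg_minnP r p0N) => p p_in pmin.
have /setIP[] : p \in nbrs e q :&: P by [].
rewrite inE => eqp pP.
have c2 : 1 < #|(nbrs e q :&: P) :\ p|.
  by have := Q3 qQ; rewrite (cardsD1 p) !inE eqp pP.
have /card_gt1P[u [v [uN vN uv]]] := c2.
move: uN vN; rewrite !inE => /and3P[up equ uP] /and3P[vp eqv vP].
have lt w : w != p -> e q w -> w \in P -> r p < r w.
  move=> wp eqw wP; have wN : w \in nbrs e q :&: P by rewrite !inE eqw.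
  rewrite ltn_neqAle (pmin w wN) andbT; by apply: contra wp => /eqP/rinj ->.
apply/bigcupP; exists p => //; apply/bigcupP; exists u.
  by rewrite inE (tri q) ?lt // eq_sym.
apply/bigcupP; exists v; last by rewrite inE eqp equ eqv.
by rewrite !inE eq_sym uv (tri q) ?lt // eq_sym.
Qed.

End ThreeNeighbours.

(** * Edges joining two neighbourhoods *)

Section Rungs.

Variable V : finType.

Definition rungs (e : rel V) (b c : V) (U : {set V}) : nat :=
  \sum_(x in U) \sum_(y in U) [&& e x b, e y c & e x y].

Lemma sum2_setD1 (F : V -> V -> nat) (U : {set V}) x : x \in U ->
  \sum_(y in U) \sum_(z in U) F y z =
  \sum_(y in U :\ x) \sum_(z in U :\ x) F y z + F x x +
  \sum_(y in U :\ x) F x y + \sum_(y in U :\ x) F y x.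
Proof.
move=> xU; rewrite (big_setD1 x xU) /= (big_setD1 x xU) /=.
have -> : \sum_(y in U :\ x) \sum_(z in U) F y z =
  \sum_(y in U :\ x) (F y x + \sum_(z in U :\ x) F y z).
  by apply: eq_bigr => y _; rewrite (big_setD1 x xU).
by rewrite big_split /=; lia.
Qed.

(* A rung whose ends see only [b], respectively only [c], is contracted; when
   no such rung is left, each rung has an end that sees both, and a third such
   neighbour of a vertex would complete a K_{3,3} with [b] and [c]. *)
Lemma rungs_le (e : rel V) b c (U : {set V}) :
  symmetric e -> irreflexive e -> K33_free e ->
  b != c -> b \notin U -> c \notin U -> rungs e b c U <= 2 * #|U|.
Proof.
move: {2}#|U| (leqnn #|U|) => n; elim: n e U => [|n IH] e U leU symE irrE K33 bc bU cU.
  move: leU; rewrite leqn0 cards_eq0 => /eqP->.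
  by rewrite /rungs big_set0.
have neq z y : z \in U -> y \notin U -> (z == y) = false.
  by move=> zU; apply: contraNF => /eqP <-.
case: (boolP [exists x in U, exists y in U,
    [&& e x b, ~~ e x c, e y c, ~~ e y b & e x y]]).
  (* After [y] is merged into [x], the vertex [x] sees both [b] and [c], so all rungs at [x] and at
     [y] survive except [x y] itself. One rung is paid by one vertex. *)
  case/exists_inP => x xU /exists_inP[y yU /and5P[xb xc yc yb exy]].
  have xy : x != y by apply: contraTneq exy => ->; rewrite irrE.
  have xUy : x \in U :\ y by rewrite !inE xy.
  have := IH (contract e x y) (U :\ y) _ (contract_sym symE x y)
    (contract_irr _ x y) (contract_K33_free symE irrE exy K33) bc _ _.
  move: leU; rewrite (cardsD1 y) yU add1n ltnS => leU /(_ leU).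
  rewrite !inE (negbTE bU) (negbTE cU) !andbF => /(_ isT isT).
  rewrite /rungs (sum2_setD1 _ xUy) (sum2_setD1 _ yU).
  rewrite (sum2_setD1 (fun u v => [&& e u b, e v c & e u v] : nat) xUy).
  rewrite (big_setD1 x xUy) /= [\sum_(_ in U :\ y) [&& e _ b, e y c & e _ y]](big_setD1 x xUy) /=.
  set W := U :\ y :\ x; rewrite (negbTE xc) (negbTE yb) xb yc exy !irrE /=.
  have Wn z : z \in W -> [/\ z != x, z != y & z \in U].
    by rewrite !inE => /and3P[-> -> ->].
  have by_ : b != y by rewrite eq_sym neq.
  have cy : c != y by rewrite eq_sym neq.
  have bx : (b == x) = false by rewrite eq_sym neq.
  have cx : (c == x) = false by rewrite eq_sym neq.
  have -> : \sum_(i in W) \sum_(z in W)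
      [&& contract e x y i b, contract e x y z c & contract e x y i z]
    = \sum_(i in W) \sum_(z in W) [&& e i b, e z c & e i z].
    apply: eq_bigr => i /Wn[ix iy iU]; apply: eq_bigr => z /Wn[zx zy zU].
    rewrite /contract /= iy zy by_ cy (negbTE ix) (negbTE zx) bx cx /= !orbF (neq i b) // (neq z c) //=.
    by case: (eqVneq i z) => [->|//]; rewrite irrE !andbF.
  have le1 : \sum_(i in W) [&& true, e i c & e x i] <=
      \sum_(i in W) [&& contract e x y x b, contract e x y i c & contract e x y x i].
    apply: leq_sum => i /Wn[ix iy iU].
    rewrite /contract /= iy xy by_ cy (negbTE ix) cx bx (neq x b) // (neq i c) // eqxx xb [x == i]eq_sym (negbTE ix) /=.
    by rewrite !orbF; case: (e i c); case: (e x i).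
  have le2 : \sum_(i in W) [&& e i b, true & e i y] <=
      \sum_(i in W) [&& contract e x y i b, contract e x y x c & contract e x y i x].
    apply: leq_sum => i /Wn[ix iy iU].
    rewrite /contract /= iy xy by_ cy (negbTE ix) cx bx (neq i b) // (neq x c) // eqxx yc /= [e i y]symE.
    by rewrite !orbF orbT /=; case: (e i b); case: (e y i); rewrite // orbT.
  have -> : \sum_(i in W) (e i b && false) = 0.
    by rewrite big1 // => i _; rewrite andbF.
  rewrite big1_eq.
  have ar (a t p q i j k : nat) : i <= p -> j <= q -> a + t + p + q <= 2 * k ->
    a + 0 + i + 0 + 0 + (0 + 0) + (1 + j) <= 2 * k.+1 by clear; lia.
  exact: ar le1 le2.
move=> /exists_inPn no.
pose full z := e z b && e z c.
have fullE z : full z -> e z b /\ e z c by move/andP.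
have full2 z : z \in U -> \sum_(y in U) (full y && e y z) <= 2.
  move=> zU; have un : uniq [:: z; b; c] by rewrite /= !inE (neq z b) // (neq z c) // (negbTE bc).
  apply: leq_trans (common_le2 irrE K33 un); rewrite -sum1_card.
  rewrite [X in _ <= X]big_mkcond [X in X <= _]big_mkcond; apply: leq_sum => y _.
  by rewrite inE /full; case: ifP => // _; case: (e y b); case: (e y c); case: (e y z).
pose F x y : nat := [&& e x b, full y & e x y].
pose G x y : nat := [&& full x, ~~ full y, e y c & e x y].
(* Each rung is charged to an end whose partner is [full]; in [G] the two ends are exchanged. For
   every [x] one of the two inner sums vanishes, and the other is at most 2 by [full2]. *)
apply: (@leq_trans (\sum_(x in U) (\sum_(y in U) F x y + \sum_(y in U) G y x))).
  rewrite big_split /= [X in _ <= _ + X]exchange_big -big_split /=.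
  apply: leq_sum => x xU; rewrite -big_split /=; apply: leq_sum => y yU.
  have /exists_inPn/(_ y yU) := no x xU.
  rewrite /F /G /full; case: (e x b); case: (e x c); case: (e y b); case: (e y c);
    by case: (e x y).
rewrite mulnC -sum_nat_const; apply: leq_sum => x xU.
case fx: (full x).
  rewrite [X in _ + X]big1 ?addn0 => [|y _]; last by rewrite /G fx andbF.
  apply: leq_trans (full2 x xU); apply: leq_sum => y _.
  by rewrite /F [e y x]symE; case: (e x b); case: (full y); case: (e x y).
have [xb|xb] := boolP (e x b).
  rewrite [X in _ + X]big1 ?addn0 => [|y _]; last first.
    by rewrite /G fx; move: fx; rewrite /full xb /= => ->; rewrite andbF.
  apply: leq_trans (full2 x xU); apply: leq_sum => y _.
  by rewrite /F [e y x]symE; case: (e x b); case: (full y); case: (e x y).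
rewrite [X in X + _]big1 ?add0n => [|y _]; last by rewrite /F (negbTE xb).
apply: leq_trans (full2 x xU); apply: leq_sum => y _.
by rewrite /G; case: (full y); case: (full x); case: (e x c); case: (e y x).
Qed.

End Rungs.

(** * Weights between vertices of high degree *)

Section PairSums.

Variable V : finType.

Lemma card_pairs_set2 (S : {set V}) :
  #|[set p : V * V | (p.1 != p.2) && ([set p.1; p.2] == S)]| <= 2.
Proof.
set P := [set p | _]; have [->|/set0Pn[[u v]]] := eqVneq P set0; first by rewrite cards0.
rewrite inE /= => /andP[uv /eqP SE].
apply: (@leq_trans #|[set (u, v); (v, u)]|); last by rewrite cards2; case: eqP.
apply: subset_leq_card; apply/subsetP => -[x y]; rewrite !inE /= -SE => /andP[xy /eqP E].
have : x \in [set u; v] by rewrite -E !inE eqxx.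
have : y \in [set u; v] by rewrite -E !inE eqxx orbT.
by move: xy; rewrite !inE => xy /orP[]/eqP yE /orP[]/eqP xE; move: xy;
  rewrite xE yE ?eqxx // orbT.
Qed.

(** Each [x] is counted at most for the two orders of the single pair [S x]. *)
Lemma sum_pairs_le (F : V -> V -> {set V}) (X : {set V}) (S : V -> {set V}) :
  (forall u v x, u != v -> x \in F u v -> (x \in X) && ([set u; v] == S x)) ->
  \sum_u \sum_(v | u != v) #|F u v| <= 2 * #|X|.
Proof.
move=> FS; have cF u v : #|F u v| = \sum_x (x \in F u v).
  by rewrite -sum1_card big_mkcond.
under eq_bigr do under eq_bigr do rewrite cF.
rewrite pair_big_dep /= exchange_big /= mulnC -sum_nat_const [X in _ <= X]big_mkcond.
apply: leq_sum => x _; case: ifP => xX.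
  apply: leq_trans (card_pairs_set2 (S x)); rewrite -sum1_card [X in _ <= X]big_mkcond.
  rewrite [X in X <= _]big_mkcond; apply: leq_sum => -[u v] _ /=; rewrite inE /=.
  case: ifP => // uv; case: (boolP (x \in F u v)) => // /(FS _ _ _ uv)/andP[_ SE].
  by rewrite SE.
by rewrite big1 // => -[u v] /= uv; case: (boolP (x \in _)) => // /(FS _ _ _ uv); rewrite xX.
Qed.

End PairSums.

Section Weights.

Variables (V : finType) (e : rel V) (K : nat).
Hypotheses (e_sym : symmetric e) (e_irr : irreflexive e) (e_K33 : K33_free e).
Hypotheses (K_gt0 : 0 < K) (V_le : #|V| <= K ^ 5).

(** Two thresholds are needed. Big hubs number O(K), so that their triples number O(K^3). Vertices
    that are not even [hubs] have degree below K, which keeps the overlap of small connected sets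
    around them at O(K). *)
Definition big_hubs : {set V} := [set v | K ^ 4 <= #|nbrs e v|].
Definition hubs : {set V} := [set v | K <= #|nbrs e v|].
Definition hub_nbrs x : {set V} := nbrs e x :&: hubs.
Definition bad : {set V} := hubs :|: [set x | 3 <= #|hub_nbrs x|].
Definition linked u v : {set V} := [set x in ~: hubs | hub_nbrs x == [set u; v]].

Local Notation B := big_hubs.
Local Notation B' := hubs.

Lemma big_hubs_sub : B \subset B'.
Proof.
apply/subsetP => v; rewrite !inE; apply: leq_trans.
by rewrite -[X in X <= _]expn1 leq_pexp2l.
Qed.

Lemma card_big_hubs : #|B| <= 12 * K.
Proof.
have h := hubs_card e_sym e_irr e_K33 (K ^ 4).
have K4 : 0 < K ^ 4 by rewrite expn_gt0 K_gt0.
rewrite -(leq_pmul2l K4); apply: leq_trans h _.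
by rewrite mulnCA leq_mul2l /= -expnSr.
Qed.

Lemma card_hubs : #|B'| <= 12 * K ^ 4.
Proof.
rewrite -(leq_pmul2l K_gt0).
apply: leq_trans (hubs_card e_sym e_irr e_K33 K) _.
by rewrite mulnCA leq_mul2l /= -expnS.
Qed.

Lemma card_bad : #|bad| <= 313 * (12 * K ^ 4).
Proof.
pose Q := [set x in ~: B' | 3 <= #|hub_nbrs x|].
have sub : bad \subset B' :|: Q.
  by apply/subsetP => x; rewrite /bad /Q !inE; case: (K <= _).
apply: leq_trans (subset_leq_card sub) _; apply: leq_trans (leq_card_setU _ _) _.
have QP : [disjoint Q & B'].
  by rewrite -setI_eq0; apply/eqP/setP => x; rewrite /Q !inE; case: (K <= _); rewrite ?andbF.
have /(degree3_card e_sym e_irr e_K33 QP) : {in Q, forall q, 3 <= #|nbrs e q :&: B'|}.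
  by move=> q; rewrite !inE => /andP[].
by have := card_hubs; rewrite -/B'; lia.
Qed.

Definition reach x : {set V} :=
  [set h in B | e x h || [exists y in ~: B', e x y && e y h]].

(** The possible ends of rungs between the big hubs [b] and [c], made symmetric in the two hubs. *)
Definition ladder b c : {set V} := [set x in ~: B' | [&& b \in B, c \in B &
  e x b && [exists y in ~: B', e x y && e y c] ||
  e x c && [exists y in ~: B', e x y && e y b]]].

Definition clean b c : {set V} :=
  [set x in ladder b c | reach x :|: hub_nbrs x \subset [set b; c]].

(** Designed to bound both [linked u v] and the whole of [ladder u v]. The clean part is merged with
    [linked], because these vertices determine their pair; the unclean part may serve several pairs
    and is estimated separately. *)
Definition weight u v : nat :=
  if u == v then 0 else #|linked u v :|: clean u v| + #|ladder u v :\: clean u v|.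

Lemma ladder_sym b c : ladder b c = ladder c b.
Proof.
by apply/setP => x; rewrite inE [RHS]inE; congr (_ && _); rewrite andbCA orbC.
Qed.

Lemma weight_sym u v : weight u v = weight v u.
Proof.
by rewrite /weight /clean /linked eq_sym ladder_sym setUC [[set u; v]]setUC [in RHS]setUC.
Qed.

Lemma weight_diag u : weight u u = 0. Proof. by rewrite /weight eqxx. Qed.

Lemma linked_weight u v : u != v -> #|linked u v| <= weight u v.
Proof.
move=> uv; rewrite /weight (negbTE uv); apply: leq_trans (leq_addr _ _).
by apply: subset_leq_card; exact: subsetUl.
Qed.

(** Both ends of a rung between low vertices lie in the ladder, so [rungs_le] applies with the
    ladder in place of all low vertices, and the ladder has at most [weight b c] elements. *)
Lemma rungs_weight b c : b != c -> b \in B -> c \in B ->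
  rungs e b c (~: B') <= 2 * weight b c.
Proof.
move=> bc bB cB; have low x : x \in ladder b c -> x \notin B'.
  by rewrite inE => /andP[]; rewrite inE.
have inL h : h \in B -> h \notin ladder b c.
  by move=> hB; apply/negP => /low; rewrite (subsetP big_hubs_sub).
apply: (@leq_trans (rungs e b c (ladder b c))).
  rewrite /rungs big_mkcond [X in _ <= X]big_mkcond; apply: leq_sum => x _.
  case: ifP => xB; last by [].
  apply: (@leq_trans (\sum_(y in ladder b c) [&& e x b, e y c & e x y])).
    rewrite big_mkcond [X in _ <= X]big_mkcond; apply: leq_sum => y _.
    case: ifP => yB //; case: ifP => // yL.
    case: (boolP [&& e x b, e y c & e x y]) => // /and3P[xb yc xy].
    move: yL; rewrite inE yB bB cB /= yc.
    suff -> : [exists y0 in ~: B', e y y0 && e y0 b] by rewrite orbT.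
    by apply/exists_inP; exists x => //; rewrite e_sym xy xb.
  case: ifP => // xL; rewrite big1 // => y yL.
  case: (boolP [&& e x b, e y c & e x y]) => // /and3P[xb yc xy].
  move: xL; rewrite inE xB bB cB /= xb /=.
  suff -> : [exists y0 in ~: B', e x y0 && e y0 c] by [].
  by apply/exists_inP; exists y; rewrite ?xy ?yc // inE low.
apply: leq_trans (rungs_le e_sym e_irr e_K33 bc (inL b bB) (inL c cB)) _.
rewrite leq_mul2l /= /weight (negbTE bc).
rewrite -[X in X <= _](cardsID (clean b c)) leq_add2r; apply: subset_leq_card.
by apply: subset_trans (subsetIr _ _) (subsetUr _ _).
Qed.

Lemma ladder_reach b c x : x \in ladder b c -> [set b; c] \subset reach x.
Proof.
rewrite inE => /andP[_ /and3P[bB cB h]].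
by apply/subsetP => z /set2P[]->; rewrite inE ?bB ?cB /=; case/orP: h => /andP[h1 h2];
  rewrite ?h1 ?h2 ?orbT.
Qed.

(** A vertex with exactly two hub neighbours can only count for these two. Any other vertex counted
    here is clean and not linked, and its pair is [reach]. *)
Lemma sum_clean_le :
  \sum_u \sum_(v | u != v) #|linked u v :|: clean u v| <= 2 * #|V|.
Proof.
rewrite -cardsT; apply: (@sum_pairs_le _ _ _
  (fun x => if #|hub_nbrs x| == 2 then hub_nbrs x else reach x)) => u v x uv.
rewrite in_setT in_setU /= => /orP[].
  by rewrite inE => /andP[_ /eqP->]; rewrite cards2 uv eqxx.
rewrite inE subUset => /andP[xl /andP[rs ns]]; case: ifP => [/eqP n2|_].
  by rewrite eq_sym eqEcard ns n2 cards2 uv.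
by rewrite eqEsubset rs ladder_reach.
Qed.

(** The vertex through which [x] reaches [h], possibly [x] itself. The default does not occur for
    [h] in [reach x]. *)
Definition step x h : V :=
  odflt x [pick y | (y \in x |: (nbrs e x :&: ~: B')) && e y h].

Lemma stepP x h : h \in reach x ->
  [/\ step x h \in x |: (nbrs e x :&: ~: B'), e (step x h) h & h \in B].
Proof.
rewrite inE => /andP[hB hr]; rewrite /step; case: pickP => [y /andP[]//|no].
case/orP: hr => [xh|/exists_inP[y yB /andP[xy yh]]].
  by move: (no x); rewrite setU11 xh.
by move: (no y); rewrite in_setU in_setI yB [y \in nbrs _ _]inE xy orbT yh.
Qed.

Lemma step_near x h : (step x h == x) || e x (step x h) && (step x h \notin B').
Proof.
rewrite /step; case: pickP => [y /andP[+ _]|_] /=; last by rewrite eqxx.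
by rewrite in_setU in_setI in_set1 [y \in nbrs _ _]inE in_setC.
Qed.

Lemma card_nbrs_low z : z \notin B' -> #|nbrs e z| <= K.
Proof. by rewrite inE -ltnNge => /ltnW. Qed.

Lemma cards3_le (a b c : V) : #|[set a; b; c]| <= 3.
Proof.
apply: leq_trans (leq_card_setU _ _) _; rewrite cards1.
by apply: (@leq_trans (2 + 1)); rewrite // leq_add2r cards2; case: eqP.
Qed.

(** Each such [x] with its three steps forms a connected set of at most 4 vertices touching [b], [c]
    and [d]. A low vertex belongs only to the sets centred at itself or at a neighbour, so the
    overlap is at most K + 1 and [connectors_card] applies. *)
Lemma reach3_card b c d : uniq [:: b; c; d] ->
  #|[set x in ~: B' | [&& b \in reach x, c \in reach x & d \in reach x]]| <= 8 * K.+1.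
Proof.
move=> un; set D := [set x in _ | _].
pose S x := x |: [set step x b; step x c; step x d].
have DP x : x \in D -> [/\ x \notin B', b \in reach x, c \in reach x & d \in reach x].
  by rewrite inE in_setC => /andP[-> /and3P[-> -> ->]].
have SP x z : z \in S x -> (z == x) || e x z && (z \notin B').
  rewrite in_setU1 in_setU in_set2 in_set1 -!orbA.
  by case/or4P=> [->//|/eqP->|/eqP->|/eqP->]; exact: step_near.
rewrite (_ : 8 * K.+1 = 2 * 4 * K.+1) //.
apply: (connectors_card e_K33 (S := S) un).
- move=> x xD; apply: (connected_in_center (c := x)) => // z /[dup] zS /SP.
  case/orP=> [/eqP->|/andP[xz _]]; first exact: connect0.
  by apply: connect1; rewrite /rel_within /= xz zS !inE eqxx.
- move=> x xD h hbcd; have [xB xb xc xd] := DP x xD.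
  have hor : [|| h == b, h == c | h == d] by move: hbcd; rewrite !inE.
  have hr : h \in reach x by case/or3P: hor => /eqP->.
  have [_ sh hB] := stepP hr; split.
    apply/negP => /SP/orP[/eqP hx|/andP[_]].
      by move: xB; rewrite -hx (subsetP big_hubs_sub).
    by rewrite (subsetP big_hubs_sub).
  exists (step x h) => //; rewrite /S in_setU1 in_setU in_set2 in_set1.
  by case/or3P: hor => /eqP->; rewrite eqxx ?orbT.
- move=> x _; apply: leq_trans (leq_card_setU _ _) _; rewrite cards1.
  by rewrite (leq_add2l 1 _ 3) cards3_le.
- move=> z; case: (boolP (z \in B')) => zB.
    rewrite (_ : [set i in D | _] = set0) ?cards0 //; apply/setP => x; rewrite in_set0.
    apply/negP; rewrite inE => /andP[/DP[xB _ _ _] /SP/orP[/eqP zx|/andP[_]]].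
      by rewrite -zx zB in xB.
    by rewrite zB.
  apply: (@leq_trans #|z |: nbrs e z|).
    apply: subset_leq_card; apply/subsetP => x; rewrite inE => /andP[_ /SP].
    by rewrite !inE e_sym [z == x]eq_sym => /orP[->|/andP[->]]; rewrite ?orbT.
  by apply: leq_trans (leq_card_setU _ _) _; rewrite cards1 add1n ltnS card_nbrs_low.
Qed.

(** The ladder vertices that are unclean only because of an extra hub neighbour [d] that is not
    big. *)
Definition pendant b c d : {set V} := [set x in ~: B' |
  [&& hub_nbrs x == [set b; d], reach x == [set b; c], d \notin B & b != c]].

Lemma pendantP b c d x : x \in pendant b c d ->
  [/\ x \notin B', hub_nbrs x = [set b; d], reach x = [set b; c], d \notin B & b != c].
Proof. by rewrite inE in_setC => /andP[-> /and4P[/eqP-> /eqP-> -> ->]]. Qed.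

Lemma pendant_hubs b c d x : x \in pendant b c d ->
  [/\ b \in B, c \in B, d \in B', b \in reach x & c \in reach x].
Proof.
move=> /pendantP[xB hN hR dB bc].
have rB h : h \in reach x -> h \in B by rewrite inE => /andP[].
have bR : b \in reach x by rewrite hR !inE eqxx.
have cR : c \in reach x by rewrite hR !inE eqxx orbT.
have : d \in hub_nbrs x by rewrite hN !inE eqxx orbT.
by rewrite in_setI => /andP[_ dB']; split; rewrite ?rB.
Qed.

Lemma pendant_step b c d x : x \in pendant b c d ->
  [/\ e x (step x c), e (step x c) c & step x c \notin B'].
Proof.
move=> xP; have [bB cB dB' bR cR] := pendant_hubs xP.
have [xB hN hR dB bc] := pendantP xP.
have [_ sc _] := stepP cR.
have := step_near x c => /orP[/eqP sx|/andP[xs sB]]; last by split.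
have : c \in hub_nbrs x.
  by rewrite in_setI (subsetP big_hubs_sub _ cB) inE -{1}sx sc.
rewrite hN !inE eq_sym (negbTE bc) /= => /eqP cd.
by rewrite -cd cB in dB.
Qed.

(** The connectors are the pairs of [x] and [step x c], as [x] already sees [b] and [d]. A vertex
    [z] lies in the pair of [z] itself and otherwise only in pairs of common neighbours of [b], [d],
    [z], of which there are at most 2; hence 12 = 2 * 2 * 3. *)
Lemma pendant_card b c d : #|pendant b c d| <= 12.
Proof.
have [->|/set0Pn[x0 x0P]] := eqVneq (pendant b c d) set0; first by rewrite cards0.
have [bB cB dB' _ _] := pendant_hubs x0P; have [_ _ _ dB bc] := pendantP x0P.
have bd : b != d by apply: contraNneq dB => <-.
have cd : c != d by apply: contraNneq dB => <-.
have un : uniq [:: b; c; d] by rewrite /= !inE negb_or bc bd cd.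
pose S x := [set x; step x c].
rewrite (_ : 12 = 2 * 2 * 3) //.
have adj x : x \in pendant b c d -> e x b /\ e x d.
  move=> /pendantP[_ hN _ _ _].
  have : b \in hub_nbrs x by rewrite hN !inE eqxx.
  have : d \in hub_nbrs x by rewrite hN !inE eqxx orbT.
  by rewrite !inE => /andP[-> _] /andP[-> _].
have hubs_bcd h : h \in [:: b; c; d] -> h \in B'.
  rewrite in_cons mem_seq2 => /or3P[]/eqP-> //; exact: (subsetP big_hubs_sub).
apply: (connectors_card e_K33 (S := S) un).
- move=> x xP; apply: (connected_in_center (c := x)) => // z zS.
  have [xs _ _] := pendant_step xP.
  move: (zS); rewrite !inE => /orP[]/eqP->; first exact: connect0.
  by apply: connect1; rewrite /rel_within /= xs !inE !eqxx orbT.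
- move=> x xP h hbcd; have [xs sc sB] := pendant_step xP; have [xB _ _ _ _] := pendantP xP.
  have [xb xd] := adj x xP; split.
    rewrite !inE negb_or; apply/andP; split.
      by apply: contraNneq xB => <-; exact: hubs_bcd.
    by apply: contraNneq sB => <-; exact: hubs_bcd.
  move: hbcd; rewrite !inE => /or3P[]/eqP->.
  + by exists x; rewrite // !inE eqxx.
  + by exists (step x c); rewrite // !inE eqxx orbT.
  + by exists x; rewrite // !inE eqxx.
- by move=> x _; rewrite cards2; case: eqP.
- move=> z; case: (boolP (z \in B')) => zB.
    rewrite (_ : [set i in _ | _] = set0) ?cards0 //; apply/setP => x; rewrite in_set0.
    apply/negP; rewrite inE => /andP[xP].
    have [xs sc sB] := pendant_step xP; have [xB _ _ _ _] := pendantP xP.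
    by rewrite !inE => /orP[]/eqP zE; move: zB; rewrite zE ?(negbTE xB) ?(negbTE sB).
  have zu h : h \in [:: b; c; d] -> z != h.
    by move=> /hubs_bcd hB; apply: contraNneq zB => ->.
  have unz : uniq [:: b; d; z].
    by rewrite /= !inE negb_or bd ![_ == z]eq_sym !zu // !inE eqxx ?orbT.
  apply: (@leq_trans #|z |: [set v | [&& e v b, e v d & e v z]]|).
    apply: subset_leq_card; apply/subsetP => x; rewrite inE => /andP[xP].
    have [xs _ _] := pendant_step xP; have [xb xd] := adj x xP.
    rewrite !inE => /orP[]/eqP->; first by rewrite eqxx.
    by rewrite xb xd xs orbT.
  apply: leq_trans (leq_card_setU _ _) _; rewrite cards1.
  by rewrite (leq_add2l 1 _ 2) (common_le2 e_irr e_K33 unz).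
Qed.

Let carries d h x := [&& x \notin B', d \in hub_nbrs x, #|hub_nbrs x| <= 2 & h \in reach x].

(** Contains [b] and [c] whenever [pendant b c d] is nonempty, which moves the count from pendant
    vertices to the hubs [d]. *)
Definition rho d : {set V} := [set h in B | [exists x, carries d h x]].

Let via d h : V := odflt d [pick x | carries d h x].

Let viaP d h : h \in rho d -> carries d h (via d h).
Proof.
rewrite inE => /andP[_ /existsP[x xP]]; rewrite /via; case: pickP => [y|no] //.
by rewrite no in xP.
Qed.

(** The connector of [d] consists of [d], three vertices [via] and three steps, 7 in all. If a low
    [z] lies in it, then [z] is [d], or [d] is one of at most two hub neighbours of a vertex among
    [z] and its neighbours; this gives the overlap 1 + 2 (K + 1). *)
Lemma rho3_card b c h : uniq [:: b; c; h] ->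
  #|[set d in ~: B | [&& b \in rho d, c \in rho d & h \in rho d]]| <= 14 * (2 * K + 3).
Proof.
move=> un; set D := [set d in _ | _].
pose X d := [set via d b; via d c; via d h].
pose Y d := [set step (via d b) b; step (via d c) c; step (via d h) h].
pose S d := d |: (X d :|: Y d).
have DP d : d \in D -> [/\ d \notin B, b \in rho d, c \in rho d & h \in rho d].
  by rewrite inE in_setC => /andP[-> /and3P[-> -> ->]].
have Drho d k : d \in D -> k \in [:: b; c; h] -> k \in rho d.
  by move=> /DP[_ rb rc rh]; rewrite in_cons mem_seq2 => /or3P[]/eqP->.
have XP d z : d \in D -> z \in X d -> exists2 k, k \in rho d & z = via d k.
  move=> /DP[_ rb rc rh]; rewrite in_setU in_set2 in_set1 -orbA.
  by case/or3P => /eqP->; [exists b|exists c|exists h].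
have YP d z : d \in D -> z \in Y d -> exists2 k, k \in rho d & z = step (via d k) k /\ via d k \in X d.
  move=> /DP[_ rb rc rh]; rewrite in_setU in_set2 in_set1 -orbA.
  case/or3P => /eqP->; [exists b|exists c|exists h] => //; split=> //.
  - by rewrite in_setU in_set2 eqxx.
  - by rewrite in_setU in_set2 eqxx orbT.
  - by rewrite in_setU in_set1 eqxx orbT.
have low d k : k \in rho d -> via d k \notin B' /\ step (via d k) k \notin B'.
  move=> /viaP/and4P[vB _ _ _]; split=> //.
  by have /orP[/eqP->|/andP[]] := step_near (via d k) k.
have SP d z : d \in D -> z \in S d -> (z == d) || (z \notin B').
  move=> dD; rewrite in_setU1 in_setU => /orP[->//|/orP[]].
    by move=> /(XP _ _ dD)[k /low[kB _] ->]; rewrite kB orbT.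
  by move=> /(YP _ _ dD)[k /low[_ kB] [-> _]]; rewrite kB orbT.
have edv d k : k \in rho d -> e d (via d k).
  by move=> /viaP/and4P[_]; rewrite in_setI inE e_sym => /andP[].
rewrite (_ : 14 = 2 * 7) //.
apply: (connectors_card e_K33 (S := S) un).
- move=> d dD; apply: (connected_in_center (c := d)) => // z /[dup] zS.
  have dS : d \in S d by rewrite in_setU1 eqxx.
  have toX u : u \in X d -> connect (rel_within e (S d)) d u.
    move=> uX; have [k kr uk] := XP d u dD uX; apply: connect1.
    by rewrite /rel_within /= {1}uk edv // dS in_setU1 in_setU uX orbT.
  rewrite in_setU1 in_setU => /or3P[/eqP->|/toX//|zY]; first exact: connect0.
  have [k kr [zk vX]] := YP d z dD zY.
  apply: connect_trans (toX _ vX) _; rewrite zk.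
  have := step_near (via d k) k => /orP[/eqP->|/andP[vs _]]; first exact: connect0.
  by apply: connect1; rewrite /rel_within /= vs -zk zS in_setU1 in_setU vX orbT.
- move=> d dD k kbch; have kr := Drho d k dD kbch.
  have /and4P[_ _ _ /stepP[_ sk kB]] := viaP kr.
  have [dB _ _ _] := DP d dD; split.
    apply/negP => /(SP d _ dD)/orP[/eqP kd|]; first by rewrite -kd kB in dB.
    by rewrite (subsetP big_hubs_sub).
  exists (step (via d k) k) => //; rewrite /S in_setU1 in_setU.
  suff -> : step (via d k) k \in Y d by rewrite !orbT.
  rewrite in_setU in_set2 in_set1.
  by move: kbch; rewrite in_cons mem_seq2 => /or3P[]/eqP->; rewrite eqxx ?orbT.
- move=> d _; apply: leq_trans (leq_card_setU _ _) _; rewrite cards1.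
  rewrite (leq_add2l 1 _ 6); apply: leq_trans (leq_card_setU _ _) _.
  by rewrite (@leq_add _ _ 3 3) ?cards3_le.
- move=> z; case: (boolP (z \in B')) => zB.
    apply: (@leq_trans #|[set z]|); last by rewrite cards1; lia.
    apply: subset_leq_card; apply/subsetP => d; rewrite inE => /andP[dD /(SP _ _ dD)].
    by rewrite zB orbF in_set1 eq_sym.
  pose N := [set x in z |: nbrs e z | #|hub_nbrs x| <= 2].
  apply: (@leq_trans #|z |: \bigcup_(x in N) hub_nbrs x|).
    apply: subset_leq_card; apply/subsetP => d; rewrite inE => /andP[dD].
    move=> zS; rewrite in_setU1; move: zS; rewrite /S in_setU1 in_setU => /or3P[/eqP->|zX|zY].
    + by rewrite eqxx.
    + have [k kr zk] := XP d z dD zX; have /and4P[_ dv v2 _] := viaP kr.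
      rewrite -zk in dv v2; apply/orP; right; apply/bigcupP; exists z => //.
      by rewrite inE setU11.
    + have [k kr [zk vX]] := YP d z dD zY; have /and4P[_ dv v2 _] := viaP kr.
      apply/orP; right; apply/bigcupP; exists (via d k) => //.
      rewrite inE v2 andbT in_setU1 inE e_sym zk.
      by have := step_near (via d k) k => /orP[/eqP->|/andP[-> _]]; rewrite ?eqxx ?orbT.
  apply: leq_trans (leq_card_setU _ _) _; rewrite cards1.
  have : #|\bigcup_(x in N) hub_nbrs x| <= #|N| * 2.
    by apply: card_bigcup_const => x; rewrite inE => /andP[].
  have : #|N| <= #|z |: nbrs e z|.
    by apply: subset_leq_card; apply/subsetP => x; rewrite inE => /andP[].
  have : #|z |: nbrs e z| <= #|[set z]| + #|nbrs e z| := leq_card_setU _ _.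
  rewrite cards1.
  by have := card_nbrs_low zB; clear; lia.
Qed.

(** A ladder vertex already sees [b] or [c]. If it reaches no third big hub and has at most two hub
    neighbours, the only way to be unclean is one further hub neighbour, which cannot be big since
    it would lie in [reach x]. *)
Lemma uncleanP b c x : b != c -> x \in ladder b c :\: clean b c ->
  [\/ exists h, [&& uniq [:: b; c; h], x \notin B', b \in reach x, c \in reach x & h \in reach x],
      (x \in bad) && (reach x == [set b; c]) |
      exists d, (x \in pendant b c d) || (x \in pendant c b d)].
Proof.
move=> bc; rewrite in_setD [_ \in clean b c]inE => /andP[+ xL]; rewrite xL /= => nc.
have rs := ladder_reach xL.
have [bR cR] : b \in reach x /\ c \in reach x.
  by split; apply: (subsetP rs); rewrite !inE eqxx ?orbT.
move: xL; rewrite inE in_setC => /andP[xB /and3P[bB cB adj]].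
have [rE|rN] := eqVneq (reach x) [set b; c]; last first.
  constructor 1; have : ~~ (reach x \subset [set b; c]).
    by apply: contra rN => rs'; rewrite eqEsubset rs' rs.
  case/subsetPn => h hR; rewrite in_set2 negb_or => /andP[hb hc].
  by exists h; rewrite xB bR cR hR /= !inE negb_or bc ![_ == h]eq_sym hb hc.
have [N3|N2] := leqP 3 #|hub_nbrs x|.
  by constructor 2; rewrite inE [x \in [set _ | _]]inE N3 orbT.
constructor 3; move: nc; rewrite rE subUset subxx /= => /subsetPn[d dN].
rewrite in_set2 negb_or => /andP[db dc]; exists d.
have dB : d \notin B.
  apply/negP => dB; have : d \in reach x.
    by rewrite inE dB; move: dN; rewrite in_setI inE => /andP[-> _].
  by rewrite rE in_set2 (negbTE db) (negbTE dc).
have NE h : h \in B -> h != d -> e x h -> hub_nbrs x = [set h; d].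
  move=> hB hd xh; apply/esym/eqP; rewrite eqEcard cards2 hd andbC; apply/andP; split; first exact: N2.
  by rewrite subUset !sub1set dN in_setI inE xh (subsetP big_hubs_sub).
have pE h k : h \in B -> h != d -> e x h -> reach x = [set h; k] -> h != k -> x \in pendant h k d.
  by move=> hB hd xh rhk hk; rewrite inE in_setC xB (NE h) // rhk dB !eqxx.
case/orP: adj => /andP[xh _]; first by rewrite pE // eq_sym.
by rewrite orbC pE // 1?eq_sym // rE setUC.
Qed.

(** Trades pairs for triples, where K_{3,3} minors give bounds. A pair in a larger set extends to a
    triple; the 2 covers a set of exactly two elements. *)
Lemma pairs_le_triples (S : {set V}) :
  \sum_u \sum_v [&& u \in S, v \in S & u != v] <=
  2 + \sum_u \sum_v \sum_w [&& u \in S, v \in S, w \in S & uniq [:: u; v; w]].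
Proof.
have [S3|S2] := leqP 3 #|S|.
  apply: leq_trans (leq_addl _ _); apply: leq_sum => u _; apply: leq_sum => v _.
  case: (boolP [&& _, _ & _]) => // /and3P[uS vS uv].
  have : 0 < #|S :\ u :\ v|.
    by move: S3; rewrite (cardsD1 u) uS (cardsD1 v (S :\ u)) !inE vS eq_sym uv.
  case/card_gt0P => w; rewrite !inE => /and3P[wv wu wS].
  by rewrite (bigD1 w) //= uS vS wS !inE negb_or uv ![_ == w]eq_sym wv wu.
apply: leq_trans (leq_addr _ _).
have cP : #|[set p : V * V | (p.1 != p.2) && ([set p.1; p.2] == S)]| <= 2 := card_pairs_set2 S.
apply: leq_trans cP; rewrite pair_big /= -sum1_card [X in _ <= X]big_mkcond.
apply: leq_sum => -[u v] _ /=; rewrite inE /=.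
case: (boolP [&& _, _ & _]) => // /and3P[uS vS uv].
by rewrite uv eqEcard subUset !sub1set uS vS cards2 uv (S2 : #|S| <= 2).
Qed.

Let T3 := \sum_u \sum_v \sum_w [&& u \in B, v \in B, w \in B & uniq [:: u; v; w]].

Lemma triples_le : T3 <= (12 * K) ^ 3.
Proof.
have le : T3 <= \sum_(u in B) \sum_(v in B) \sum_(w in B) 1.
  rewrite /T3 [X in _ <= X]big_mkcond; apply: leq_sum => u _; case: ifP => uB; last first.
    by rewrite big1 // => v _; rewrite big1.
  rewrite [X in _ <= X]big_mkcond; apply: leq_sum => v _; case: ifP => vB; last first.
    by rewrite big1.
  by rewrite [X in _ <= X]big_mkcond; apply: leq_sum => w _; case: ifP => // _; exact: leq_b1.
apply: leq_trans le _; rewrite !sum_nat_const.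
by rewrite muln1 !expnS expn0 muln1 !leq_mul ?card_big_hubs.
Qed.

(** A hub [d] accounts for at most 12 pendant vertices per ordered pair in [rho d]. Passing to
    triples leaves 2 per hub, and after exchanging the sums each triple of big hubs is controlled by
    [rho3_card]. *)
Lemma sum_pendant_le :
  \sum_b \sum_c \sum_d #|pendant b c d| <=
  12 * (2 * (12 * K ^ 4) + T3 * (14 * (2 * K + 3))).
Proof.
have rhoB d h : h \in rho d -> h \in B by rewrite inE => /andP[].
have in_rho b c d x : x \in pendant b c d ->
    [&& d \in B', d \notin B & [&& b \in rho d, c \in rho d & b != c]].
  move=> xP; have [bB cB dB' bR cR] := pendant_hubs xP.
  have [xB hN hR dB bc] := pendantP xP; rewrite dB' dB bc andbT /=.
  have dh : d \in hub_nbrs x by rewrite hN !inE eqxx orbT.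
  have N2 : #|hub_nbrs x| <= 2 by rewrite hN cards2; case: eqP.
  by rewrite ![_ \in rho d]inE bB cB; apply/andP; split; apply/existsP; exists x;
    rewrite /carries xB dh N2 ?bR ?cR.
apply: (@leq_trans (\sum_b \sum_c \sum_d 12 * [&& d \in B', d \notin B &
    [&& b \in rho d, c \in rho d & b != c]])).
  apply: leq_sum => b _; apply: leq_sum => c _; apply: leq_sum => d _.
  have [->|/set0Pn[x /in_rho->]] := eqVneq (pendant b c d) set0; first by rewrite cards0.
  by rewrite muln1 pendant_card.
under eq_bigr do under eq_bigr do rewrite -big_distrr /=.
under eq_bigr do rewrite -big_distrr /=.
rewrite -big_distrr leq_mul2l /=.
under eq_bigr do rewrite exchange_big /=.
rewrite exchange_big /=.
apply: (@leq_trans (\sum_(d in B' :\: B) (2 + \sum_u \sum_v \sum_w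
    [&& u \in rho d, v \in rho d, w \in rho d & uniq [:: u; v; w]]))).
  rewrite [X in _ <= X]big_mkcond; apply: leq_sum => d _; rewrite in_setD.
  case: (d \in B'); last by rewrite andbF big1 // => b _; rewrite big1.
  case: (d \in B); first by rewrite big1 // => b _; rewrite big1.
  exact: pairs_le_triples.
rewrite big_split /= sum_nat_const leq_add //.
  rewrite mulnC leq_mul2l /=; apply: leq_trans card_hubs.
  by apply: subset_leq_card; exact: subsetDl.
rewrite exchange_big big_distrl; apply: leq_sum => u _ /=.
rewrite exchange_big big_distrl; apply: leq_sum => v _ /=.
rewrite exchange_big big_distrl; apply: leq_sum => w _ /=.
case un: (uniq [:: u; v; w]); move: (un) => /= un'; last first.
  by rewrite big1 // => d _; rewrite un' !andbF.
rewrite un'.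
case: (boolP [&& u \in B, v \in B & w \in B]) => [/and3P[-> -> ->]|no]; last first.
  rewrite big1 // => d _; case: (boolP [&& _, _ , _ & _]) => // /and4P[/rhoB uB /rhoB vB /rhoB wB _].
  by rewrite uB vB wB in no.
rewrite mul1n; apply: leq_trans (rho3_card un); rewrite -sum1_card big_mkcond [X in _ <= X]big_mkcond.
apply: leq_sum => d _; rewrite in_setD inE in_setC andbT.
by case: (d \in B); case: (d \in B').
Qed.

Lemma sum_unclean_le :
  \sum_b \sum_(c | b != c) #|ladder b c :\: clean b c| <=
  T3 * (8 * K.+1) + 2 * (313 * (12 * K ^ 4)) +
  2 * (12 * (2 * (12 * K ^ 4) + T3 * (14 * (2 * K + 3)))).
Proof.
pose T b c h := [set x in ~: B' | [&& b \in reach x, c \in reach x & h \in reach x]].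
pose W b c := [set x in bad | reach x == [set b; c]].
pose F b c h := if uniq [:: b; c; h] then #|T b c h| else 0.
apply: (@leq_trans (\sum_b \sum_(c | b != c) (\sum_h F b c h +
    #|W b c| + \sum_d #|pendant b c d| + \sum_d #|pendant c b d|))).
  apply: leq_sum => b _; apply: leq_sum => c bc.
  apply: (@leq_trans #|\bigcup_(h in [set h | uniq [:: b; c; h]]) T b c h :|: W b c :|:
     \bigcup_(d in [set: V]) pendant b c d :|: \bigcup_(d in [set: V]) pendant c b d|).
    apply: subset_leq_card; apply/subsetP => x /(uncleanP bc)[[h /and5P[un xB xb xc xh]]|/andP[xbad xr]|[d dP]].
    - rewrite !in_setU; suff -> : x \in \bigcup_(h in [set h | uniq [:: b; c; h]]) T b c h by [].
      by apply/bigcupP; exists h; rewrite inE // in_setC xB xb xc xh.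
    - by rewrite !in_setU [x \in W _ _]inE xbad xr orbT.
    - rewrite in_setU [x \in _ :|: \bigcup_(d in _) pendant b c d]in_setU.
      by case/orP: dP => dP; apply/orP; [left; apply/orP; right|right]; apply/bigcupP; exists d.
  apply: leq_trans (leq_card_setU _ _) _; apply: leq_add.
    apply: leq_trans (leq_card_setU _ _) _; apply: leq_add.
      apply: leq_trans (leq_card_setU _ _) _; apply: leq_add.
        apply: leq_trans (card_bigcup_le _ _) _; rewrite big_mkcond.
        by apply: leq_sum => h _; rewrite inE.
      by [].
    apply: leq_trans (card_bigcup_le _ _) _; rewrite big_mkcond.
    by apply: leq_sum => h _; rewrite inE.
  apply: leq_trans (card_bigcup_le _ _) _; rewrite big_mkcond.
  by apply: leq_sum => h _; rewrite inE.
under eq_bigr do rewrite 3!big_split /=.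
rewrite 3!big_split /= [X in _ <= _ + X]mul2n -addnn addnA.
apply: leq_add; [apply: leq_add; [apply: leq_add|]|].
- rewrite /T3 big_distrl; apply: leq_sum => b _ /=; rewrite big_distrl big_mkcond.
  apply: leq_sum => c _ /=; case: ifP => // _; rewrite big_distrl.
  apply: leq_sum => h _ /=; rewrite /F; case: ifP => // un.
  have [->|/set0Pn[x]] := eqVneq (T b c h) set0; first by rewrite cards0.
  rewrite inE => /andP[_ /and3P[xb xc xh]].
  have rB k : k \in reach x -> k \in B by rewrite inE => /andP[].
  by rewrite !rB //; move: (un) => /= ->; rewrite mul1n reach3_card.
- apply: (@leq_trans (2 * #|bad|)); last by rewrite leq_mul2l card_bad.
  apply: (sum_pairs_le (S := reach)) => u v x uv.
  by rewrite inE eq_sym => /andP[-> /eqP->]; rewrite eqxx.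
- apply: leq_trans sum_pendant_le.
  by apply: leq_sum => b _; rewrite big_mkcond; apply: leq_sum => c _; case: ifP.
- apply: leq_trans sum_pendant_le; rewrite [X in _ <= X]exchange_big.
  by apply: leq_sum => b _; rewrite big_mkcond; apply: leq_sum => c _; case: ifP.
Qed.

(** The factors 16 = 8 * 2 and 70 = 14 * 5 come from K + 1 <= 2K and 2K + 3 <= 5K, and 12^3 from the
    triples of big hubs. *)
Definition weight_const : nat :=
  12 ^ 3 * 16 + 2 * (313 * 12) + 2 * (12 * (2 * 12 + 12 ^ 3 * 70)).

Lemma sum_weight_le :
  \sum_u \sum_v weight u v <= 2 * #|V| + weight_const * K ^ 4.
Proof.
have -> : \sum_u \sum_v weight u v =
  \sum_u \sum_(v | u != v) (#|linked u v :|: clean u v| + #|ladder u v :\: clean u v|).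
  apply: eq_bigr => u _; rewrite [RHS]big_mkcond; apply: eq_bigr => v _.
  by rewrite /weight; case: eqP.
under eq_bigr do rewrite big_split /=.
rewrite big_split leq_add ?sum_clean_le //; apply: leq_trans sum_unclean_le _.
have := triples_le; rewrite expnMn /weight_const; move: T3 (12 ^ 3) => t c tc.
have tK : t * K <= c * K ^ 4 by rewrite expnSr mulnA leq_mul2r tc orbT.
have t1 : t <= t * K by rewrite leq_pmulr.
have t8 : t * (8 * K.+1) = 8 * (t * K) + 8 * t by clear; lia.
have t14 : t * (14 * (2 * K + 3)) = 28 * (t * K) + 42 * t by clear; lia.
rewrite t8 t14; move: (t * K) (K ^ 4) tK t1 => tk k4.
have cE : (c * 16 + 2 * (313 * 12) + 2 * (12 * (2 * 12 + c * 70))) * k4 =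
  16 * (c * k4) + 2 * (313 * (12 * k4)) + 2 * (12 * (2 * (12 * k4) + 70 * (c * k4))).
  by clear; lia.
by rewrite cE; move: (c * k4); clear; lia.
Qed.

End Weights.

(** * Counting odd cycles in sparse graphs *)

Lemma card_ord_ltn n k : #|[pred x : 'I_n | x < k]| <= k.
Proof.
rewrite -[X in _ <= X](size_iota 0) cardE -(size_map val).
apply: uniq_leq_size => [|j /mapP[x]].
  by rewrite map_inj_uniq ?enum_uniq //; exact: val_inj.
by rewrite mem_enum => xk ->; rewrite mem_iota; exact: xk.
Qed.

(* A map of [R] is recovered from the indices of its values [f i] in the sets
   [S i (f (mu i))], following [mu] back to the positions where [S] is constant. *)
Lemma search_bound (I V : finType) (R : {set {ffun I -> V}}) (mu : I -> I)
    (S : I -> V -> {set V}) (rho : I -> nat) (kappa : I -> nat) :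
  (forall i, (forall x y, S i x = S i y) \/ rho (mu i) < rho i) ->
  (forall i x, #|S i x| <= kappa i) ->
  (forall f : {ffun I -> V}, f \in R -> forall i, f i \in S i (f (mu i))) ->
  #|R| <= \prod_i kappa i.
Proof.
move=> wf cS RS.
have ix_lt (f : {ffun I -> V}) i : index (f i) (enum (S i (f (mu i)))) < #|V|.+1.
  by apply: leq_ltn_trans (index_size _ _) _; rewrite -cardE ltnS max_card.
pose g (f : {ffun I -> V}) : {ffun I -> 'I_#|V|.+1} := [ffun i => Ordinal (ix_lt f i)].
have ginj : {in R &, injective g}.
  move=> f f' fR fR' /ffunP gff; apply/ffunP.
  have key k i : rho i < k -> f i = f' i.
    elim: k i => // k IH i ik.
    have SE : S i (f (mu i)) = S i (f' (mu i)).
      by case: (wf i) => [h|lt]; [exact: h|rewrite IH // (leq_trans lt)].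
    have := gff i; rewrite !ffunE => /(congr1 val) /=; rewrite SE.
    by apply: (index_inj (f i)); rewrite mem_enum; [rewrite -SE|]; apply: RS.
  by move=> i; apply: (key (rho i).+1).
rewrite -(card_in_imset ginj).
apply: (@leq_trans #|[set h : {ffun I -> 'I_#|V|.+1} | [forall i, h i < kappa i]]|).
  apply: subset_leq_card; apply/subsetP => h /imsetP[f fR ->]; rewrite inE.
  apply/forallP => i; rewrite ffunE /=; apply: leq_trans (cS i (f (mu i))).
  by rewrite cardE index_mem mem_enum RS.
have -> : [set h : {ffun I -> 'I_#|V|.+1} | [forall i, h i < kappa i]] =
    [set h in family (fun i => [pred x : 'I_#|V|.+1 | x < kappa i])].
  apply/setP => h; rewrite [LHS]in_set [RHS]in_set.
  by apply/forallP/familyP => H i; apply: H.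
rewrite cardsE card_family foldrE big_map big_enum /=; apply: leq_prod => i _.
exact: card_ord_ltn.
Qed.

(** * Cyclic maps and local minima of the rank *)

Section CyclicMaps.

Variables (V : finType) (e : rel V) (r : V -> nat) (N : nat).
Hypotheses (e_sym : symmetric e) (e_irr : irreflexive e) (r_inj : injective r).

Implicit Type f : {ffun 'I_N.+1 -> V}.

Definition is_cyc f : bool := injectiveb f && [forall i, e (f i) (f (ordS i))].

Definition cyc_shift k f : {ffun 'I_N.+1 -> V} := [ffun i => f (iter k (@ordS _) i)].

Definition cyc_flip f : {ffun 'I_N.+1 -> V} := [ffun i => f (rev_ord i)].

Definition up f i : bool := r (f i) < r (f (ordS i)).

(** On a cycle the rank falls both into and out of position 0, which is therefore neither a local
    minimum nor a local maximum. *)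
Definition oriented f : bool := ~~ up f ord0 && ~~ up f ord_max.

Lemma is_cycP f : reflect (injective f /\ forall i, e (f i) (f (ordS i))) (is_cyc f).
Proof.
apply: (iffP andP) => [[/injectiveP fi /forallP fe]|[fi fe]] //.
by split; [apply/injectiveP|apply/forallP].
Qed.

Lemma val_iter_ordS k (i : 'I_N.+1) : val (iter k (@ordS _) i) = (i + k) %% N.+1.
Proof.
elim: k => [|k IH]; first by rewrite addn0 modn_small.
by rewrite iterS addnS -[(i + k).+1]addn1 -modnDml -IH addn1.
Qed.

Lemma iter_ordS_inj k : injective (iter k (@ordS N.+1)).
Proof. by elim: k => // k IH i j /= /ordS_inj /IH. Qed.

Lemma ordS_rev (i : 'I_N.+1) : ordS (rev_ord (ordS i)) = rev_ord i.
Proof.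
apply: val_inj => /=; have := ltn_ord i; rewrite leq_eqVlt => /orP[/eqP iN|iN].
  by rewrite iN modnn subn1 /= modnn subnn.
by rewrite (modn_small iN) modn_small; lia.
Qed.

Lemma shift_cyc k f : is_cyc f -> is_cyc (cyc_shift k f).
Proof.
move=> /is_cycP[fi fe]; apply/is_cycP; split=> [i j|i]; rewrite !ffunE.
  by move/fi/iter_ordS_inj.
by rewrite -iterSr iterS.
Qed.

Lemma flip_cyc f : is_cyc f -> is_cyc (cyc_flip f).
Proof.
move=> /is_cycP[fi fe]; apply/is_cycP; split=> [i j|i]; rewrite !ffunE.
  by move/fi/rev_ord_inj.
by rewrite e_sym -(ordS_rev i).
Qed.

Lemma up_neq f i : 0 < N -> injective f -> ~~ up f i -> r (f (ordS i)) < r (f i).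
Proof.
move=> N0 fi; rewrite -leqNgt leq_eqVlt => /orP[/eqP/r_inj/fi|//].
move=> /(congr1 val) /=; have := ltn_ord i; rewrite leq_eqVlt => /orP[/eqP iN|iN].
  by rewrite iN modnn => i0; move: iN; rewrite -i0 => -[E]; rewrite -E in N0.
by rewrite modn_small //; lia.
Qed.

(** Around an odd cycle rises and falls cannot alternate, so two consecutive steps have the same
    direction. Two falls are rotated to position 0; two rises become falls under the flip. *)
Lemma oriented_rotation f : 0 < N -> ~~ odd N -> is_cyc f ->
  exists k, oriented (cyc_shift k f) \/ oriented (cyc_shift k (cyc_flip f)).
Proof.
move=> N0 oddN /is_cycP[fi fe].
have [i /eqP ui] : exists i, up f i == up f (ordS i).
  case: (boolP [exists i, up f i == up f (ordS i)]) => [/existsP//|/existsPn alt].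
  exfalso.
  have key k : up f (iter k (@ordS _) ord0) = up f ord0 (+) odd k.
    elim: k => [|k IH]; first by rewrite addbF.
    have := alt (iter k (@ordS _) ord0); rewrite -iterS IH oddS.
    by case: (up f (iter k.+1 (@ordS _) ord0)); case: (up f ord0); case: (odd k).
  have := key N.+1; rewrite oddS oddN addbT.
  rewrite (_ : iter N.+1 (@ordS _) ord0 = ord0); last first.
    by apply: val_inj; rewrite val_iter_ordS add0n modnn.
  by case: (up f ord0).
have to0 (j : 'I_N.+1) : iter j (@ordS _) ord0 = j.
  by apply: val_inj; rewrite val_iter_ordS add0n modn_small.
have max0 : ordS (@ord_max N) = ord0 by apply: val_inj; rewrite /= modnn.
have iter_max (j : 'I_N.+1) : ordS (iter j (@ordS _) ord_max) = j.
  by rewrite -iterS iterSr max0 to0.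
have upS k g j : up (cyc_shift k g) j = up g (iter k (@ordS _) j).
  by rewrite /up !ffunE -iterSr.
case ui1 : (up f i).
  exists (rev_ord (ordS i)); right; rewrite /oriented !upS to0.
  have upF j : up (cyc_flip f) (rev_ord (ordS j)) = ~~ up f j.
    rewrite /up !ffunE ordS_rev !rev_ordK -leqNgt ltn_neqAle.
    rewrite andb_idl // => _; apply/eqP => /r_inj E.
    by have := fe j; rewrite E e_irr.
  have E : iter (rev_ord (ordS i)) (@ordS _) ord_max = rev_ord (ordS (ordS i)).
    by apply: (@ordS_inj N.+1); rewrite iter_max ordS_rev.
  by rewrite E !upF -ui ui1.
exists (ordS i); left; rewrite /oriented !upS to0 -ui ui1 /=.
by rewrite (ordS_inj (iter_max (ordS i))) ui1.
Qed.

End CyclicMaps.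

(** Marks are never adjacent and the two end positions are unmarked, so m marks fit in only one
    way. *)
Lemma sparse_positions_odd (p : nat -> bool) m :
  p 0 = false -> (forall i, ~~ (p i && p i.+1)) ->
  p (2 * m) = false -> m <= \sum_(0 <= i < (2 * m).+1) p i ->
  forall k, k < m -> p (2 * k).+1.
Proof.
move=> p0 adj; have le k : \sum_(0 <= i < (2 * k).+1) p i <= k.
  elim: k => [|k IH]; first by rewrite big_nat1 p0.
  rewrite mulnS !addSn add0n 2?big_nat_recr //=.
  by have := adj (2 * k).+1; case: (p _.+1); case: (p _.+2) => //=; lia.
elim: m => // m IH; rewrite mulnS !addSn add0n => pm.
rewrite 2?big_nat_recr //= pm addn0 => sm.
have pm1 : p (2 * m).+1 by have := le m; move: sm; case: (p _.+1) => //=; lia.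
move=> k; rewrite ltnS leq_eqVlt => /orP[/eqP->//|]; apply: IH.
  by have := adj (2 * m); rewrite pm1 andbT => /negbTE.
by move: sm; rewrite pm1 addn1.
Qed.

Section PatternCount.

Variables (V : finType) (e : rel V) (r : V -> nat) (N : nat).
Hypotheses (e_sym : symmetric e) (e_irr : irreflexive e) (r_inj : injective r).
Hypothesis r_out : forall v, #|[set u | e v u && (r v < r u)]| <= 12.
Hypothesis N_gt0 : 0 < N.

Implicit Type D : {set 'I_N.+1}.

Definition out_nbrs v : {set V} := [set u | e v u && (r v < r u)].

Definition pattern (f : {ffun 'I_N.+1 -> V}) : {set 'I_N.+1} := [set i | up r f i].

(** For [D = pattern f] these are the local minima of the rank along the cycle. *)
Definition dips D : {set 'I_N.+1} := [set i in D | ord_pred i \notin D].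

(** Local minima are chosen freely. Every other vertex is one of the at most 12 higher neighbours of
    a lower vertex next to it on the cycle. *)
Lemma card_pattern D :
  #|[set f : {ffun 'I_N.+1 -> V} | is_cyc e f && (pattern f == D)]|
  <= #|V| ^ #|dips D| * 12 ^ N.+1.
Proof.
set R := [set f | _]; have [->|/set0Pn[f0]] := eqVneq R set0; first by rewrite cards0.
rewrite inE => /andP[/is_cycP[f0i f0e] /eqP f0D].
pose mu i := if i \in dips D then i else if i \in D then ord_pred i else ordS i.
pose S i x := if i \in dips D then [set: V] else out_nbrs x.
have lower (f : {ffun 'I_N.+1 -> V}) i : is_cyc e f -> pattern f = D -> i \notin dips D ->
    e (f (mu i)) (f i) && (r (f (mu i)) < r (f i)).
  move=> /is_cycP[fi fe] fD iD; rewrite /mu (negbTE iD).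
  case: ifP => [iD'|iD'].
    have : ord_pred i \in D by move: iD; rewrite inE iD' /= negbK.
    by rewrite -fD inE /up ord_predK => ->; have := fe (ord_pred i); rewrite ord_predK => ->.
  by rewrite e_sym fe (up_neq r_inj) //; move: iD'; rewrite -fD inE => ->.
(* The dependence [mu] is determined by the pattern alone, so the ranks along the one map [f0] show
   for all maps that following it terminates. *)
apply: leq_trans (search_bound (mu := mu) (S := S) (rho := fun i => r (f0 i))
  (kappa := fun i => if i \in dips D then #|V| else 12) _ _ _) _.
- move=> i; case iD: (i \in dips D); first by left=> x y; rewrite /S iD.
  right; suff /andP[] : e (f0 (mu i)) (f0 i) && (r (f0 (mu i)) < r (f0 i)) by [].
  by apply: lower; rewrite ?iD //; apply/is_cycP.
- by move=> i x; rewrite /S; case: ifP => _; rewrite ?cardsT // r_out.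
- move=> f; rewrite inE => /andP[fc /eqP fD] i; rewrite /S.
  by case: ifPn => // /(lower _ _ fc fD); rewrite inE.
rewrite (bigID (mem (dips D))) /=; apply: leq_mul.
  rewrite -prod_nat_const; apply: eq_leq; apply: eq_bigr => i iD.
  by rewrite iD.
rewrite (eq_bigr (fun=> 12)) => [|i /negbTE-> //].
rewrite prod_nat_const leq_pexp2l //; apply: leq_trans (max_card _) _.
by rewrite card_ord.
Qed.

(** The base 24 is 2 * 12: the patterns are subsets of the positions, and each position that is not
    a dip costs at most 12. *)
Lemma card_few_dips k : 0 < #|V| ->
  #|[set f : {ffun 'I_N.+1 -> V} | is_cyc e f && (#|dips (pattern f)| <= k)]|
  <= #|V| ^ k * 24 ^ N.+1.
Proof.
move=> V0; set R := [set f | _].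
apply: (@leq_trans #|\bigcup_(D in [set D | #|dips D| <= k])
    [set f : {ffun 'I_N.+1 -> V} | is_cyc e f && (pattern f == D)]|).
  apply: subset_leq_card; apply/subsetP => f; rewrite inE => /andP[fc fk].
  by apply/bigcupP; exists (pattern f); rewrite inE // fc eqxx.
apply: leq_trans (card_bigcup_const (k := #|V| ^ k * 12 ^ N.+1) _) _.
  move=> D; rewrite inE => Dk; apply: leq_trans (card_pattern D) _.
  by rewrite leq_mul2r leq_pexp2l ?orbT.
rewrite (_ : 24 = 2 * 12) // expnMn mulnCA leq_mul2l; apply/orP; right.
rewrite leq_mul2r; apply/orP; right.
have <- : #|powerset [set: 'I_N.+1]| = 2 ^ N.+1 by rewrite card_powerset cardsT card_ord.
by apply: subset_leq_card; apply/subsetP => D _; rewrite powersetE subsetT.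
Qed.

End PatternCount.

Section Alternating.

Variables (V : finType) (e : rel V) (r : V -> nat) (m : nat).
Hypotheses (e_sym : symmetric e) (e_irr : irreflexive e) (r_inj : injective r).
Hypothesis r_out : forall v, #|[set u | e v u && (r v < r u)]| <= 12.
Hypothesis m_gt1 : 1 < m.

Local Notation ix := 'I_(2 * m).+1.

Implicit Type f : {ffun ix -> V}.

Definition at_ f (k : nat) : V := f (inord k).

(* Position 0 is the only vertex on the cycle that is neither a local minimum
   (odd positions) nor a local maximum (even positions) of the rank [r]. *)
Definition alternating f : Prop :=
  [/\ injective f,
      forall k, k < m -> [/\ e (at_ f (2 * k).+1) (at_ f (2 * k)),
        e (at_ f (2 * k).+1) (at_ f (2 * k).+2),
        r (at_ f (2 * k).+1) < r (at_ f (2 * k)) &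
        r (at_ f (2 * k).+1) < r (at_ f (2 * k).+2)],
      e (at_ f 0) (at_ f (2 * m)) &
      r (at_ f 0) < r (at_ f (2 * m))].

Let ordS_inord k : k < 2 * m -> ordS (inord k : ix) = inord k.+1.
Proof.
move=> k2; apply: val_inj => /=; rewrite !inordK ?ltnS //; last exact: ltnW.
by rewrite modn_small // ltnS.
Qed.

Let ord_pred_inord k : k < 2 * m -> ord_pred (inord k.+1 : ix) = inord k.
Proof. by move=> k2; rewrite -ordS_inord // ordSK. Qed.

Let ordS_max : ordS (ord_max : ix) = ord0.
Proof. by apply: val_inj; rewrite /= modnn. Qed.

Let inord_max : inord (2 * m) = ord_max :> ix.
Proof. by apply: val_inj; rewrite /= inordK. Qed.

Let inord_0 : inord 0 = ord0 :> ix.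
Proof. by apply: val_inj; rewrite /= inordK. Qed.

Lemma oriented_alternating f : is_cyc e f -> oriented r f ->
  m <= #|dips (pattern r f)| -> alternating f.
Proof.
move=> /is_cycP[fi fe] /andP[u0 umax] md.
have m20 : 0 < 2 * m by lia.
have dn := up_neq r_inj m20 fi.
pose p k := inord k \in dips (pattern r f).
have pE k : p k = up r f (inord k) && ~~ up r f (ord_pred (inord k)) by rewrite /p !inE.
have odd_dip : forall k, k < m -> p (2 * k).+1.
  apply: sparse_positions_odd.
  - by rewrite pE inord_0 (negbTE u0).
  - move=> i; rewrite !pE; have [lt|ge] := ltnP i (2 * m).
      by rewrite ord_pred_inord //; case: (up r f (inord i)); rewrite ?andbF.
    (* The condition on neighbouring marks is required at all natural numbers. Out of range [inord]
       returns [ord0], where there is no dip. *)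
    have out k : 2 * m < k -> inord k = ord0 :> ix.
      by move=> lt; rewrite /inord /insubd insubF //= ltnS leqNgt lt.
    by rewrite (out i.+1) // (negbTE u0) andbF.
  - by rewrite pE inord_max (negbTE umax).
  - apply: leq_trans md _; rewrite big_mkord -sum1_card big_mkcond; apply: eq_leq.
    by apply: eq_bigr => i _; rewrite /p inord_val; case: ifP.
split=> // [k km||]; last 2 first.
- by rewrite /at_ inord_max inord_0 e_sym -ordS_max.
- by rewrite /at_ inord_max inord_0 -ordS_max dn.
have k1 : (2 * k).+1 < 2 * m by lia.
have k0 : 2 * k < 2 * m by lia.
have /andP[uk nuk] : up r f (inord (2 * k).+1) && ~~ up r f (inord (2 * k)).
  by have := odd_dip k km; rewrite pE ord_pred_inord.
have := dn _ nuk; rewrite ordS_inord // => lt.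
move: uk; rewrite /up ordS_inord // => lt'.
have := fe (inord (2 * k)); have := fe (inord (2 * k).+1); rewrite !ordS_inord // => e1 e0.
by rewrite /at_ [e _ (f (inord (2 * k)))]e_sym.
Qed.

Lemma prod_odd_positions p c n : odd p -> p < 2 * m ->
  \prod_(i : ix) (if odd i then if i == p :> nat then c else n else 12) =
  c * n ^ m.-1 * 12 ^ m.+1.
Proof.
move=> op pm.
have count_odd k : \sum_(i < (2 * k).+1) odd i = k.
  elim: k => [|k IH]; first by rewrite big_ord_recl big_ord0.
  by rewrite mulnS !addSn add0n 2!big_ord_recr /= IH mul2n /= odd_double /= addn0 addn1.
have c_odd : #|[pred i : ix | odd i]| = m.
  rewrite -[RHS]count_odd -sum1_card big_mkcond; apply: eq_bigr => i _.
  by rewrite inE; case: (odd i).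
rewrite (bigID (fun i : ix => odd i)) /=; congr (_ * _).
  have pi : odd (Ordinal (ltnW pm : p < (2 * m).+1)) by [].
  rewrite (bigD1 _ pi) /= op eqxx; congr (_ * _).
  rewrite (eq_bigr (fun=> n)) => [|i /andP[-> ip]]; last first.
    by rewrite ifN //; apply: contra ip => /eqP ip; apply/eqP/val_inj.
  rewrite prod_nat_const; congr (_ ^ _).
  have := cardD1 (Ordinal (ltnW pm : p < (2 * m).+1)) [pred i : ix | odd i].
  rewrite c_odd inE /= op add1n => mE; apply: etrans (esym (congr1 predn mE)).
  by apply: eq_card => i; rewrite !inE andbC.
rewrite (eq_bigr (fun=> 12)) => [|i /negbTE-> //]; rewrite prod_nat_const; congr (_ ^ _).
have := cardC [pred i : ix | odd i]; rewrite c_odd card_ord => E.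
have cC : #|[pred i : ix | ~~ odd i]| = #|[predC [pred i : ix | odd i]]| by apply: eq_card.
by apply: (@addnI m); rewrite [X in m + X]cC E mul2n -addnn addnS.
Qed.

End Alternating.

(** * Cycles that avoid the hub pattern *)

Section Exceptional.

Variables (V : finType) (e : rel V) (r : V -> nat) (m : nat).
Hypotheses (e_sym : symmetric e) (e_irr : irreflexive e) (r_inj : injective r).
Hypothesis r_out : forall v, #|[set u | e v u && (r v < r u)]| <= 12.
Hypothesis m_gt1 : 1 < m.

Local Notation ix := 'I_(2 * m).+1.

Let m2_gt0 : 0 < 2 * m. Proof. by lia. Qed.

Let odd2 k : odd (2 * k) = false. Proof. by rewrite mul2n odd_double. Qed.

Lemma alternating_out f i : alternating e r f -> i <= 2 * m -> ~~ odd i ->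
  at_ (m := m) f i \in out_nbrs e r (at_ f (if i == 0 then 1 else i.-1)).
Proof.
move=> [_ alt _ _] im oi; rewrite inE; case: eqP => [->|/eqP i0].
  by have [-> _ -> _] := alt 0 (ltnW m_gt1).
have [|_ e1 _ r1] := alt i./2.-1; first by move: im oi i0; case: (i) => //= j; lia.
have iE : i = (2 * i./2.-1).+2.
  have := odd_double_half i; rewrite (negbTE oi) add0n -mul2n.
  by case: (i./2) => [|h] E; [move: i0; rewrite -E muln0|rewrite -{1}E mulnS].
by rewrite [X in at_ f X.-1]iE [X in e _ (at_ f X)]iE [X in _ < r (at_ f X)]iE /= e1 r1.
Qed.

(** A search in which the m minima at odd positions are free, except one with only [c] choices; that
    saves a factor |V| / c. The m + 1 even positions cost 12 each. *)
Lemma card_alternating_plan (R : {set {ffun ix -> V}}) p c (mu rho : nat -> nat)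
    (S : nat -> V -> {set V}) : odd p -> p < 2 * m ->
  (forall i, i <= 2 * m ->
    (forall x y, S i x = S i y) \/ (mu i <= 2 * m) && (rho (mu i) < rho i)) ->
  (forall i x, #|S i x| <= if odd i then if i == p then c else #|V| else 12) ->
  (forall f i, f \in R -> i <= 2 * m -> at_ f i \in S i (at_ f (mu i))) ->
  #|R| <= c * #|V| ^ m.-1 * 12 ^ m.+1.
Proof.
move=> op pm wf cS RS; rewrite -(prod_odd_positions c #|V| op pm).
apply: (search_bound (mu := fun i : ix => inord (mu i) : ix) (S := fun i : ix => S i)
  (rho := fun i : ix => rho i)
  (kappa := fun i : ix => if odd i then if i == p :> nat then c else #|V| else 12)) => [i|i x|f fR i].
- have [h|/andP[h1 h2]] := wf i (ltn_ord i : i <= 2 * m); first by left.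
  by right; rewrite inordK.
- exact: cS.
- by have := RS f i fR (ltn_ord i : i <= 2 * m); rewrite {1}/at_ inord_val.
Qed.

Lemma card_alternating_in (R : {set {ffun ix -> V}}) (X : {set V}) p :
  odd p -> p < 2 * m -> {in R, forall f, alternating e r f /\ at_ f p \in X} ->
  #|R| <= #|X| * #|V| ^ m.-1 * 12 ^ m.+1.
Proof.
move=> op pm RX.
apply: (card_alternating_plan (p := p) (c := #|X|)
  (mu := fun i => if i == 0 then 1 else i.-1)
  (rho := fun i => ~~ odd i) (S := fun i x => if odd i then
    (if i == p then X else [set: V]) else out_nbrs e r x)) => // [i im|i x|f i fR im].
- case oi: (odd i); first by left.
  right; case: (i) im oi => [|j] /=; first by rewrite m2_gt0.
  by move=> /ltnW -> ->.
- by case: ifP => _; [case: ifP; rewrite ?cardsT|exact: r_out].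
- have [alt fX] := RX f fR; case: ifPn => [_|]; last exact: alternating_out.
  by case: eqP => [->|]; rewrite ?inE.
Qed.

(** The vertex at position 2k + 2 is found from its lower neighbour on one side. The minimum on its
    other side is then among its at most [d] neighbours instead of being free. *)
Lemma card_alternating_low (R : {set {ffun ix -> V}}) k d :
  k < m -> {in R, forall f, alternating e r f /\ #|nbrs e (at_ f (2 * k).+2)| <= d} ->
  #|R| <= d * #|V| ^ m.-1 * 12 ^ m.+1.
Proof.
move=> km Rd.
pose low x := if #|nbrs e x| <= d then nbrs e x else set0.
have low_le x : #|low x| <= d by rewrite /low; case: ifP; rewrite ?cards0.
have [km1|mk] := ltnP k.+1 m.
  apply: (card_alternating_plan (p := (2 * k.+1).+1) (c := d)
    (mu := fun i => if odd i then i.-1 else if i == 0 then 1 else i.-1)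
    (rho := fun i => if odd i then (if i == (2 * k.+1).+1 then 2 else 0)
       else (if i == 2 * k.+1 then 1 else 3))
    (S := fun i x => if odd i then (if i == (2 * k.+1).+1 then low x else [set: V])
       else out_nbrs e r x)) => // [||i im|i x|f i fR im].
  - by rewrite oddS odd2.
  - lia.
  - case oi: (odd i).
      case ip: (i == (2 * k.+1).+1); last by left.
      right; rewrite (eqP ip) succnK odd2 !eqxx andbT.
      by apply: ltnW; rewrite -(eqP ip).
    right; case: (i) im oi => [|j] jm /= oi; first by rewrite m2_gt0; case: (2 * k.+1).
    rewrite ltnW //=; move: oi => /negbFE oj; rewrite oj.
    case: eqP => [jE|_]; last by case: ifP.
    by case: eqP => // j1; move: oj; rewrite jE oddS odd2 in j1 *; lia.
  - by case: ifP => _; [case: ifP; rewrite ?cardsT|exact: r_out].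
  - have [alt fd] := Rd f fR; case oi: (odd i); last by apply: alternating_out; rewrite ?oi.
    case: eqP => [->|]; rewrite ?inE //=.
    have [_ /(_ _ km1)[e1 _ _ _] _ _] := alt.
    move: fd; rewrite (_ : (2 * k).+2 = 2 * k.+1); last by rewrite mulnS.
    by move=> fd; rewrite /low fd inE e_sym.
(* At the last maximum there is no minimum to the right. Position 2m is recovered from position 0,
   whose rank is lower, position 0 from position 1, and the saved minimum is the one at 2m - 1. *)
have kE : 2 * m = (2 * k).+2 by have := conj km mk; lia.
apply: (card_alternating_plan (p := (2 * k).+1) (c := d)
    (mu := fun i => if odd i then i.+1 else if i == 0 then 1 else
       if i == 2 * m then 0 else i.-1)
    (rho := fun i => if odd i then (if i == (2 * k).+1 then 3 else 0)
       else (if i == 2 * m then 2 else 1))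
    (S := fun i x => if odd i then (if i == (2 * k).+1 then low x else [set: V])
       else out_nbrs e r x)) => // [||i im|i x|f i fR im].
- by rewrite oddS odd2.
- by rewrite kE.
- case oi: (odd i).
    case: eqP => [iE|_]; last by left.
    by right; rewrite iE -kE leqnn odd2 !eqxx.
  right; case: (i) im oi => [|j] jm /= oi.
    have k1 : (1 == (2 * k).+1) = false by move: m_gt1 kE; clear; lia.
    have mN : (0 == 2 * m) = false by rewrite kE.
    by rewrite m2_gt0 k1 mN.
  move: oi => /negbFE oi; case: (j.+1 =P 2 * m) => [jE|jN] /=.
    by rewrite kE.
  rewrite ltnW //= oi /=; case: eqP => // jE.
  by move: jN; rewrite kE jE.
- by case: ifP => _; [case: ifP; rewrite ?cardsT|exact: r_out].
- have [alt fd] := Rd f fR; case oi: (odd i).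
    case: eqP => [->|]; rewrite ?inE //=.
    have [_ /(_ _ km)[_ e1 _ _] _ _] := alt.
    by rewrite /low fd inE e_sym.
  case: (i =P 2 * m) => [iE|iN]; last by have := alternating_out alt im (negbT oi).
  have [_ _ e1 r1] := alt; rewrite iE ifN ?inE ?e1 ?r1 //.
  by rewrite kE.
Qed.

Definition good_cycle (X B : {set V}) (f : {ffun ix -> V}) : bool :=
  [forall k : 'I_m, (at_ f (2 * k).+1 \notin X) && (at_ f (2 * k).+2 \in B)].

(** Fewer than m minima, a minimum in [X], or a maximum of degree at most [d]: each failure removes
    one free choice among |V| vertices. *)
Lemma card_exceptional (X B : {set V}) d : 0 < #|V| ->
  (forall v, v \notin B -> #|nbrs e v| <= d) ->
  #|[set f : {ffun ix -> V} | [&& is_cyc e f, oriented r f &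
      ~~ ((m <= #|dips (pattern r f)|) && good_cycle X B f)]]|
  <= (24 ^ (2 * m).+1 + m * (#|X| + d) * 12 ^ m.+1) * #|V| ^ m.-1.
Proof.
move=> V0 Bd; set E := [set f | _].
pose E0 := [set f : {ffun ix -> V} | is_cyc e f && (#|dips (pattern r f)| <= m.-1)].
pose A := [set f : {ffun ix -> V} | [&& is_cyc e f, oriented r f & m <= #|dips (pattern r f)|]].
pose E1 k := [set f in A | at_ f (2 * k).+1 \in X].
pose E2 k := [set f in A | at_ f (2 * k).+2 \notin B].
have Aalt f : f \in A -> alternating e r f.
  by rewrite inE => /and3P[fc fo fd]; exact: oriented_alternating.
apply: (@leq_trans #|E0 :|: \bigcup_(k in [set: 'I_m]) (E1 k :|: E2 k)|).
  apply: subset_leq_card; apply/subsetP => f; rewrite inE => /and3P[fc fo].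
  have [dm|dm] := leqP m #|dips (pattern r f)|; last first.
    move=> _; rewrite in_setU [f \in E0]inE fc /=.
    by rewrite -ltnS prednK ?dm // ltnW.
  move=> /forallPn[k]; rewrite negb_and negbK => h; rewrite in_setU.
  apply/orP; right; apply/bigcupP; exists k; first by rewrite inE.
  rewrite in_setU [f \in E1 k]inE [f \in E2 k]inE.
  by have -> : f \in A; [rewrite inE fc fo dm|].
apply: leq_trans (leq_card_setU _ _) _; rewrite mulnDl; apply: leq_add.
  by rewrite [X in _ <= X]mulnC; apply: card_few_dips.
apply: leq_trans (card_bigcup_const (k := (#|X| + d) * #|V| ^ m.-1 * 12 ^ m.+1) _) _.
  move=> k _; apply: leq_trans (leq_card_setU _ _) _; rewrite mulnDl mulnDl.
  have km := ltn_ord k; apply: leq_add.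
    apply: (@card_alternating_in _ _ (2 * k).+1); [by rewrite oddS odd2|lia|].
    by move=> f; rewrite inE => /andP[/Aalt].
  by apply: (card_alternating_low km) => f; rewrite inE => /andP[/Aalt ? /Bd].
by rewrite cardsT card_ord -!mulnA [12 ^ _ * _]mulnC.
Qed.

End Exceptional.

(** * Good cycles as weighted walks of hubs *)

Section GoodCycles.

Variables (V : finType) (e : rel V) (r : V -> nat) (K m : nat) (x0 : V).
Hypotheses (e_sym : symmetric e) (e_irr : irreflexive e) (e_K33 : K33_free e).
Hypotheses (r_inj : injective r) (K_gt0 : 0 < K) (m_gt1 : 1 < m).

Local Notation ix := 'I_(2 * m).+1.
Implicit Type f : {ffun ix -> V}.

Local Notation w := (weight e K).
Local Notation B := (big_hubs e K).
Local Notation B' := (hubs e K).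

Lemma linkedI x a b : x \notin bad e K -> a != b -> a \in B' -> b \in B' ->
  e x a -> e x b -> x \in linked e K a b.
Proof.
rewrite in_setU negb_or => /andP[xB' xN] ab aB bB xa xb.
rewrite inE in_setC xB' /= eq_sym eqEcard cards2 ab subUset !sub1set.
rewrite !in_setI aB bB [a \in _]inE [b \in _]inE xa xb /=.
by move: xN; rewrite inE -ltnNge.
Qed.

Lemma card_fibre (R : {set {ffun ix -> V}}) (S : nat -> {set V}) (kappa : nat -> nat) :
  (forall f i, f \in R -> i <= 2 * m -> at_ f i \in S i) ->
  (forall i, #|S i| <= kappa i) ->
  #|R| <= kappa 0 * \prod_(k < m) (kappa (2 * k).+1 * kappa (2 * k).+2).
Proof.
move=> RS cS.
have -> : kappa 0 * \prod_(k < m) (kappa (2 * k).+1 * kappa (2 * k).+2) =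
    \prod_(i < (2 * m).+1) kappa i.
  clear; elim: m => [|n IH]; first by rewrite muln0 big_ord_recr /= !big_ord0 muln1 mul1n.
  by rewrite mulnS !addSn add0n 2![in RHS]big_ord_recr /= -IH big_ord_recr /= !mulnA.
apply: (search_bound (mu := id) (S := fun (i : ix) _ => S i) (rho := fun=> 0)
  (kappa := fun i : ix => kappa i)) => [i|i _|f fR i]; [by left|exact: cS|].
by have := RS f i fR (ltn_ord i : i <= 2 * m); rewrite /at_ inord_val.
Qed.

Definition good : {set {ffun ix -> V}} :=
  [set f | [&& is_cyc e f, oriented r f, m <= #|dips (pattern r f)| &
    good_cycle (bad e K) B f]].

Lemma goodP f : f \in good -> [/\ alternating e r f,
  forall k, k < m -> at_ f (2 * k).+1 \notin bad e K &
  forall k, k < m -> at_ f (2 * k).+2 \in B].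
Proof.
rewrite inE => /and4P[fc fo fd /forallP fg].
split=> [|k km|k km]; first exact: oriented_alternating.
  by have /andP[] := fg (Ordinal km).
by have /andP[] := fg (Ordinal km).
Qed.

Lemma at_inj f i j : injective f -> i <= 2 * m -> j <= 2 * m ->
  at_ (m := m) f i = at_ f j -> i = j.
Proof. by move=> fi im jm /fi/(congr1 val); rewrite /= !inordK. Qed.

Lemma uniq_at f (h : nat -> nat) n : injective f -> injective h ->
  (forall k, k < n -> h k <= 2 * m) -> uniq [tuple at_ (m := m) f (h k) | k < n].
Proof.
move=> fi hi hm; rewrite map_inj_in_uniq ?enum_uniq // => i j _ _.
by move/(at_inj fi (hm _ (ltn_ord i)) (hm _ (ltn_ord j)))/hi/val_inj.
Qed.

Definition hub_case : {set {ffun ix -> V}} := [set f in good | at_ f 0 \in B'].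

Let tnth_at f (h : nat -> nat) n k : k < n ->
  nth x0 [tuple at_ (m := m) f (h k) | k < n] k = at_ f (h k).
Proof. by move=> kn; rewrite -(tnth_nth _ _ (Ordinal kn)) tnth_mktuple. Qed.

(** The vertices at positions 0, 2, ..., 2m are distinct hubs and each odd position is linked to its
    two neighbours. The closing edge supplies the rank condition, so that only one direction of the
    path occurs. *)
Lemma card_hub_case :
  #|hub_case| <= \sum_(v : m.+1.-tuple V | uniq v && (r (head x0 v) < r (last x0 v)))
    \prod_(p <- steps v) w p.1 p.2.
Proof.
pose ev f := [tuple at_ (m := m) f (2 * k) | k < m.+1].
rewrite -sum1_card (partition_big ev
  (fun v => uniq v && (r (head x0 v) < r (last x0 v)))) /=; last first.
  move=> f; rewrite inE => /andP[/goodP[[fi alt f0 r0] _ _] _]; apply/andP; split.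
    apply: (uniq_at (h := fun k => 2 * k)) => // [i j|k]; first by lia.
    by rewrite ltnS leq_mul2l.
  by rewrite -nth0 -nth_last size_tuple card_ord /= !(tnth_at f (fun k => 2 * k)).
apply: leq_sum => v /andP[uv _]; rewrite sum1dep_card.
rewrite (@big_steps_nth _ _ _ _ x0 _ _ m) ?size_tuple //.
(* No position beyond 2m enters the product. There [nth] may return the default, for which
   [linked_weight] lacks distinct hubs, so [kappa] is the cardinality itself. *)
apply: leq_trans (card_fibre
  (S := fun i => if odd i then linked e K (nth x0 v i./2) (nth x0 v i./2.+1)
     else [set nth x0 v i./2])
  (kappa := fun i => if odd i then (if i./2 < m then w (nth x0 v i./2) (nth x0 v i./2.+1)
     else #|linked e K (nth x0 v i./2) (nth x0 v i./2.+1)|) else 1) _ _) _.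
- move=> f i; rewrite inE => /andP[]; rewrite inE => /andP[/goodP[[fi alt f0 r0] gx gb] t0].
  move=> /eqP <- im; have hubE k : k <= m -> at_ f (2 * k) \in B'.
    case: k => [|k] km; first by rewrite muln0.
    by rewrite mulnS; apply: (subsetP (big_hubs_sub _ K_gt0)); exact: gb.
  case oi: (odd i); last first.
    rewrite (tnth_at f (fun k => 2 * k)); last by lia.
    by rewrite inE mul2n -[X in at_ f X == _](odd_double_half i) oi.
  have iE : i = (2 * i./2).+1 by rewrite -{1}(odd_double_half i) oi mul2n.
  have i2 : i./2 < m by lia.
  have [e1 e2 _ _] := alt _ i2.
  rewrite !(tnth_at f (fun k => 2 * k)) ?ltnS // 1?ltnW //.
  rewrite [X in at_ f X \in _]iE; apply: linkedI.
  + exact: gx.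
  + by apply/eqP => /(at_inj fi) E; have := E _ _; lia.
  + by apply: hubE; apply: ltnW.
  + exact: hubE.
  + exact: e1.
  + by rewrite mulnS.
- move=> i; case oi: (odd i); last by rewrite cards1.
  case: ifP => // i2; apply: linked_weight.
  by rewrite nth_uniq ?size_tuple ?ltnS //; lia.
rewrite mul1n; apply: leq_prod => k _ /=.
by rewrite !mul2n !odd_double /= !uphalf_double ltn_ord muln1.
Qed.

Definition low_case : {set {ffun ix -> V}} := [set f in good | at_ f 0 \notin B'].

(* [x] and [t] are positions 1 and 0 of an alternating map. *)
Let rung b c (p : V * V) : bool :=
  [&& p.1 \notin B', p.2 \notin B', e p.1 b, e p.2 c, e p.1 p.2 & r p.1 < r p.2].

(** The edge between positions 1 and 0 is a rung from the hub at position 2 to the hub at position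
    2m; all other minima are linked to consecutive hubs. *)
Lemma card_low_case :
  #|low_case| <= \sum_(v : m.-tuple V | uniq v && all (mem B) v)
    \sum_(p | rung (head x0 v) (last x0 v) p) \prod_(p <- steps v) w p.1 p.2.
Proof.
pose bt f := [tuple at_ (m := m) f (2 * k).+2 | k < m].
have hm k : k < m -> (2 * k).+2 <= 2 * m by lia.
rewrite pair_big_dep /= -sum1_card (partition_big (fun f => (bt f, (at_ f 1, at_ f 0)))
  (fun z => (uniq z.1 && all (mem B) z.1) && rung (head x0 z.1) (last x0 z.1) z.2)) /=; last first.
  move=> f; rewrite inE => /andP[/goodP[[fi alt f0 r0] gx gb] t0].
  apply/andP; split; first (apply/andP; split).
  - by apply: (uniq_at (h := fun k => (2 * k).+2)) => // i j; lia.
  - by apply/allP => b /mapP[k _ ->]; exact: gb.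
  have m0 : 0 < m := ltnW m_gt1.
  rewrite -nth0 -nth_last size_tuple card_ord !(tnth_at f (fun k => (2 * k).+2)) ?prednK //.
  have [e0 e1 r1 r2] := alt 0 m0; have := gx 0 m0; rewrite in_setU negb_or => /andP[x1 _].
  rewrite /rung /= t0 x1 e0 e1 r1 (_ : (2 * m.-1).+2 = 2 * m) ?f0 //.
  by case: (m) m0 => // n _; rewrite mulnS.
apply: leq_sum => -[v [x t]] /andP[/andP[/= uv _] _]; rewrite sum1dep_card.
have m1 : m = m.-1.+1 by rewrite prednK // ltnW.
rewrite (@big_steps_nth _ _ _ _ x0 _ _ m.-1) ?size_tuple //.
apply: leq_trans (card_fibre
  (S := fun i => if i == 0 then [set t] else if i == 1 then [set x] else
     if odd i then linked e K (nth x0 v i./2.-1) (nth x0 v i./2)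
     else [set nth x0 v i./2.-1])
  (kappa := fun i => if odd i && (i != 1) then (if i./2 < m then w (nth x0 v i./2.-1) (nth x0 v i./2)
     else #|linked e K (nth x0 v i./2.-1) (nth x0 v i./2)|) else 1) _ _) _.
- move=> f i; rewrite inE => /andP[]; rewrite inE => /andP[/goodP[[fi alt f0 r0] gx gb] t0].
  move=> /eqP[<- <- <-] im.
  case: eqP => [->|i0]; first by rewrite inE.
  case: eqP => [->|i1]; first by rewrite inE.
  have hubE k : k < m -> at_ f (2 * k).+2 \in B'.
    by move=> km; apply: (subsetP (big_hubs_sub _ K_gt0)); exact: gb.
  case oi: (odd i); last first.
    rewrite (tnth_at f (fun k => (2 * k).+2)); last by lia.
    rewrite inE (_ : (2 * i./2.-1).+2 = i) //.
    by have := odd_double_half i; rewrite oi; lia.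
  have iE : i = (2 * i./2).+1 by rewrite -{1}(odd_double_half i) oi mul2n.
  have i2 : i./2 < m by lia.
  have i3 : (2 * i./2.-1).+2 = 2 * i./2 by lia.
  have i4 : i./2.-1 < m by lia.
  have [e1 e2 _ _] := alt _ i2.
  rewrite !(tnth_at f (fun k => (2 * k).+2)) //.
  rewrite [X in at_ f X \in _]iE; apply: linkedI.
  + exact: gx.
  + by apply/eqP => /(at_inj fi) E; have := E _ _; lia.
  + exact: hubE.
  + exact: hubE.
  + by rewrite i3.
  + exact: e2.
- move=> i; case: eqP => [->|_]; first by rewrite cards1.
  case: (i =P 1) => [->|i1]; first by rewrite cards1.
  case oi: (odd i); last by rewrite cards1.
  rewrite /=; case: ifP => // i2; apply: linked_weight.
  by rewrite nth_uniq ?size_tuple //; lia.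
rewrite mul1n /=.
have -> : \prod_(k < m) ((if odd (2 * k).+1 && ((2 * k).+1 != 1) then
      if (2 * k).+1./2 < m then w (nth x0 v (2 * k).+1./2.-1) (nth x0 v (2 * k).+1./2)
      else #|linked e K (nth x0 v (2 * k).+1./2.-1) (nth x0 v (2 * k).+1./2)| else 1) *
     (if odd (2 * k).+2 && ((2 * k).+2 != 1) then
      if (2 * k).+2./2 < m then w (nth x0 v (2 * k).+2./2.-1) (nth x0 v (2 * k).+2./2)
      else #|linked e K (nth x0 v (2 * k).+2./2.-1) (nth x0 v (2 * k).+2./2)| else 1)) =
   \prod_(k < m) (if k == 0 :> nat then 1 else w (nth x0 v k.-1) (nth x0 v k)).
  apply: eq_bigr => k _; rewrite !mul2n /= odd_double uphalf_double ltn_ord muln1 /=.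
  by case: (val k).
have shiftE n : \prod_(k < n.+1) (if k == 0 :> nat then 1 else w (nth x0 v k.-1) (nth x0 v k)) =
    \prod_(k < n) w (nth x0 v k) (nth x0 v k.+1) by rewrite big_ord_recl mul1n.
by have := shiftE m.-1; rewrite -m1 => ->.
Qed.

Let head_rev_last (s : seq V) : head x0 (rev s) = last x0 s.
Proof. by case/lastP: s => // s y; rewrite rev_rcons last_rcons. Qed.

Let last_rev_head (s : seq V) : last x0 (rev s) = head x0 s.
Proof. by rewrite -head_rev_last revK. Qed.

Let w_sym u v : w u v = w v u.
Proof. exact: weight_sym. Qed.

(** Reversal preserves the product and exchanges the ends, so the paths with the rank condition and
    those without it each bound [hub_case]. *)
Lemma card_hub_case2 :
  2 * #|hub_case| <= \sum_(v : m.+1.-tuple V | uniq v) \prod_(p <- steps v) w p.1 p.2.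
Proof.
rewrite (bigID (fun v : m.+1.-tuple V => r (head x0 v) < r (last x0 v))) /= mul2n -addnn.
apply: leq_add; first exact: card_hub_case.
apply: leq_trans card_hub_case _.
rewrite [X in _ <= X](@big_tuple_rev _ _ _ _ _
  (fun s => uniq s && ~~ (r (head x0 s) < r (last x0 s)))
  (fun s => \prod_(p <- steps s) w p.1 p.2)).
rewrite big_mkcond [X in _ <= X]big_mkcond; apply: leq_sum => v _.
rewrite rev_uniq head_rev_last last_rev_head (big_steps_rev _ _ w_sym).
case: (uniq v) => //=; case: (ltnP (r (head x0 v))) => // lt.
by rewrite -leqNgt (ltnW lt).
Qed.

(** The bound is added to its image under reversal. Rungs with either order of the ranks together
    make up [rungs], which is at most twice the weight, and the factor 2 cancels. *)
Lemma card_low_case2 :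
  #|low_case| <= \sum_(v : m.-tuple V | uniq v)
    w (head x0 v) (last x0 v) * \prod_(p <- steps v) w p.1 p.2.
Proof.
pose P (s : seq V) := uniq s && all (mem B) s.
pose n b c := #|[pred p | rung b c p]|.
pose c (s : seq V) := \prod_(p <- steps s) w p.1 p.2.
have nE : #|low_case| <= \sum_(v : m.-tuple V | P v) n (head x0 v) (last x0 v) * c v.
  apply: leq_trans card_low_case _; apply: leq_sum => v _.
  by rewrite sum_nat_const.
have nE' : #|low_case| <= \sum_(v : m.-tuple V | P v) n (last x0 v) (head x0 v) * c v.
  apply: leq_trans nE _; rewrite (@big_tuple_rev _ _ _ _ _ P (fun s => n (head x0 s) (last x0 s) * c s)).
  apply: eq_leq; apply: eq_big => [v|v _]; first by rewrite /P rev_uniq all_rev.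
  by rewrite head_rev_last last_rev_head /c (big_steps_rev _ _ w_sym).
rewrite -(leq_pmul2l (_ : 0 < 2)) // [2 * #|_|]mul2n -addnn.
apply: leq_trans (leq_add nE nE') _; rewrite -big_split /= big_distrr /=.
rewrite big_mkcond [X in _ <= X]big_mkcond; apply: leq_sum => v _.
case: ifP => [/andP[uv Bv]|_]; last by case: ifP.
rewrite uv -mulnDl mulnA leq_mul2r; apply/orP; right.
set h := head x0 v; set l := last x0 v.
have m0 : 0 < m := ltnW m_gt1.
have [hv lv hl] : [/\ h \in v, l \in v & h != l].
  rewrite /h /l -nth0 -nth_last size_tuple; split; try by apply: mem_nth; rewrite size_tuple; lia.
  by rewrite nth_uniq ?size_tuple //; lia.
apply: leq_trans (rungs_weight e_sym e_irr e_K33 K_gt0 hl (allP Bv _ hv) (allP Bv _ lv)).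
rewrite /rungs /n -!sum1_card [X in _ <= X]big_mkcond /=.
have -> : \sum_(p | rung h l p) 1 = \sum_x \sum_t rung h l (x, t).
  by rewrite pair_big big_mkcond; apply: eq_bigr => -[x t] _ /=; case: (rung _ _ _).
have -> : \sum_(p | rung l h p) 1 = \sum_x \sum_t rung l h (t, x).
  by rewrite exchange_big pair_big big_mkcond; apply: eq_bigr => -[x t] _ /=; case: (rung _ _ _).
rewrite -big_split; apply: leq_sum => x _ /=; rewrite -big_split in_setC.
case: ifP => xB; last by rewrite big1 // => t _; rewrite /rung /= (negbFE xB) !andbF.
rewrite [X in _ <= X]big_mkcond; apply: leq_sum => t _; rewrite in_setC /rung /= xB.
case: ifP => // tB; rewrite ?andbF // [e t x]e_sym.
by case: (e x h); case: (e t l); case: (e x t) => //=; case: ltngtP.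
Qed.

Lemma card_good : 2 * #|good| <=
  \sum_(v : m.+1.-tuple V | uniq v) \prod_(p <- steps v) w p.1 p.2 +
  2 * \sum_(v : m.-tuple V | uniq v)
    w (head x0 v) (last x0 v) * \prod_(p <- steps v) w p.1 p.2.
Proof.
have -> : #|good| = #|hub_case| + #|low_case|.
  rewrite -(cardsID [set f : {ffun ix -> V} | at_ f 0 \in B'] good).
  by congr (_ + _); apply: eq_card => f; rewrite /hub_case /low_case !inE // andbC.
rewrite mulnDr; apply: leq_add; first exact: card_hub_case2.
by rewrite leq_mul2l card_low_case2.
Qed.

End GoodCycles.

Definition exceptional_const m : nat :=
  24 ^ (2 * m).+1 + m * (313 * 12 + 1) * 12 ^ m.+1.

(** Here [cp] stands for the subgraph traced by a map. Its invariance under rotation and flip lets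
    every image be represented by an oriented map, either exceptional or good. *)
Theorem cycle_images_le (V T : finType) (e : rel V) (K m : nat) (x0 : V)
    (cp : {ffun 'I_(2 * m).+1 -> V} -> T) :
  symmetric e -> irreflexive e -> K33_free e -> 0 < K -> #|V| <= K ^ 5 -> 1 < m ->
  (forall k f, cp (cyc_shift k f) = cp f) -> (forall f, cp (cyc_flip f) = cp f) ->
  2 * #|cp @: [set f | is_cyc e f]| <=
  2 * (exceptional_const m * K ^ 4 * #|V| ^ m.-1) +
  (\sum_(v : m.+1.-tuple V | uniq v) \prod_(p <- steps v) weight e K p.1 p.2 +
   2 * \sum_(v : m.-tuple V | uniq v)
    weight e K (head x0 v) (last x0 v) * \prod_(p <- steps v) weight e K p.1 p.2).
Proof.
move=> symE irrE K33 K0 VK m1 cp_shift cp_flip.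
have [r r_inj r_out] := sparse_order symE irrE K33.
have V0 : 0 < #|V| by apply/card_gt0P; exists x0.
have m2 : 0 < 2 * m by lia.
set exc := [set f : {ffun 'I_(2 * m).+1 -> V} | [&& is_cyc e f, oriented r f &
  ~~ ((m <= #|dips (pattern r f)|) && good_cycle (bad e K) (big_hubs e K) f)]].
have sub : cp @: [set f | is_cyc e f] \subset cp @: (exc :|: good e r K m).
  apply/subsetP => S /imsetP[f]; rewrite inE => fc ->.
  have cover g : is_cyc e g -> oriented r g -> cp g \in cp @: (exc :|: good e r K m).
    move=> gc go; apply: imset_f; rewrite in_setU [g \in exc]inE [g \in good _ _ _ _]inE.
    by rewrite gc go /=; case: (_ && _).
  have odd2 : ~~ odd (2 * m) by rewrite mul2n odd_double.
  have [k [ok|ok]] := oriented_rotation irrE r_inj m2 odd2 fc.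
    by rewrite -(cp_shift k); apply: cover => //; exact: shift_cyc.
  by rewrite -cp_flip -(cp_shift k); apply: cover => //; apply: shift_cyc; exact: flip_cyc.
have low v : v \notin big_hubs e K -> #|nbrs e v| <= K ^ 4.
  by rewrite inE -ltnNge => /ltnW.
have := card_exceptional symE r_inj r_out m1 (bad e K) V0 low; rewrite -/exc => excle.
apply: leq_trans (leq_mul (leqnn 2) (subset_leq_card sub)) _.
apply: leq_trans (leq_mul (leqnn 2) (leq_imset_card _ _)) _.
apply: leq_trans (leq_mul (leqnn 2) (leq_card_setU _ _)) _; rewrite mulnDr.
apply: leq_add; last exact: card_good.
rewrite leq_mul2l /=; apply: leq_trans excle _; rewrite leq_mul2r; apply/orP; right.
rewrite /exceptional_const mulnDl; apply: leq_add.
  by rewrite leq_pmulr // expn_gt0 K0.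
rewrite [X in _ <= X]mulnAC leq_mul2r -mulnA leq_mul2l; apply/orP; right; apply/orP; right.
by have := card_bad symE irrE K33 K0 VK; move: (K ^ 4) => k4; lia.
Qed.

(** * Weighted cycles and paths *)

Section CyclePathBound.

Import Order.TTheory GRing.Theory Num.Theory.
Local Open Scope ring_scope.

Variables (R : realFieldType) (E : R -> R).
Hypotheses (E_add : forall x y, E (x + y) = E x * E y) (E_ge : forall x, 1 + x <= E x).
Hypothesis E_gt0 : forall x, 0 < E x.

Let E0 : E 0 = 1.
Proof.
have := E_add 0 0; rewrite addr0 -{1}[E 0]mulr1 => /(mulfI _) -> //.
by rewrite gt_eqF.
Qed.

(** The tool is (1 + y)^2 <= E (2y). For o >= 1/2 the left side is at most ((d + o + u) / 2)^2. For
    small o this fails, so the exponent is shifted by 1/2, at the cost of a factor E (1/2) <= 2. *)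
Lemma exp_bound (d o u : R) : 0 <= d -> 0 <= o -> 0 <= u ->
  d / 4 + o * (u + d / 2) <= E (d + o + u - 2).
Proof.
move=> d0 o0 u0.
have sq x y : 0 <= x -> 1 + y = x -> x * x <= E (y + y).
  move=> x0 yx; rewrite E_add -yx; have := E_ge y; rewrite yx => le.
  by apply: ler_pM.
have [ge|lt] := lerP (1 / 2) o.
  have h : (d + o + u) / 2 * ((d + o + u) / 2) <= E (d + o + u - 2).
    rewrite (_ : _ - 2 = ((d + o + u) / 2 - 1) + ((d + o + u) / 2 - 1)); last by lra.
    by apply: sq; lra.
  have p1 : 0 <= d * (o - 1 / 2) by apply: mulr_ge0 => //; lra.
  have p2 : 0 <= (o - d - u) ^+ 2 by exact: sqr_ge0.
  by apply: le_trans h; move: p1 p2; rewrite expr2; nra.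
pose y := (d + o + u + 1 / 2) / 2.
have y2 : y * y <= E (d + o + u - 2) * E (1 / 2).
  rewrite -E_add (_ : d + o + u - 2 + 1 / 2 = (y - 1) + (y - 1)); last by rewrite /y; lra.
  by apply: sq; rewrite /y; lra.
have Eh : E (1 / 2) <= 2.
  have : E (1 / 2) * E (- (1 / 2)) = 1 by rewrite -E_add addrN E0.
  have := E_ge (- (1 / 2)); have := E_gt0 (1 / 2); nra.
have : d / 4 + o * (u + d / 2) <= y * y / 2.
  have p1 : 0 <= u * (1 / 2 - o) by apply: mulr_ge0 => //; lra.
  have p2 : 0 <= (d + u - 1 / 2 - o) ^+ 2 by exact: sqr_ge0.
  by move: p1 p2; rewrite expr2 /y; nra.
have := E_gt0 (d + o + u - 2); nra.
Qed.

Variables (V : finType) (w : V -> V -> R) (x0 : V) (m : nat).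
Hypotheses (w_ge0 : forall x y, 0 <= w x y) (w_sym : forall x y, w x y = w y x).
Hypotheses (w_diag : forall x, w x x = 0) (m_gt2 : (2 < m)%N).
Hypothesis w_sum : \sum_x \sum_y w x y <= 2 * m%:R.

Let row x : R := \sum_y w x y.
Let outer x (s : seq V) : R := \sum_(y | y \notin s) w x y.
Let inner x (s : seq V) : R := \sum_(y <- s) w x y.
Let path_weight (s : seq V) : R := \prod_(p <- steps s) w p.1 p.2.

Let path_weight_cons x y s : path_weight [:: x, y & s] = w x y * path_weight (y :: s).
Proof. exact: (big_steps_cons2 _ w x y s). Qed.

Let path_weight1 x : path_weight [:: x] = 1.
Proof. exact: big_nil. Qed.

(** The normalising factors of a random walk that grows a path from its last edge towards its head:
    from [y] the next vertex is drawn outside the part already built, with probability proportional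
    to [w]. The last vertex has no factor. *)
Fixpoint tail_prod (s : seq V) : R :=
  if s is y :: s' then (if s' is [::] then 1 else outer y s * tail_prod s') else 1.

Fixpoint tail_sum (s : seq V) : R :=
  if s is y :: s' then (if s' is [::] then 0 else outer y s + tail_sum s') else 0.

Let outer_ge0 x s : 0 <= outer x s.
Proof. by apply: sumr_ge0 => y _. Qed.

Let inner_ge0 x s : 0 <= inner x s.
Proof. by apply: sumr_ge0 => y _. Qed.

Let path_weight_ge0 s : 0 <= path_weight s.
Proof. by apply: prodr_ge0 => p _. Qed.

Let tail_prod_ge0 s : 0 <= tail_prod s.
Proof. by elim: s => //= y [|z s] IH //; apply: mulr_ge0. Qed.

Let outer_inner x s : uniq s -> outer x s + inner x s = row x.
Proof.
by move=> us; rewrite /row (bigID (mem s)) /= addrC /inner big_uniq.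
Qed.

Let tail_prod_le s : tail_prod s <= E (tail_sum s - (size s).-1%:R).
Proof.
elim: s => [|y [|z s] IH]; try by rewrite subr0 E0.
rewrite [tail_prod _]/= [tail_sum _]/=.
rewrite (_ : _ - _ = (outer y [:: y, z & s] - 1) + (tail_sum (z :: s) - (size (z :: s)).-1%:R)).
  rewrite E_add; apply: ler_pM; [exact: outer_ge0|exact: (tail_prod_ge0 (z :: s))| |exact: IH].
  by have := E_ge (outer y [:: y, z & s] - 1); rewrite addrC subrK.
by rewrite /= -natr1; lra.
Qed.

Let tail_prod_eq0 y s : uniq (y :: s) -> tail_prod s = 0 -> path_weight (y :: s) = 0.
Proof.
elim: s y => [|z s IH] y; first by move=> _ /eqP; rewrite oner_eq0.
move=> /[dup] uy /andP[ys us]; rewrite path_weight_cons.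
case: s IH us ys uy => [|z' s] IH us ys uy; first by move=> /eqP; rewrite oner_eq0.
move=> /eqP; rewrite mulf_eq0 => /orP[/eqP o0|/eqP q0]; last by rewrite (IH z us q0) mulr0.
suff -> : w y z = 0 by rewrite mul0r.
apply/eqP; rewrite eq_le w_ge0 andbT -o0 w_sym /outer (bigD1 y) //=.
by rewrite lerDl sumr_ge0.
Qed.

(** Each term is the weight of the last edge times the probability of the walk that follows. Summing
    over the head first gives a factor 1, or 0 when [outer] vanishes, and the last edges have total
    weight at most 2m. *)
Lemma sum_path_tail k :
  \sum_(t : k.+2.-tuple V | uniq t) path_weight t / tail_prod (behead t) <= 2 * m%:R.
Proof.
elim: k => [|k IH].
  apply: le_trans w_sum.
  rewrite (@big_tuple_cons _ _ _ _ _ uniq (fun t => path_weight t / tail_prod (behead t))).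
  rewrite (@big_tuple_cons _ _ _ _ _ predT (fun t => \sum_(x | uniq (x :: t))
     path_weight (x :: t) / tail_prod (behead (x :: t)))).
  rewrite (eq_bigr (fun=> \sum_y \sum_(x | x != y) w y x)) => [|t _].
    rewrite sumr_const card_tuple expn0 mulr1n; apply: ler_sum => y _.
    by rewrite [X in _ <= X](bigID (fun x => x != y)) /= lerDl sumr_ge0.
  rewrite tuple0; apply: eq_bigr => y _; apply: eq_big => x; first by rewrite /= inE andbT.
  by rewrite path_weight_cons path_weight1 mulr1 divr1 w_sym.
rewrite (@big_tuple_cons _ _ _ _ _ uniq (fun t => path_weight t / tail_prod (behead t))).
apply: le_trans IH; rewrite [X in _ <= X]big_mkcond; apply: ler_sum => t _.
case: ifP => [ut|nut]; last by rewrite big_pred0 // => x; rewrite /= nut andbF.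
case: t ut => -[|y [|z s]] //= _ ut.
rewrite (eq_bigr (fun x => path_weight [:: y, z & s] / tail_prod (z :: s) /
    outer y [:: y, z & s] * w y x)) => [|x _]; last first.
  by rewrite path_weight_cons invfM [w x y]w_sym; ring.
rewrite -big_distrr /= -mulrA.
rewrite (eq_bigl (fun x => x \notin [:: y, z & s])); last by move=> x; rewrite /= ut andbT.
rewrite -/(outer y [:: y, z & s]) -[X in _ <= X]mulr1; apply: ler_wpM2l.
  by apply: divr_ge0; [exact: path_weight_ge0|exact: (tail_prod_ge0 (z :: s))].
have [->|n0] := eqVneq (outer y [:: y, z & s]) 0; first by rewrite mulr0.
by rewrite mulVf.
Qed.

(** The total weight of the edges that meet [s]; [inner] sees an edge inside [s] from both ends,
    hence the half. *)
Let touch (s : seq V) : R := \sum_(x <- s) outer x s + (\sum_(x <- s) inner x s) / 2.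

Let touchE s : uniq s -> touch s = \sum_(x <- s) row x - (\sum_(x <- s) inner x s) / 2.
Proof.
move=> us; rewrite (eq_bigr (fun x => outer x s + inner x s)) => [|x _].
  by rewrite big_split /= /touch; lra.
by rewrite outer_inner.
Qed.

Let touch_cons y s : uniq (y :: s) -> touch (y :: s) = touch s + outer y (y :: s).
Proof.
move=> /[dup] uys /andP[ys us]; rewrite !touchE // !big_cons.
have -> : \sum_(x <- s) inner x (y :: s) = inner y s + \sum_(x <- s) inner x s.
  rewrite {2}/inner -big_split /=; apply: eq_bigr => x _.
  by rewrite /inner big_cons w_sym.
have yy : inner y (y :: s) = inner y s by rewrite /inner big_cons w_diag add0r.
by have := outer_inner y uys; rewrite yy; lra.
Qed.

(** An edge with both ends on the path is counted at its later end only, because the suffix starting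
    at the earlier end contains the other. The row of the last vertex completes the sum. *)
Let tail_sum_touch y s : uniq (y :: s) ->
  tail_sum (y :: s) + row (last y s) = touch (y :: s).
Proof.
elim: s y => [|z s IH] y uy.
  rewrite /= touchE // !big_seq1 /inner big_seq1 w_diag; lra.
rewrite touch_cons // -IH; last by case/andP: uy.
rewrite (_ : tail_sum [:: y, z & s] = outer y [:: y, z & s] + tail_sum (z :: s)) //.
by rewrite [last y _]/=; lra.
Qed.

Let touch_le s : uniq s -> touch s <= m%:R.
Proof.
move=> us; have : \sum_x row x = \sum_(x <- s) row x + \sum_(x | x \notin s) row x.
  by rewrite (bigID (mem s)) /= big_uniq.
have : \sum_(x <- s) outer x s <= \sum_(x | x \notin s) row x.
  rewrite /outer exchange_big /=; apply: ler_sum => x xs.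
  rewrite -(outer_inner x us) /inner (eq_bigr (w x)) ?lerDr ?outer_ge0 // => y _.
have : touch s = \sum_(x <- s) row x - (\sum_(x <- s) inner x s) / 2 by exact: touchE.
have : touch s = \sum_(x <- s) outer x s + (\sum_(x <- s) inner x s) / 2 by [].
move: w_sum; rewrite -/row; lra.
Qed.

(** This is u + d / 2 for the values of [u] and [d] at which [exp_bound] is used in [pointwise]. It
    may be small for a single cycle, so only its average is bounded below. *)
Let slack (s : seq V) : R :=
  m%:R - touch s + inner (last x0 s) s - w (last x0 s) (head x0 s) +
  (outer (head x0 s) s + outer (last x0 s) s) / 2.

(** [exp_bound] and [tail_prod_le] have opposite exponents: with D the outer weight of the two ends
    and o the weight of the closing edge, [tail_sum_touch] turns the second into -(D + o + u - 2).
    The product of the two estimates is therefore 1. *)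
Let pointwise s : uniq s -> size s = m ->
  path_weight s * ((outer (head x0 s) s + outer (last x0 s) s) / 4 +
    w (last x0 s) (head x0 s) * slack s) <= path_weight s / tail_prod (behead s).
Proof.
case: s => [|y [|z s]] us sz; try by move: m_gt2; rewrite -sz.
set T := [:: y, z & s] in us sz *; have /andP[_ us'] := us.
rewrite /slack [head _ _]/= (_ : last x0 T = last z s) // (_ : behead T = z :: s) //.
set l := last z s; set D := outer y T + outer l T.
set u := m%:R - touch T + inner l T - w l y.
have u0 : 0 <= u.
  have -> : u = (m%:R - touch T) + inner l (z :: s) by rewrite /u /inner big_cons; lra.
  by apply: addr_ge0; [rewrite subr_ge0; exact: touch_le|exact: inner_ge0].
have tE : tail_sum (z :: s) - (size (z :: s)).-1%:R = - (D + w l y + u - 2).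
  have := tail_sum_touch us'; have := touch_cons us; rewrite -/T -/l.
  have := outer_inner l us; rewrite -/T.
  have mR : m%:R = (size (z :: s)).-1%:R + 2 :> R by rewrite -sz /= -!natr1; lra.
  by rewrite /u /D mR; lra.
have [q0|q0] := eqVneq (tail_prod (z :: s)) 0.
  by rewrite (tail_prod_eq0 us q0) !mul0r.
have qgt : 0 < tail_prod (z :: s) by rewrite lt_neqAle eq_sym q0 tail_prod_ge0.
apply: ler_wpM2l; first exact: path_weight_ge0.
rewrite -[X in _ <= X]mul1r ler_pdivlMr //.
have D0 : 0 <= D by rewrite addr_ge0.
have := exp_bound D0 (w_ge0 l y) u0; rewrite -/u => le1.
have := tail_prod_le (z :: s); rewrite tE => le2.
apply: le_trans (ler_pM _ _ le1 le2) _ => //.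
- by apply: addr_ge0; [apply: divr_ge0|apply: mulr_ge0 => //; apply: addr_ge0 => //; apply: divr_ge0].
by rewrite -E_add subrr E0.
Qed.

Let cyc_weight (s : seq V) : R := w (last x0 s) (head x0 s) * path_weight s.

Let cyc_weight_rot s : (1 < size s)%N -> cyc_weight (rot 1 s) = cyc_weight s.
Proof.
case: s => [|x [|y s]] // _; rewrite /cyc_weight path_weight_cons.
have -> : rot 1 [:: x, y & s] = rcons (y :: s) x by rewrite rot1_cons.
rewrite last_rcons (_ : head x0 (rcons (y :: s) x) = y) // (_ : last x0 [:: x, y & s] = last y s) //.
rewrite (_ : head x0 _ = x) //.
have -> : path_weight (rcons (y :: s) x) = path_weight (y :: s) * w (last y s) x.
  by rewrite lastI; exact: (big_steps_rcons2 _ w).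
ring.
Qed.

Let avg (phi : seq V -> R) : R := \sum_(t : m.-tuple V | uniq t) cyc_weight t * phi t.

Let avg_rot1 phi : avg phi = avg (fun s => phi (rot 1 s)).
Proof.
rewrite /avg (@big_tuple_rot _ _ _ _ _ 1 uniq (fun t => cyc_weight t * phi t)).
apply: eq_big => [t|t _]; first by rewrite rot_uniq.
by rewrite cyc_weight_rot // size_tuple ltnW.
Qed.

Let avg_ext phi psi : (forall s, uniq s -> size s = m -> phi s = psi s) -> avg phi = avg psi.
Proof. by move=> h; apply: eq_bigr => t ut; rewrite h // size_tuple. Qed.

Let avg_le phi psi : (forall s, uniq s -> size s = m -> phi s <= psi s) -> avg phi <= avg psi.
Proof.
move=> h; apply: ler_sum => t ut; rewrite ler_wpM2l ?h ?size_tuple //.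
by rewrite mulr_ge0.
Qed.

Let avg_rot k phi : (k <= m)%N -> avg phi = avg (fun s => phi (rot k s)).
Proof.
elim: k => [|k IH] km; first by apply: avg_ext => s _ _; rewrite rot0.
rewrite IH 1?ltnW // avg_rot1; apply: avg_ext => s _ sz.
by rewrite [rot k.+1 s]rotS ?sz // rot_rot.
Qed.

Let avgD phi psi : avg (fun s => phi s + psi s) = avg phi + avg psi.
Proof. by rewrite /avg -big_split; apply: eq_bigr => t _; rewrite mulrDr. Qed.

Let avgZ a phi : avg (fun s => a * phi s) = a * avg phi.
Proof. by rewrite /avg big_distrr; apply: eq_bigr => t _; rewrite mulrCA. Qed.

Let avg_head (psi : V -> seq V -> R) : (forall x k s, psi x (rot k s) = psi x s) ->
  avg (fun s => \sum_(x <- s) psi x s) = m%:R * avg (fun s => psi (head x0 s) s).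
Proof.
move=> h.
have -> : avg (fun s => \sum_(x <- s) psi x s) =
    \sum_(i < m) avg (fun s => psi (nth x0 s i) s).
  rewrite /avg exchange_big; apply: eq_bigr => t ut.
  by rewrite -mulr_sumr (big_nth x0) big_mkord size_tuple.
rewrite (eq_bigr (fun=> avg (fun s => psi (head x0 s) s))) => [|i _].
  by rewrite sumr_const card_ord mulr_natl.
rewrite [RHS](@avg_rot i) 1?ltnW //; apply: avg_ext => s us sz.
by rewrite h -nth0 nth_cat size_drop sz subn_gt0 ltn_ord nth_drop addn0.
Qed.

Let outer_rot x k s : outer x (rot k s) = outer x s.
Proof. by apply: eq_bigl => y; rewrite mem_rot. Qed.

Let inner_rot x k s : inner x (rot k s) = inner x s.
Proof. by apply: perm_big; rewrite perm_rot. Qed.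

Let avg_last (psi : V -> seq V -> R) : (forall x k s, psi x (rot k s) = psi x s) ->
  avg (fun s => psi (last x0 s) s) = avg (fun s => psi (head x0 s) s).
Proof.
move=> h; rewrite avg_rot1; apply: avg_ext => s _ sz; rewrite h.
by case: s sz => // y s _; rewrite rot1_cons last_rcons.
Qed.

(* Averaged over the rotations of a cycle, the slack is at least 1. *)
Let avg_slack : avg (fun=> 1) <= avg slack.
Proof.
set a := avg (fun s => w (last x0 s) (head x0 s)).
set o := avg (fun s => outer (head x0 s) s); set i := avg (fun s => inner (head x0 s) s).
have touchA : avg touch = m%:R * (o + i / 2).
  rewrite /touch avgD (avg_head outer_rot) -/o.
  rewrite (_ : avg (fun s => _ / 2) = avg (fun s => 2^-1 * \sum_(x <- s) inner x s)).
    by rewrite avgZ (avg_head inner_rot) -/i; lra.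
  by apply: avg_ext => s _ _; rewrite mulrC.
have touch_le1 : avg touch <= m%:R * avg (fun=> 1).
  by rewrite -avgZ; apply: avg_le => s us _; rewrite mulr1 touch_le.
have ai : 2 * a <= i.
  have a2 : avg (fun s => w (head x0 s) (nth x0 s 1)) = a.
    rewrite /a [RHS]avg_rot1; apply: avg_ext => s _ sz.
    by case: s sz => [|x [|y s]] sz; try (by move: m_gt2; rewrite -sz); rewrite rot1_cons last_rcons.
  have -> : 2 * a = avg (fun s => w (head x0 s) (nth x0 s 1) + w (last x0 s) (head x0 s)).
    by rewrite avgD a2 -/a; lra.
  rewrite /i; apply: avg_le => s us sz; case: s us sz => [|x [|y [|z s]]] us sz;
    try by move: m_gt2; rewrite -sz.
  rewrite /inner 2!big_cons w_diag add0r /= lerD2l w_sym.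
  by rewrite (big_rem (last z s)) ?mem_last //= lerDl sumr_ge0.
set tch := avg touch in touchA touch_le1 *.
have slackA : avg slack = m%:R * avg (fun=> 1) - tch + i - a + o.
  rewrite (_ : avg slack = avg (fun s => m%:R * 1 + ((-1) * touch s + (inner (last x0 s) s +
    ((-1) * w (last x0 s) (head x0 s) + (2^-1 * outer (head x0 s) s + 2^-1 * outer (last x0 s) s)))))).
    by rewrite !avgD !avgZ (avg_last inner_rot) (avg_last outer_rot) -/a -/o -/i -/tch; lra.
  by apply: avg_ext => s _ _; rewrite /slack; lra.
have m0 : 0 < m%:R :> R by rewrite ltr0n; lia.
have le1 : o + i / 2 <= avg (fun=> 1) by move: touch_le1; rewrite touchA ler_pM2l.
(* Let c be the average of 1 and t = o + i / 2, so that t <= c. As i >= 2a, the averaged slack is at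
   least m (c - t) + t, which is at least c. *)
have : 0 <= (m%:R - 1) * (avg (fun=> 1) - (o + i / 2)).
  by apply: mulr_ge0; rewrite subr_ge0 // ler1n -(ltr0n R).
by rewrite slackA touchA; lra.
Qed.

(** Summing [pointwise] over m-tuples, the outer weights extend a path at its head or at its last
    vertex. Both give the sum A over paths of m + 1 vertices, so they contribute 2A / 4. The closing
    edges contribute the averaged slack, at least the cycle sum. *)
Theorem cycle_path_bound :
  \sum_(t : m.-tuple V | uniq t) w (last x0 t) (head x0 t) * (\prod_(p <- steps t) w p.1 p.2) +
  (\sum_(t : m.+1.-tuple V | uniq t) \prod_(p <- steps t) w p.1 p.2) / 2 <= 2 * m%:R.
Proof.
have mE : m = m.-2.+2 by lia.
pose A := \sum_(t : m.-tuple V | uniq t) path_weight t * outer (head x0 t) t.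
have AE : \sum_(t : m.+1.-tuple V | uniq t) path_weight t = A.
  rewrite (@big_tuple_cons _ _ _ _ _ uniq path_weight) [RHS]big_mkcond; apply: eq_bigr => t _.
  case: ifP => ut; last by rewrite big_pred0 // => x; rewrite /= ut andbF.
  have sz : size t = m by rewrite size_tuple.
  case: (val t) ut sz => [|y s] ut sz; first by move: m_gt2; rewrite -sz.
  rewrite /outer mulr_sumr; apply: eq_big => x; first by rewrite cons_uniq ut andbT.
  by rewrite path_weight_cons mulrC w_sym.
have AE' : \sum_(t : m.-tuple V | uniq t) path_weight t * outer (last x0 t) t = A.
  rewrite /A (@big_tuple_rev _ _ _ _ _ uniq (fun t => path_weight t * outer (head x0 t) t)).
  apply: eq_big => [t|t _]; first by rewrite rev_uniq.
  rewrite /path_weight (big_steps_rev _ _ w_sym) -/(path_weight t); congr (_ * _).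
  have sz : size t = m by rewrite size_tuple.
  case/lastP: (val t) sz => [|s y] sz; first by move: m_gt2; rewrite -sz.
  by rewrite rev_rcons last_rcons; apply: eq_bigl => z; rewrite -rev_rcons mem_rev.
have le1 : \sum_(t : m.-tuple V | uniq t) path_weight t *
    ((outer (head x0 t) t + outer (last x0 t) t) / 4 + w (last x0 t) (head x0 t) * slack t)
    <= 2 * m%:R.
  apply: (@le_trans _ _ (\sum_(t : m.-tuple V | uniq t) path_weight t / tail_prod (behead t))).
    by apply: ler_sum => t ut; apply: pointwise; rewrite ?size_tuple.
  by have := sum_path_tail m.-2; rewrite -mE.
have le2 : \sum_(t : m.-tuple V | uniq t) path_weight t *
    ((outer (head x0 t) t + outer (last x0 t) t) / 4 + w (last x0 t) (head x0 t) * slack t)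
    = (A + A) / 4 + avg slack.
  rewrite -{2}AE' /A -big_split /= mulr_suml /avg -big_split /=.
  by apply: eq_bigr => t _; rewrite /cyc_weight; ring.
have le3 : avg (fun=> 1) = \sum_(t : m.-tuple V | uniq t) w (last x0 t) (head x0 t) * path_weight t.
  by apply: eq_bigr => t _; rewrite mulr1.
rewrite -/path_weight AE; move: avg_slack; rewrite le3; move: le1; rewrite le2; lra.
Qed.

End CyclePathBound.

From mathcomp Require Import all_classical all_reals all_analysis.

Import Order.TTheory GRing.Theory Num.Theory.
Import numFieldNormedType.Exports.

(** * Planar graphs have no K33 minor *)

Section Arcs.

Local Open Scope classical_set_scope.
Local Open Scope ring_scope.

Variable R : realType.

Definition eps_close (eps : R) (p q : R * R) : bool :=
  (`|p.1 - q.1| < eps) && (`|p.2 - q.2| < eps).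

Definition eps_continuous (f : R -> R * R) : Prop :=
  forall x eps, x \in `[0, 1] -> 0 < eps -> exists2 delta, 0 < delta &
    forall y, y \in `[0, 1] -> `|x - y| < delta -> eps_close eps (f x) (f y).

Lemma within_eps_continuous (f : R -> R * R) :
  {within `[0, 1], continuous f}%classic -> eps_continuous f.
Proof.
move=> /subspace_continuousP fc x eps x01 e0.
have /fc /cvg_ballP/(_ _ e0) : `[0, 1]%classic x by rewrite /=.
rewrite near_withinE => /nbhs_ballP[d /= d0 h]; exists d => // y y01 xy.
have /(_ y01) := h y xy.
by case=> /= h1 h2; apply/andP; split.
Qed.

Lemma eps_closeC eps p q : eps_close eps p q = eps_close eps q p.
Proof. by rewrite /eps_close distrC [in X in _ && X]distrC. Qed.

Lemma eps_close_trans e1 e2 p q r : eps_close e1 p q -> eps_close e2 q r -> eps_close (e1 + e2) p r.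
Proof.
move=> /andP[p1 p2] /andP[q1 q2]; apply/andP; split.
  by rewrite -(subrKA q.1); apply: le_lt_trans (ler_normD _ _) _; exact: ltrD.
by rewrite -(subrKA q.2); apply: le_lt_trans (ler_normD _ _) _; exact: ltrD.
Qed.

Lemma eps_closeW e1 e2 p q : e1 <= e2 -> eps_close e1 p q -> eps_close e2 p q.
Proof. by move=> le /andP[p1 p2]; rewrite /eps_close !(lt_le_trans _ le). Qed.

Lemma eps_continuous_uniform f eps : eps_continuous f -> 0 < eps -> exists N : nat,
  forall x y, x \in `[0, 1] -> y \in `[0, 1] -> `|x - y| <= N.+1%:R^-1 -> eps_close eps (f x) (f y).
Proof.
move=> fc e0; have /compact_near_coveringP := @segment_compact R 0 1.
move=> /(_ _ \oo (fun N x => x \in `[0, 1] -> forall y, y \in `[0, 1] ->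
  `|x - y| <= N.+1%:R^-1 -> eps_close eps (f x) (f y))) [x x01|N _ h].
  have e2 : 0 < eps / 2 by lra.
  have [d d0 h] := fc x _ x01 e2; have d2 : 0 < d / 2 by lra.
  near=> x' N => /= x'01 y y01 xy.
  have xx' : `|x - x'| < d / 2.
    by near: x'; apply: nbhsx_ballx.
  have Nd : N.+1%:R^-1 < d / 2.
    by near: N; apply: near_infty_natSinv_lt (PosNum d2).
  rewrite [eps]splitr; apply: (@eps_close_trans _ _ _ (f x)).
    by rewrite eps_closeC; apply: h => //; lra.
  apply: h => //; rewrite -(subrKA x'); apply: le_lt_trans (ler_normD _ _) _.
  by rewrite [ltRHS]splitr; apply: ltrD xx' _; exact: le_lt_trans xy Nd.
exists N => x y x01 y01; exact: (h N (leqnn N) x x01 x01).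
Unshelve. all: by end_near.
Qed.

(** Compactness of the interval is used twice, for [t] with [s] near a fixed point and then for [s].
    The bound is sought among the numbers 1 / (N + 1), so that it can be treated as a limit along
    N. *)
Lemma eps_continuous_separated f g : eps_continuous f -> eps_continuous g ->
  (forall s t, s \in `[0, 1] -> t \in `[0, 1] -> f s <> g t) -> exists2 eps, 0 < eps &
  forall s t, s \in `[0, 1] -> t \in `[0, 1] -> ~~ eps_close eps (f s) (g t).
Proof.
move=> fc gc fg; have /compact_near_coveringP cpt := @segment_compact R 0 1.
have [s s01|N _ h] := cpt _ \oo (fun N s => s \in `[0, 1] -> forall t, t \in `[0, 1] ->
  ~~ eps_close N.+1%:R^-1 (f s) (g t)).
  have [|[A B] /= [sA NB] h] := cpt _ (filter_prod (nbhs s) \oo) (fun p t => p.1 \in `[0, 1] ->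
    t \in `[0, 1] -> ~~ eps_close p.2.+1%:R^-1 (f p.1) (g t)).
  + move=> t t01.
    have [eps e0 ne] : exists2 eps : R, 0 < eps & ~~ eps_close (eps + eps + eps) (f s) (g t).
      have : (f s).1 != (g t).1 \/ (f s).2 != (g t).2.
        apply/orP; rewrite -negb_and; apply/negP => /andP[/eqP e1 /eqP e2].
        by apply: (fg s t s01 t01); rewrite [f s]surjective_pairing e1 e2 -surjective_pairing.
      case=> ne; rewrite -subr_eq0 -normr_gt0 in ne.
        exists (`|(f s).1 - (g t).1| / 3); rewrite ?divr_gt0 //.
        rewrite /eps_close negb_and -!leNgt; apply/orP; left.
        by rewrite (_ : _ + _ + _ = `|(f s).1 - (g t).1|) //; lra.
      exists (`|(f s).2 - (g t).2| / 3); rewrite ?divr_gt0 //.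
      rewrite /eps_close negb_and -!leNgt; apply/orP; right.
      by rewrite (_ : _ + _ + _ = `|(f s).2 - (g t).2|) //; lra.
    have [d d0 hd] := fc s eps s01 e0; have [d' d'0 hd'] := gc t eps t01 e0.
    near=> t' p => /= p01 t'01; apply: contra ne => cl.
    have tt' : `|t - t'| < d' by near: t'; apply: nbhsx_ballx.
    have sp : `|s - p.1| < d.
      near: p; exists (ball s d, setT) => /=; first by split; [exact: nbhsx_ballx|exact: filterT].
      by move=> -[a b] [/= ab _].
    have pN : p.2.+1%:R^-1 < eps.
      near: p; exists (setT, [set k : nat | k.+1%:R^-1 < eps]) => /=.
        by split; [exact: filterT|exact: near_infty_natSinv_lt (PosNum e0)].
      by move=> -[a b] [].
    apply: eps_close_trans (_ : eps_close eps (g t') (g t)); last by rewrite eps_closeC hd'.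
    apply: eps_close_trans (hd _ p01 sp) _.
    exact: eps_closeW (ltW pN) cl.
  + exists (A, B) => //= -[a b] /= [Aa Bb] a01 t t01.
    exact: (h (a, b) (conj Aa Bb) t t01 a01 t01).
exists N.+1%:R^-1; first by rewrite invr_gt0.
by move=> s t s01; exact: (h N (leqnn N) s s01 s01).
Unshelve. all: by end_near.
Qed.

End Arcs.

Lemma finite_eps (R : realDomainType) (T : finType) (Q : T -> R -> Prop) :
  (forall x d d', (d' <= d)%R -> Q x d -> Q x d') ->
  (forall x, exists2 d, (0 < d)%R & Q x d) -> exists2 d, (0 < d)%R & forall x, Q x d.
Proof.
move=> Qle Qex; suff [d d0 h] : exists2 d : R, (0 < d)%R & forall x, x \in enum T -> Q x d.
  by exists d => // x; apply: h; rewrite mem_enum.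
elim: (enum T) => [|x s [d d0 h]]; first by exists 1%R.
have [d' d'0 h'] := Qex x; exists (Num.min d d'); first by rewrite lt_min d0.
move=> y; rewrite inE => /orP[/eqP->|ys]; first by apply: Qle h'; rewrite ge_min lexx orbT.
by apply: Qle (h y ys); rewrite ge_min lexx.
Qed.

Definition adj (V : finType) (G : sgraph V) : rel V := [rel u v | [set u; v] \in edges G].

Lemma adj_sym (V : finType) (G : sgraph V) : symmetric (adj G).
Proof. by move=> u v; rewrite /adj /= finset.setUC. Qed.

Lemma adj_irr (V : finType) (G : sgraph V) : irreflexive (adj G).
Proof.
move=> u; rewrite /adj /=; apply/negP => uu.
by have /forall_inP/(_ _ uu) := edgesP G; rewrite cards2 eqxx.
Qed.

Section Drawing.

Local Open Scope ring_scope.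

Variables (R : realType) (V : finType) (G : sgraph V).
Variables (pt : V -> R * R) (arc : {set V} -> R -> R * R).
Hypothesis drawing : is_plane_drawing G pt arc.

Let e := adj G.

Lemma arc_continuous E : E \in edges G -> eps_continuous (arc E).
Proof. by case: drawing => _ h _ _ /h[/within_eps_continuous]. Qed.

Lemma arc_ends E : E \in edges G -> exists u v, [/\ E = [set u; v], arc E 0 = pt u & arc E 1 = pt v].
Proof. by case: drawing => _ h _ _ /h[]. Qed.

Lemma arc_inner_or_end E (t : R) : E \in edges G -> t \in `[0, 1] ->
  (t \in `]0, 1[) \/ exists2 v, v \in E & arc E t = pt v.
Proof.
move=> EG; rewrite !in_itv /= => /andP[t0 t1].
have [u [v [EE a0 a1]]] := arc_ends EG.
have [t00|tn0] := eqVneq t 0; first by right; exists u; rewrite ?t00 // EE finset.set21.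
have [t11|tn1] := eqVneq t 1; first by right; exists v; rewrite ?t11 // EE finset.set22.
by left; rewrite !lt_neqAle t0 t1 tn1 eq_sym tn0.
Qed.

Lemma arcs_disjoint E F (s t : R) : E \in edges G -> F \in edges G -> [disjoint E & F] ->
  s \in `[0, 1] -> t \in `[0, 1] -> arc E s <> arc F t.
Proof.
move=> EG FG dEF s01 t01 st; have [pt_inj _ no_pt no_cross] := drawing.
have EF : E != F.
  apply: contraTneq dEF => <-; rewrite -setI_eq0 finset.setIid.
  have [u [v [-> _ _]]] := arc_ends EG.
  by apply/set0Pn; exists u; rewrite finset.set21.
have [s'|[u uE us]] := arc_inner_or_end EG s01; have [t'|[v vF vt]] := arc_inner_or_end FG t01.
- exact: no_cross EF _ _ s' t' st.
- by apply: (no_pt E EG s v s'); rewrite st.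
- by apply: (no_pt F FG t u t'); rewrite -st.
- have uv : u = v by apply: pt_inj; rewrite -us -vt.
  by move: (disjointFr dEF uE); rewrite uv vF.
Qed.

Lemma arcs_separated : exists2 eps : R, 0 < eps & forall E F (s t : R), E \in edges G ->
  F \in edges G -> [disjoint E & F] -> s \in `[0, 1] -> t \in `[0, 1] ->
  ~~ eps_close eps (arc E s) (arc F t).
Proof.
have [||eps e0 h] := @finite_eps R ({set V} * {set V})%type (fun p d => p.1 \in edges G ->
  p.2 \in edges G -> [disjoint p.1 & p.2] -> forall s t : R, s \in `[0, 1] -> t \in `[0, 1] ->
  ~~ eps_close d (arc p.1 s) (arc p.2 t)).
- move=> [E F] d d' le h EG FG dEF s t s01 t01.
  by apply: contra (h EG FG dEF s t s01 t01); apply: eps_closeW.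
- move=> [E F] /=; have [/and3P[EG FG dEF]|no] := boolP [&& E \in edges G, F \in edges G & [disjoint E & F]].
    have [|d d0 h] := eps_continuous_separated (arc_continuous EG) (arc_continuous FG).
      by move=> s t; apply: arcs_disjoint.
    by exists d.
  by exists 1 => // EG FG dEF; rewrite EG FG dEF in no.
by exists eps => // E F s t EG FG dEF s01 t01; exact: (h (E, F)).
Qed.

Lemma sample_path (f : R -> R * R) eps N i n :
  (forall x y : R, x \in `[0, 1] -> y \in `[0, 1] -> `|x - y| <= N.+1%:R^-1 -> eps_close eps (f x) (f y)) ->
  (i + n <= N.+1)%N ->
  path (eps_close eps) (f (i%:R / N.+1%:R)) [seq f (k.+1%:R / N.+1%:R) | k <- iota i n].
Proof.
move=> fu; elim: n i => [|n IH] i iN //=.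
have in01 k : (k <= N.+1)%N -> k%:R / N.+1%:R \in `[0 : R, 1].
  move=> kN; rewrite in_itv /= divr_ge0 //= ler_pdivrMr // mul1r ler_nat //.
rewrite IH ?andbT; last by rewrite addSnnS.
apply: fu; [apply: in01; lia|apply: in01; lia|].
by rewrite -mulrBl -natr1 opprD addNKr mulN1r normrN ger0_norm.
Qed.

Lemma sample_last (f : R -> R * R) (N n i : nat) :
  last (f (i%:R / N.+1%:R)) [seq f (k.+1%:R / N.+1%:R) | k <- iota i n] = f ((i + n)%N%:R / N.+1%:R).
Proof. by elim: n i => [|n IH] i /=; rewrite ?addn0 // IH addSnnS. Qed.

Lemma arc_samples u v eps : e u v -> 0 < eps -> exists Q : seq (R * R),
  [/\ path (eps_close eps) (pt u) Q, last (pt u) Q = pt v &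
      forall p, p \in Q -> exists2 t : R, t \in `[0, 1] & p = arc [set u; v] t].
Proof.
move=> uv e0; have [u' [v' [EE a0 a1]]] := arc_ends uv.
have [f [fu f0 f1 fa]] : exists f : R -> R * R, [/\ exists N : nat, forall x y : R,
    x \in `[0, 1] -> y \in `[0, 1] -> `|x - y| <= N.+1%:R^-1 -> eps_close eps (f x) (f y),
    f 0 = pt u, f 1 = pt v &
    forall t, t \in `[0, 1] -> exists2 t' : R, t' \in `[0, 1] & f t = arc [set u; v] t'].
  have [N h] := eps_continuous_uniform (arc_continuous uv) e0.
  have uE : u \in [set u'; v'] by rewrite -EE finset.set21.
  have vE : v \in [set u'; v'] by rewrite -EE finset.set22.
  have nuv : u != v by apply: contraTneq uv => ->; rewrite /e adj_irr.
  case/set2P: uE => uE; case/set2P: vE => vE.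
  - by rewrite uE vE eqxx in nuv.
  - exists (arc [set u; v]); split; [by exists N| | |by move=> t t01; exists t].
      by rewrite a0 uE.
    by rewrite a1 vE.
  - exists (fun t => arc [set u; v] (1 - t)); split.
    + have in01 (t : R) : t \in `[0, 1] -> 1 - t \in `[0, 1].
        by rewrite !in_itv /= => /andP[? ?]; apply/andP; split; lra.
      exists N => x y x01 y01 xy; apply: h; rewrite ?in01 //.
      by rewrite (_ : 1 - x - (1 - y) = - (x - y)) ?normrN //; ring.
    + by rewrite subr0 a1 uE.
    + by rewrite subrr a0 vE.
    by move=> t; rewrite in_itv /= => /andP[? ?]; exists (1 - t) => //; rewrite in_itv /=; apply/andP; split; lra.
  - by rewrite uE vE eqxx in nuv.
have [N fN] := fu; exists [seq f (k.+1%:R / N.+1%:R) | k <- iota 0 N.+1]; split.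
- by rewrite -f0 -[0](mul0r (N.+1%:R^-1)); exact: (@sample_path f eps N 0 N.+1 fN).
- by rewrite -f0 -{1}[0](mul0r (N.+1%:R^-1)) (@sample_last f N N.+1 0) add0n divff // pnatr_eq0.
move=> p /mapP[k]; rewrite mem_iota add0n => /andP[_ kN] ->.
by apply: fa; rewrite in_itv /= divr_ge0 //= ler_pdivrMr // mul1r ler_nat.
Qed.

Definition on_arcs (C : {set V}) (p : R * R) : Prop :=
  exists x y (t : R), [/\ [set x; y] \subset C, e x y, t \in `[0, 1] & p = arc [set x; y] t].

Lemma walk_samples (C : {set V}) u q eps : path e u q -> u \in C -> all (mem C) q -> 0 < eps ->
  exists Q : seq (R * R), [/\ path (eps_close eps) (pt u) Q, last (pt u) Q = pt (last u q) &
    forall p, p \in Q -> on_arcs C p].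
Proof.
move=> + + + e0; elim: q u => [|v q IH] u /=; first by exists [::].
move=> /andP[uv vq] uC /andP[vC qC].
have [Q [Q1 Q2 Q3]] := arc_samples uv e0; have [Q' [Q1' Q2' Q3']] := IH v vq vC qC.
exists (Q ++ Q'); split.
- by rewrite cat_path Q1 Q2.
- by rewrite last_cat Q2.
move=> p; rewrite mem_cat => /orP[/Q3[t t01 ->]|/Q3'//].
by exists u, v, t; split=> //; rewrite finset.subUset !finset.sub1set uC.
Qed.

Lemma pt_on_arcs (C : {set V}) u v : e u v -> u \in C -> v \in C -> on_arcs C (pt u).
Proof.
move=> uv uC vC; have sC : [set u; v] \subset C by rewrite finset.subUset !finset.sub1set uC.
have [u' [v' [EE a0 a1]]] := arc_ends uv.
have : u \in [set u'; v'] by rewrite -EE finset.set21.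
case/set2P => ->; exists u, v; [exists 0|exists 1]; split=> //; rewrite in_itv /= ?lexx ?ler01 //.
Qed.

Lemma on_arcs_separated eps (C D : {set V}) p q :
  (forall E F (s t : R), E \in edges G ->
    F \in edges G -> [disjoint E & F] -> s \in `[0, 1] -> t \in `[0, 1] ->
    ~~ eps_close eps (arc E s) (arc F t)) ->
  [disjoint C & D] -> on_arcs C p -> on_arcs D q -> ~~ eps_close eps p q.
Proof.
move=> sep dCD [x [y [s [xyC xy s01 ->]]]] [x' [y' [t [xyD xy' t01 ->]]]].
apply: sep => //; apply: disjointWl xyC _; exact: disjointWr xyD dCD.
Qed.

End Drawing.

Lemma path_within (V : finType) (e : rel V) (A : {set V}) u q :
  path (rel_within e A) u q -> path e u q && all (mem A) q.
Proof.
by elim: q u => //= v q IH u /andP[/and3P[-> _ ->] /IH/andP[-> ->]].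
Qed.

Lemma path_steps (T : eqType) (r : rel T) x s p : path r x s -> p \in steps (x :: s) ->
  [/\ p.1 \in x :: s, p.2 \in x :: s & r p.1 p.2].
Proof.
elim: s x => [|y s IH] x //= /andP[rxy ps]; rewrite /steps /= inE => /orP[/eqP-> /=|pin].
  by rewrite !inE !eqxx orbT.
have [p1 p2 rp] := IH y ps pin; split=> //; first by rewrite p1 orbT.
by rewrite in_cons p2 orbT.
Qed.

Lemma chain_crossingsP (R : realFieldType) (I : eqType) (P : I -> R * R) (s t : seq I) :
  chain_crossings P s t -> exists p q, [/\ p \in steps s, q \in steps t &
    crossing (P p.1) (P p.2) (P q.1) (P q.2)].
Proof.
move=> cr; apply: contrapT => no; move: cr; rewrite /chain_crossings big_seq big1 // => p ps.
rewrite big_seq big1 // => q qt; apply/negP => c.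
by apply: no; exists p, q.
Qed.

(** A chain for the pair i, j follows arcs inside [C i j]. For i != k and j != l the sets [C i j]
    and [C k l] are disjoint, so their arcs stay [eps] apart, whereas two such chains must cross by
    [K33_chains_cross]. *)
Theorem planar_K33_free (R : realType) (V : finType) (G : sgraph V) :
  planar R G -> K33_free (adj G).
Proof.
move=> [pt [arc drawing]] sA sB sA3 sB3 cn dj tc.
set e := adj G in cn tc.
pose A (i : 'I_3) := nth finset.set0 sA i; pose B (j : 'I_3) := nth finset.set0 sB j.
have AE (i : 'I_3) : nth finset.set0 (sA ++ sB) i = A i by rewrite nth_cat sA3 ltn_ord.
have BE (j : 'I_3) : nth finset.set0 (sA ++ sB) (3 + j) = B j.
  by rewrite nth_cat sA3 ltnNge leq_addr /= addKn.
have cA i : connected_in e (A i) by apply: (allP cn); rewrite mem_cat mem_nth // sA3.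
have cB j : connected_in e (B j) by apply: (allP cn); rewrite mem_cat orbC mem_nth // sB3.
have tch i j : touches e (A i) (B j).
  by move/allrelP: tc; apply; apply: mem_nth; rewrite ?sA3 ?sB3.
have dj' (i j : nat) : (i < 6)%N -> (j < 6)%N -> i != j ->
    [disjoint nth finset.set0 (sA ++ sB) i & nth finset.set0 (sA ++ sB) j].
  move=> i6 j6; rewrite neq_ltn => /orP[] ij; last rewrite disjoint_sym.
    by apply: (pairwiseP finset.set0 dj) => //; rewrite inE size_cat sA3 sB3.
  by apply: (pairwiseP finset.set0 dj) => //; rewrite inE size_cat sA3 sB3.
have dAA i k : i != k -> [disjoint A i & A k].
  move=> ik; rewrite -!AE; apply: dj' => //; exact: leq_trans (ltn_ord _) _.
have dBB j l : j != l -> [disjoint B j & B l].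
  move=> jl; rewrite -!BE; apply: dj'; rewrite ?(ltn_add2l 3 _ 3) ?ltn_ord //.
have dAB i j : [disjoint A i & B j].
  rewrite -AE -BE; apply: dj'; rewrite ?(ltn_add2l 3 _ 3) ?ltn_ord //.
    exact: leq_trans (ltn_ord _) _.
  by rewrite neq_ltn (leq_trans (ltn_ord i)) ?leq_addr.
have [a aA] : {a : 'I_3 -> V & forall i, a i \in A i}.
  apply: (@choice _ _ (fun i x => is_true (x \in A i))) => i; have /touchesP[x [y [xA _ _]]] := tch i ord0; by exists x.
have [b bB] : {b : 'I_3 -> V & forall j, b j \in B j}.
  apply: (@choice _ _ (fun j x => is_true (x \in B j))) => j; have /touchesP[x [y [_ yB _]]] := tch ord0 j; by exists y.
pose C i j := A i :|: B j.
have dC i j k l : i != k -> j != l -> [disjoint C i j & C k l].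
  move=> ik jl; rewrite -setI_eq0; apply/eqP/setP => x; rewrite !finset.inE.
  apply/negP => /andP[/orP[] h1 /orP[] h2].
  - by rewrite (disjointFr (dAA _ _ ik) h1) in h2.
  - by rewrite (disjointFr (dAB _ _) h1) in h2.
  - by rewrite (disjointFr (dAB _ _) h2) in h1.
  - by rewrite (disjointFr (dBB _ _ jl) h1) in h2.
have aC i j : a i \in C i j by rewrite finset.in_setU aA.
have walk i j : exists q, [/\ path e (a i) q, all (mem (C i j)) q & last (a i) q = b j].
  have /touchesP[x [y [xA yB xy]]] := tch i j.
  have : connect (rel_within e (C i j)) (a i) (b j).
    apply: (connect_trans (y := x)).
      move/connected_inP: (cA i) => /(_ _ _ (aA i) xA).
      by apply: connect_within_sub; exact: finset.subsetUl.
    apply: (connect_trans (y := y)).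
      by apply: connect1; apply/and3P; split=> //; rewrite finset.in_setU ?xA ?yB ?orbT.
    move/connected_inP: (cB j) => /(_ _ _ yB (bB j)).
    by apply: connect_within_sub; exact: finset.subsetUr.
  by case/connectP => q /path_within/andP[q1 q2] ql; exists q.
have [eps e0 sep] := arcs_separated drawing.
have h0 : (0 < eps / 8)%R by rewrite divr_gt0.
have samp (ij : 'I_3 * 'I_3) : exists Q : seq (R * R),
    [/\ path (eps_close (eps / 8)) (pt (a ij.1)) Q, last (pt (a ij.1)) Q = pt (b ij.2) &
      forall p, p \in pt (a ij.1) :: Q -> on_arcs G arc (C ij.1 ij.2) p].
  case: ij => i j /=; have [q [q1 q2 q3]] := walk i j.
  have [Q [Q1 Q2 Q3]] := walk_samples drawing q1 (aC i j) q2 h0.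
  exists Q; split=> //; first by rewrite Q2 q3.
  move=> p; rewrite inE => /orP[/eqP->|/Q3//].
  case: q q1 q2 q3 {Q1 Q2 Q3} => [|v q] /=.
    by move=> _ _ ab; move: (disjointFr (dAB i j) (aA i)); rewrite ab bB.
  by move=> /andP[av _] /andP[vC _] _; exact: (pt_on_arcs drawing av (aC i j) vC).
have [Qf QfP] := choice samp.
pose Q i j := Qf (i, j).
have Q1 i j : path (eps_close (eps / 8)) (pt (a i)) (Q i j) by case: (QfP (i, j)).
have Q2 i j : last (pt (a i)) (Q i j) = pt (b j) by case: (QfP (i, j)).
have Q3 i j p : p \in pt (a i) :: Q i j -> on_arcs G arc (C i j) p.
  by case: (QfP (i, j)) => _ _; apply.
have [pt_inj _ _ _] := drawing.
have Q0 i j : Q i j != [::].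
  apply/eqP => Q0; have := Q2 i j; rewrite Q0 /= => /pt_inj ab.
  by move: (disjointFr (dAB i j) (aA i)); rewrite ab bB.
pose M := \max_(ij : 'I_3 * 'I_3) size (Qf ij).
(* Every sample has its own index, even where walks share a vertex, so the perturbation separates
   coinciding points. Only the branch vertices [a i] and [b j] are shared, and [ib j] replaces the
   last sample of a chain. *)
pose I : finType := (('I_3 + 'I_3) + ('I_3 * 'I_3 * 'I_M.+1))%type.
pose base (x : I) : R * R := match x with
  | inl (inl i) => pt (a i) | inl (inr j) => pt (b j)
  | inr (i, j, k) => nth (pt (a i)) (Q i j) k end.
pose ia i : I := inl (inl i); pose ib j : I := inl (inr j).
pose mid i j : seq I := [seq inr (i, j, inord k) | k <- iota 0 (size (Q i j)).-1].
pose chain i j : seq I := rcons (mid i j) (ib j).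
have sM i j : (size (Q i j) <= M)%N by rewrite /M (leq_bigmax (i, j)).
have chainE i j : map base (chain i j) = Q i j.
  have [Q' [z QE]] : exists Q' z, Q i j = rcons Q' z.
    by case/lastP: (Q i j) (Q0 i j) => // Q' z _; exists Q', z.
  rewrite /chain map_rcons /= -(Q2 i j) QE last_rcons; congr rcons.
  rewrite /mid -map_comp QE size_rcons /=.
  apply: (@eq_from_nth _ (pt (a i))); rewrite size_map size_iota // => k kQ.
  rewrite (nth_map 0) ?size_iota // nth_iota //= add0n inordK.
    by rewrite QE nth_rcons kQ.
  by rewrite ltnS (leq_trans _ (sM i j)) // QE size_rcons ltnW // ltnW.
(* Enumeration ranks and their squares are at most (|I| + 1)^2, so a perturbation below [eta] moves
   each coordinate by less than [eps / 8]. *)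
pose eta := (eps / 8 / (#|I|.+1%:R ^+ 2))%R.
have N0 : (0 < #|I|.+1%:R ^+ 2 :> R)%R by rewrite exprn_gt0.
have eta0 : (0 < eta)%R by rewrite divr_gt0.
have [delta [d0 de gen]] := generic_perturbation base eta0.
pose P := perturb base delta.
have Pclose x : eps_close (eps / 8) (P x) (base x).
  have small (k : R) : (0 <= k)%R -> (k <= #|I|.+1%:R ^+ 2)%R -> (`|delta * k| < eps / 8)%R.
    move=> k0 kN; rewrite normrM (gtr0_norm d0) (ger0_norm k0).
    apply: (@le_lt_trans _ _ (delta * #|I|.+1%:R ^+ 2)%R); first by rewrite ler_pM2l.
    by rewrite -ltr_pdivlMr.
  have rI : ((enum_rank x)%:R <= #|I|.+1%:R :> R)%R by rewrite ler_nat ltnW // ltnS ltnW.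
  rewrite /eps_close /P /perturb /= ![(_ + _ - _)%R]addrAC !subrr !add0r; apply/andP; split.
    apply: small => //; apply: le_trans rI _.
    by rewrite expr2 ler_peMl ?ler0n // ler1n.
  by apply: small; rewrite ?exprn_ge0 // ler_pXn2r ?nnegrE.
have s_end i j : chain i j != [::] /\ last (ia i) (chain i j) = ib j.
  by rewrite /chain last_rcons; split=> //; case: (mid i j).
have s_uniq i j k l : i != k -> j != l ->
    uniq ((ia i :: chain i j) ++ (ia k :: chain k l)).
  move=> ik jl.
  have um i' j' : uniq (mid i' j').
    rewrite map_inj_in_uniq ?iota_uniq // => x y; rewrite !mem_iota /= !add0n => xQ yQ [].
    move=> /(congr1 val) /=; rewrite !inordK // ltnS (leq_trans _ (sM i' j')) //;
      by rewrite ltnW // (leq_trans _ (leq_pred _)).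
  have uc i' j' : uniq (ia i' :: chain i' j').
    rewrite /= rcons_uniq um andbT mem_rcons inE /=; apply/andP; split.
      by apply/negP => /mapP[].
    by apply/negP => /mapP[].
  rewrite cat_uniq !uc andbT andTb; apply/hasPn => x; rewrite inE mem_rcons inE => xin.
  rewrite inE mem_rcons inE; apply/negP => xin'.
  case/or3P: xin => [/eqP xE|/eqP xE|/mapP[n _ xE]]; case/or3P: xin' => [/eqP xE'|/eqP xE'|/mapP[n' _ xE']];
    move: xE'; rewrite xE => // -[] //.
  - by move=> ki; rewrite ki eqxx in ik.
  - by move=> lj; rewrite lj eqxx in jl.
  - by move=> ki; rewrite ki eqxx in ik.
have [i [j [k [l [ik jl cr]]]]] := K33_chains_cross gen s_end s_uniq.
have [p [q [ps qs c]]] := chain_crossingsP cr.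
have chain_step i' j' p' : p' \in steps (ia i' :: chain i' j') ->
    eps_close (eps / 8) (base p'.1) (base p'.2) /\ on_arcs G arc (C i' j') (base p'.1).
  have pp : path (relpre base (eps_close (eps / 8))) (ia i') (chain i' j').
    by rewrite -path_map chainE; exact: Q1.
  case/(path_steps pp) => p1 p2 rp; split=> //; apply: Q3.
  by rewrite -chainE -[pt (a i')]/(base (ia i')) -map_cons map_f.
have [pc pA] := chain_step _ _ _ ps; have [qc qA] := chain_step _ _ _ qs.
have := on_arcs_separated sep (dC _ _ _ _ ik jl) pA qA; case/negP.
(* A perturbed step is shorter than 3 eps / 8. Two crossing steps bring their starting points within
   6 eps / 8, and undoing the perturbation at both points adds 2 eps / 8, which stays below
   [eps]. *)
have step3 x y : eps_close (eps / 8) (base x) (base y) -> eps_close (eps / 8 + (eps / 8 + eps / 8)) (P x) (P y).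
  move=> xy; apply: eps_close_trans (Pclose x) _; apply: eps_close_trans xy _.
  by rewrite eps_closeC.
have /andP[p1 p2] := step3 _ _ pc; have /andP[q1 q2] := step3 _ _ qc.
have [c1 c2] := crossing_close c.
have /andP[s1 s2] := Pclose p.1; have /andP[t1 t2] := Pclose q.1.
have tri (x y z t u : R) : (`|x - y| < u -> `|z - t| < u -> `|y - t| <= 6 * u -> `|x - z| < 8 * u)%R.
  move=> h1 h2 h3; rewrite -(subrKA y) (_ : y - z = (y - t) - (z - t))%R; last by ring.
  apply: le_lt_trans (ler_normD _ _) _; apply: le_lt_trans (_ : (_ <= `|x - y| + (`|y - t| + `|z - t|))%R) _.
    by rewrite lerD2l ler_normB.
  lra.
rewrite distrC in s1; rewrite distrC in s2; rewrite distrC in t1; rewrite distrC in t2.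
have eE : (eps = 8 * (eps / 8))%R by rewrite mulrC divfK.
rewrite /eps_close eE; apply/andP; split; [apply: tri s1 t1 _|apply: tri s2 t2 _].
  by apply: le_trans c1 _; lra.
by apply: le_trans c2 _; lra.
Qed.

(** * The upper bound *)

Section CopiesOfCycles.

Variables (V : finType) (N : nat).

Definition cycle_copy (f : {ffun 'I_N.+1 -> V}) : {set V} * {set {set V}} :=
  (f @: [set: 'I_N.+1], [set f @: E | E : {set 'I_N.+1} in cycle_edges N.+1]).

Lemma cycle_copy_aut (f g : {ffun 'I_N.+1 -> V}) (sigma : 'I_N.+1 -> 'I_N.+1) :
  injective sigma -> (forall i, g i = f (sigma i)) ->
  (forall i, exists j, [set sigma i; sigma (ordS i)] = [set j; ordS j]) ->
  cycle_copy g = cycle_copy f.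
Proof.
move=> s_inj gE s_edge.
have gS (E : {set 'I_N.+1}) : g @: E = f @: (sigma @: E).
  by rewrite -imset_comp; apply: eq_imset => i; rewrite gE.
have edgesE : [set sigma @: E | E : {set 'I_N.+1} in cycle_edges N.+1] = cycle_edges N.+1.
  apply/eqP; rewrite eqEcard (card_imset _ (finset.imset_inj s_inj)) leqnn andbT.
  apply/fintype.subsetP => _ /imsetP[_ /imsetP[i + ->] ->]; rewrite finset.inE => ni.
  rewrite imsetU1 imset_set1; have [j sE] := s_edge i; rewrite sE.
  apply: imset_f; rewrite finset.inE.
  apply: contra ni => /eqP jj; apply/eqP/s_inj.
  have : sigma i \in [set j; ordS j] by rewrite -sE finset.set21.
  have : sigma (ordS i) \in [set j; ordS j] by rewrite -sE finset.set22.
  by rewrite -jj finset.setUid !finset.in_set1 => /eqP-> /eqP->.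
congr (_, _).
  apply/eqP; rewrite gS eqEcard.
  have -> : sigma @: [set: 'I_N.+1] = [set: 'I_N.+1].
    by apply/eqP; rewrite eqEcard finset.subsetT (card_imset _ s_inj) leqnn.
  by rewrite leqnn fintype.subxx.
transitivity [set f @: (E : {set 'I_N.+1}) | E in [set sigma @: E | E : {set 'I_N.+1} in cycle_edges N.+1]].
  rewrite -(imset_comp (fun E : {set 'I_N.+1} => f @: E) (fun E : {set 'I_N.+1} => sigma @: E)).
  by apply: eq_imset => E; rewrite /= gS.
by rewrite edgesE.
Qed.

Lemma cycle_copy_shift k f : cycle_copy (cyc_shift k f) = cycle_copy f.
Proof.
apply: (@cycle_copy_aut _ _ (iter k (@ordS _))) => [|i|i]; first exact: iter_ordS_inj.
  by rewrite ffunE.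
by exists (iter k (@ordS _) i); rewrite -iterSr.
Qed.

Lemma cycle_copy_flip f : cycle_copy (cyc_flip f) = cycle_copy f.
Proof.
apply: (@cycle_copy_aut _ _ (@rev_ord _)) => [|i|i]; first exact: rev_ord_inj.
  by rewrite ffunE.
by exists (rev_ord (ordS i)); rewrite ordS_rev finset.setUC.
Qed.

Lemma num_copies_cycle_le (G : sgraph V) : (0 < N)%N ->
  (num_copies G (cycle_graph N.+1) <= #|cycle_copy @: [set f | is_cyc (adj G) f]|)%N.
Proof.
move=> N0; apply: subset_leq_card; apply/fintype.subsetP => -[A E].
rewrite finset.inE => /andP[/andP[/= sub _] /existsP[f /and3P[finj /= /eqP-> /eqP EE]]].
have -> : (f @: [set: 'I_N.+1], E) = cycle_copy f by rewrite EE.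
apply: imset_f; rewrite finset.inE; apply/andP; split=> //; apply/forallP => i.
have fE : f @: [set i; ordS i] = [set f i; f (ordS i)] by rewrite imsetU1 imset_set1.
apply: (fintype.subsetP sub); rewrite EE -fE; apply: imset_f.
apply: imset_f; rewrite finset.inE; apply/eqP => /(congr1 val) /=.
have := ltn_ord i; rewrite leq_eqVlt => /orP[/eqP[iN]|iN].
  by rewrite iN modnn => i0; rewrite i0 in N0.
by rewrite modn_small // => /n_Sn.
Qed.

End CopiesOfCycles.

Section UpperBound.

Local Open Scope ring_scope.

Variable R : realType.

(** For the least such K, either K = 1 or K <= 2 (K - 1) with (K - 1)^5 < n, which gives the factor
    2^5. *)
Lemma fifth_root_bound (n : nat) : (0 < n)%N -> exists K : nat,
  [/\ (0 < K)%N, (n <= K ^ 5)%N & (K ^ 5 <= 32 * n)%N].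
Proof.
move=> n0; have ex : exists K, (n <= K ^ 5)%N by exists n; rewrite -[leqLHS]expn1 leq_pexp2l.
case: (ex_minnP ex) => K nK Kmin.
have K0 : (0 < K)%N by case: K nK {Kmin} => //; rewrite exp0n // leqn0 => /eqP nE; rewrite nE in n0.
exists K; split=> //; have [K1|K1] := leqP K 1.
  have -> : K = 1%N by lia.
  by rewrite exp1n muln_gt0.
have lt : ((K.-1) ^ 5 < n)%N by rewrite ltnNge; apply/negP => /Kmin; lia.
apply: (@leq_trans ((2 * K.-1) ^ 5)); first by rewrite leq_exp2r //; lia.
by rewrite expnMn leq_mul // ltnW.
Qed.

Lemma expr_add_le (x y c : R) (m : nat) : 0 <= x -> 0 <= y -> 0 <= c -> y <= c * x ->
  (x + y) ^+ m <= x ^+ m + m%:R * (1 + c) ^+ m * (y * x ^+ m.-1).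
Proof.
move=> x0 y0 c0 yx; elim: m => [|m IH]; first by rewrite !expr0 mul0r mul0r addr0.
have xyc : x + y <= (1 + c) * x by rewrite mulrDl mul1r lerD2l.
have xy0 : 0 <= x + y by exact: addr_ge0.
have c1 : 1 <= 1 + c by rewrite lerDl.
case: m IH => [_|m IH].
  rewrite !expr1 expr0 mulr1 mul1r lerD2l.
  by rewrite ler_peMl.
rewrite exprS mulrDl; apply: (@le_trans _ _ (x * (x ^+ m.+1 + m.+1%:R * (1 + c) ^+ m.+1 * (y * x ^+ m.+1.-1))
   + y * ((1 + c) * x) ^+ m.+1)).
  by apply: lerD; apply: ler_wpM2l => //; rewrite lerXn2r ?nnegrE // mulr_ge0 // addr_ge0.
rewrite /= mulrDr -exprS -addrA lerD2l.
rewrite exprMn.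
have -> : x * (m.+1%:R * (1 + c) ^+ m.+1 * (y * x ^+ m)) + y * ((1 + c) ^+ m.+1 * x ^+ m.+1) =
   m.+2%:R * (1 + c) ^+ m.+1 * (y * x ^+ m.+1).
  by rewrite -[m.+2%:R]natr1 [x ^+ m.+1]exprS; move: ((1 + c) ^+ m.+1) (m.+1%:R); intros; ring.
apply: ler_wpM2r; first by rewrite mulr_ge0 // exprn_ge0.
by apply: ler_wpM2l => //; rewrite [leRHS]exprS ler_peMl // exprn_ge0 // addr_ge0.
Qed.

Lemma scaled_paths (V : finType) (w : V -> V -> nat) (a : R) (s : seq V) k : size s = k.+1 ->
  \prod_(p <- steps s) (a * (w p.1 p.2)%:R) = a ^+ k * (\prod_(p <- steps s) w p.1 p.2)%N%:R.
Proof.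
elim: k s => [|k IH] [|x [|y s]] // sz; first by rewrite !big_nil mulr1.
have sz' : size (y :: s) = k.+1 by case: sz => /= ->.
rewrite (big_steps_cons2 _ (fun u v => a * (w u v)%:R)) (big_steps_cons2 _ w) /=.
by rewrite IH // natrM exprS; ring.
Qed.

(** Scaling by a = m / n' brings the total weight to 2m. Paths on m + 1 vertices and closed walks on
    m vertices both have m factors, so both sums scale by a^m. *)
Lemma weighted_paths_le (V : finType) (w : V -> V -> nat) (x0 : V) (m : nat) (n' : R) :
  (forall u v, w u v = w v u) -> (forall u, w u u = 0)%N -> (2 < m)%N -> 0 < n' ->
  (\sum_u \sum_v w u v)%N%:R <= 2 * n' ->
  (\sum_(v : m.+1.-tuple V | uniq v) \prod_(p <- steps v) w p.1 p.2 +
   2 * \sum_(v : m.-tuple V | uniq v) w (head x0 v) (last x0 v) * \prod_(p <- steps v) w p.1 p.2)%N%:R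
  <= 4 * m%:R * (n' / m%:R) ^+ m.
Proof.
move=> w_sym w_diag m2 n0 wn.
have m0 : 0 < m%:R :> R by rewrite ltr0n; lia.
pose a : R := m%:R / n'; have a0 : 0 < a by rewrite divr_gt0.
have := @cycle_path_bound R (@expR R) (@expRD R) (@expR_ge1Dx R) (@expR_gt0 R) V
  (fun u v => a * (w u v)%:R) x0 m.
move=> /(_ (fun u v => mulr_ge0 (ltW a0) (ler0n _ _))) bnd.
have {}bnd := bnd (fun u v => congr1 (fun k => a * k%:R) (w_sym u v)).
have dg u : a * (w u u)%:R = 0 by rewrite w_diag mulr0.
have ws : \sum_u \sum_v a * (w u v)%:R <= 2 * m%:R.
  rewrite (eq_bigr (fun u => a * (\sum_v w u v)%N%:R)) => [|u _]; last first.
    by rewrite natr_sum big_distrr.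
  rewrite -big_distrr -natr_sum /=.
  apply: (le_trans (ler_wpM2l (ltW a0) wn)).
  by rewrite /a mulrCA divfK // gt_eqF.
have {}bnd := bnd dg m2 ws.
have aX : a ^+ m * (n' / m%:R) ^+ m = 1.
  by rewrite -exprMn /a mulrA divfK ?gt_eqF // divff ?expr1n // gt_eqF.
have aX0 : 0 < a ^+ m by exact: exprn_gt0.
rewrite -(ler_pM2l aX0) [leRHS]mulrCA aX mulr1.
apply: le_trans (_ : 2 * (2 * m%:R) <= _); last by lra.
rewrite -(ler_pM2l (_ : 0 < 2)) // in bnd; apply: le_trans bnd.
rewrite natrD natrM !natr_sum mulrDr [leRHS]mulrDr [leRHS]addrC; apply: lerD.
  rewrite mulrCA divff ?mulr1 // big_distrr /=; apply: ler_sum => v _.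
  by rewrite (@scaled_paths _ _ _ _ m) ?size_tuple.
rewrite mulrCA; apply: ler_wpM2l => //; rewrite big_distrr /=; apply: ler_sum => v _.
have sz : size v = m.-1.+1 by rewrite size_tuple; lia.
rewrite (scaled_paths _ _ sz) natrM w_sym {1}(_ : m = m.-1.+1) ?exprS //; last by lia.
by rewrite le_eqVlt; apply/orP; left; apply/eqP; ring.
Qed.

Lemma planar_copies_le (m : nat) : (2 < m)%N -> exists C : R, forall n : nat, (0 < n)%N ->
  forall G : sgraph 'I_n, planar R G ->
  (num_copies G (cycle_graph (2 * m).+1))%:R <=
  2 * m%:R * (n%:R / m%:R) ^+ m + C * n%:R `^ (m%:R - 1 / 5%:R).
Proof.
move=> m2; have m0 : 0 < m%:R :> R by rewrite ltr0n; lia.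
pose c : R := weight_const%:R / 2; pose c' : R := 16 * c.
have c0 : 0 <= c by rewrite divr_ge0.
have c'0 : 0 <= c' by rewrite mulr_ge0.
(* The factor 16 comes from K <= 2 n^(1/5). The second summand is the error of [expr_add_le] when n
   is enlarged to n + x with x = c K^4 <= c' n, divided by m^m as the main term is. *)
pose C : R := 16 * ((exceptional_const m)%:R + 2 * m%:R * (m%:R * (1 + c') ^+ m * c / m%:R ^+ m)).
exists C => n n0 G planarG.
have [K [K0 nK Kn]] := fifth_root_bound n0.
have K33 := planar_K33_free planarG.
pose y : R := n%:R `^ (1 / 5%:R).
have n0R : 0 < n%:R :> R by rewrite ltr0n.
have y0 : 0 < y by rewrite powR_gt0.
have y5 : y ^+ 5 = n%:R by rewrite -powR_mulrn ?ltW // -powRrM div1r mulVf // powRr1 // ltW.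
have yE : n%:R `^ (m%:R - 1 / 5%:R) = y ^+ 4 * n%:R ^+ m.-1.
  have -> : m%:R - 1 / 5%:R = 1 / 5%:R * (4 + 5 * m.-1)%N%:R :> R.
    have mE : m%:R = m.-1%:R + 1 :> R by rewrite natr1 prednK //; lia.
    by rewrite {1}mE natrD natrM; lra.
  by rewrite powRrM -/y powR_mulrn ?ltW // exprD exprM y5.
have K4 : K%:R ^+ 4 <= 16 * y ^+ 4 :> R.
  have -> : 16 * y ^+ 4 = (2 * y) ^+ 4 by ring.
  have y20 : 0 <= 2 * y by rewrite mulr_ge0 // ltW.
  have Ky : K%:R <= 2 * y.
    rewrite -(@ler_pXn2r _ 5) ?nnegrE // exprMn y5.
    by move: Kn; rewrite -(ler_nat R) natrM natrX => h; apply: (le_trans h); rewrite -natrX.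
  by apply: lerXn2r; rewrite ?nnegrE.
have yn : y ^+ 4 <= n%:R.
  have y1 : 1 <= y by rewrite -(@ler_pXn2r _ 5) ?nnegrE ?(ltW y0) // expr1n y5 ler1n.
  by rewrite -y5 [leRHS]exprS ler_peMl // exprn_ge0 // ltW.
pose x : R := c * K%:R ^+ 4.
have x0 : 0 <= x by rewrite mulr_ge0 // exprn_ge0.
have xn : x <= c' * n%:R.
  have -> : c' * n%:R = c * (16 * n%:R) by rewrite /c'; ring.
  apply: ler_wpM2l => //; apply: le_trans K4 _.
  by rewrite ler_pM2l.
have cyc := cycle_images_le (Ordinal n0) (adj_sym G) (adj_irr G) K33 K0 _
  (ltnW m2) (@cycle_copy_shift _ _) (@cycle_copy_flip _ _).
rewrite card_ord in cyc; have {}cyc := cyc nK.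
have n'0 : 0 < n%:R + x by rewrite ltr_wpDr.
have wsum : (\sum_u \sum_v weight (adj G) K u v)%N%:R <= 2 * (n%:R + x).
  have := sum_weight_le (adj_sym G) (adj_irr G) K33 K0; rewrite card_ord => /(_ nK).
  rewrite -(ler_nat R) => /le_trans; apply.
  have -> : (2 * n + weight_const * K ^ 4)%N%:R = 2 * n%:R + weight_const%:R * K%:R ^+ 4 :> R.
    by rewrite natrD (natrM _ 2) (natrM _ weight_const) natrX.
  by rewrite /x /c; lra.
have wp := weighted_paths_le (Ordinal n0) (weight_sym _ _) (weight_diag _ _) m2 n'0 wsum.
have m20 : (0 < 2 * m)%N by rewrite muln_gt0 (ltnW (ltnW m2)).
have cop : (num_copies G (cycle_graph (2 * m).+1))%:R <=
    (exceptional_const m)%:R * K%:R ^+ 4 * n%:R ^+ m.-1 + 2 * m%:R * ((n%:R + x) / m%:R) ^+ m.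
  have := num_copies_cycle_le G m20; rewrite -(leq_pmul2l (isT : (0 < 2)%N)) => le1.
  have := leq_trans le1 cyc; rewrite -(ler_nat R) natrD (natrM _ 2).
  have -> : (2 * (exceptional_const m * K ^ 4 * n ^ m.-1))%N%:R =
      2 * ((exceptional_const m)%:R * K%:R ^+ 4 * n%:R ^+ m.-1) :> R.
    by rewrite (natrM _ 2) (natrM _ (exceptional_const m * K ^ 4)) natrX
      (natrM _ (exceptional_const m)) natrX.
  by move: wp; move: (_ + _)%N => S wp; lra.
apply: le_trans cop _.
have ex := expr_add_le m (ltW n0R) x0 c'0 xn.
have mX : 0 < m%:R ^+ m :> R by exact: exprn_gt0.
apply: (@le_trans _ _ ((exceptional_const m)%:R * K%:R ^+ 4 * n%:R ^+ m.-1 + 2 * m%:R *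
   ((n%:R ^+ m + m%:R * (1 + c') ^+ m * (x * n%:R ^+ m.-1)) / m%:R ^+ m))).
  rewrite lerD2l; apply: ler_wpM2l; first by rewrite mulr_ge0.
  by rewrite exprMn exprVn ler_pM2r ?invr_gt0.
rewrite yE [(n%:R / m%:R) ^+ m]exprMn exprVn.
have -> : (exceptional_const m)%:R * K%:R ^+ 4 * n%:R ^+ m.-1 + 2 * m%:R *
   ((n%:R ^+ m + m%:R * (1 + c') ^+ m * (x * n%:R ^+ m.-1)) / m%:R ^+ m) =
   2 * m%:R * (n%:R ^+ m / m%:R ^+ m) +
   (C / 16) * (K%:R ^+ 4 * n%:R ^+ m.-1).
  by rewrite /C /x; field; rewrite gt_eqF.
rewrite lerD2l (_ : C * (y ^+ 4 * n%:R ^+ m.-1) = (C / 16) * (16 * y ^+ 4 * n%:R ^+ m.-1)); last by field.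
apply: ler_wpM2l.
  rewrite /C mulrC mulKf //; apply: addr_ge0; first exact: ler0n.
  by rewrite mulr_ge0 ?mulr_ge0 ?invr_ge0 ?exprn_ge0 // ?mulr_ge0 ?exprn_ge0 ?addr_ge0.
by apply: ler_wpM2r K4; rewrite exprn_ge0.
Qed.

End UpperBound.

(** * The lower bound *)

Section Necklace.

Variables (m n' : nat).
Hypothesis m_gt2 : (2 < m)%N.

Local Notation n := n'.+1.

(** Group m - 1 closes the ring between hubs m - 1 and 0. The two hubs of a group are named by
    increasing index, which is also their order from left to right in the drawing. *)
Definition lhub g : nat := if g == m.-1 then 0 else g.
Definition rhub g : nat := if g == m.-1 then m.-1 else g.+1.
Definition bead g j : nat := m + j * m + g.
Definition grp v : nat := (v - m) %% m.
Definition lvl v : nat := (v - m) %/ m.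

(** Directed from the smaller label to the larger. The third alternative is the rail between
    consecutive beads of a group. All labels from m on are beads, so leftover vertices only prolong
    some rails. *)
Definition isedge (u v : nat) : bool :=
  (m <= v) && [|| u == lhub (grp v), u == rhub (grp v) | (m <= u) && (u + m == v)].

Let m_gt0 : (0 < m)%N. Proof. exact: ltnW (ltnW m_gt2). Qed.

Lemma grp_bead g j : (g < m)%N -> grp (bead g j) = g.
Proof. by move=> gm; rewrite /grp /bead -addnA addKn modnMDl modn_small. Qed.

Lemma lvl_bead g j : (g < m)%N -> lvl (bead g j) = j.
Proof. by move=> gm; rewrite /lvl /bead -addnA addKn divnMDl // divn_small // addn0. Qed.

Lemma beadK v : (m <= v)%N -> bead (grp v) (lvl v) = v.
Proof. by move=> mv; rewrite /bead -addnA -divn_eq subnKC. Qed.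

Lemma grp_lt v : (grp v < m)%N.
Proof. by rewrite ltn_mod. Qed.

Lemma hubs_neq g : (g < m)%N -> (lhub g < rhub g)%N && (rhub g < m)%N.
Proof.
rewrite /lhub /rhub; case: eqP => [->|gN] gm.
  by apply/andP; split; clear -m_gt2; lia.
apply/andP; split; first exact: ltnSn.
by clear -m_gt2 gm gN; lia.
Qed.

Lemma isedge_ltn u v : isedge u v -> (u < v)%N.
Proof.
have /andP[h1 h2] := hubs_neq (grp_lt v).
move=> /andP[mv /or3P[/eqP->|/eqP->|/andP[mu /eqP <-]]]; lia.
Qed.

Definition necklace_edges : {set {set 'I_n}} :=
  [set [set p.1; p.2] | p : 'I_n * 'I_n & isedge p.1 p.2].

Lemma necklace_edgesP : [forall E in necklace_edges, #|E| == 2].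
Proof.
apply/forall_inP => E /imsetP[[u v]]; rewrite finset.inE /= => /isedge_ltn uv ->.
by rewrite cards2 -val_eqE (ltn_eqF uv).
Qed.

Definition necklace : sgraph 'I_n := SGraph necklace_edgesP.

Lemma necklace_adj (u v : 'I_n) : isedge u v -> [set u; v] \in edges necklace.
Proof. by move=> uv; apply/imsetP; exists (u, v); rewrite // finset.inE. Qed.

Lemma isedge_from g j : (g < m)%N -> isedge g (bead g j).
Proof.
move=> gm; rewrite /isedge grp_bead // /lhub /rhub; apply/andP; split.
  by rewrite /bead -addnA leq_addr.
by have [->|gN] := eqVneq g m.-1; rewrite eqxx ?orbT.
Qed.

Lemma isedge_to g j : (g < m)%N -> isedge (g.+1 %% m) (bead g j).
Proof.
move=> gm; rewrite /isedge grp_bead // /lhub /rhub; apply/andP; split.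
  by rewrite /bead -addnA leq_addr.
have [->|gn] := eqVneq g m.-1; first by rewrite prednK // modnn eqxx.
by rewrite modn_small ?eqxx ?orbT //; lia.
Qed.

Lemma isedge_rail g j : isedge (bead g j) (bead g j.+1).
Proof.
apply/andP; split; first by rewrite /bead -addnA leq_addr.
apply/orP; right; apply/orP; right; apply/andP; split; first by rewrite /bead -addnA leq_addr.
by rewrite /bead mulSn; apply/eqP; lia.
Qed.

Variable k : nat.
Hypothesis k_n : (m + k * m <= n)%N.

Lemma bead_lt g j : (g < m)%N -> (j < k)%N -> (bead g j < n)%N.
Proof.
move=> gm jk; apply: leq_trans k_n; rewrite /bead -addnA ltn_add2l.
apply: (@leq_trans (j.+1 * m)%N); first by rewrite mulSn addnC ltn_add2r.
by rewrite leq_mul2r jk orbT.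
Qed.

(* Position [2q] is a hub and position [2q + 1] a bead, except that the two
   beads of group [g0] joined by a rail occupy positions 0 and 1. *)
Definition necklace_pos (tau : nat -> nat) (g0 : nat) (dir : bool) (i : nat) : nat :=
  if i == 0 then bead g0 (tau g0 + ~~ dir) else
  if i == 1 then bead g0 (tau g0 + dir) else
  if odd i then bead ((g0 + i./2) %% m) (tau ((g0 + i./2) %% m)) else (g0 + i./2) %% m.

Section OneCopy.

Variables (tau : nat -> nat) (g0 : nat) (dir : bool).
Hypotheses (g0m : (g0 < m)%N) (tau_k : forall g, (tau g < k)%N) (tau0 : ((tau g0).+1 < k)%N).

Let pos := necklace_pos tau g0 dir.

Lemma necklace_pos_lt i : (pos i < n)%N.
Proof.
rewrite /pos /necklace_pos; case: eqP => _; first by apply: bead_lt => //; case: dir; lia.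
case: eqP => _; first by apply: bead_lt => //; case: dir; lia.
case: ifP => _; first by apply: bead_lt; rewrite ?ltn_mod.
by apply: leq_trans k_n; apply: (@leq_trans m); rewrite ?ltn_mod ?leq_addr.
Qed.

Definition necklace_map : {ffun 'I_(2 * m).+1 -> 'I_n} := [ffun i : 'I_(2 * m).+1 => inord (pos i)].

Lemma necklace_mapE i : val (necklace_map i) = pos i.
Proof. by rewrite ffunE /= inordK // necklace_pos_lt. Qed.

Let half_inj i i' : (1 < i)%N -> (1 < i')%N -> (i <= 2 * m)%N -> (i' <= 2 * m)%N ->
  (odd i -> i./2 < m)%N -> odd i = odd i' ->
  (g0 + i./2) %% m = (g0 + i'./2) %% m -> i = i'.
Proof.
move=> i1 i1' im im' _ oE.
have h1 : (0 < i./2)%N by lia.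
have h1' : (0 < i'./2)%N by lia.
rewrite -(prednK h1) -(prednK h1') !addnS -!addSn => /eqP.
rewrite eqn_modDl !modn_small; [|lia|lia] => /eqP E.
by rewrite -(odd_double_half i) -(odd_double_half i') oE -(prednK h1) -(prednK h1') E.
Qed.

Lemma necklace_pos_inj i i' : (i <= 2 * m)%N -> (i' <= 2 * m)%N -> pos i = pos i' -> i = i'.
Proof.
have hub_bead g g' j : (g < m)%N -> g <> bead g' j by rewrite /bead; lia.
have md q : ((g0 + q) %% m < m)%N by rewrite ltn_mod.
have not_g0 a : odd a -> a <> 1%N -> (a <= 2 * m)%N -> (g0 + a./2) %% m <> g0.
  move=> oa a1 am /eqP; rewrite -{2}(modn_small g0m) -{2}[g0]addn0 eqn_modDl mod0n.
  by rewrite modn_small; lia.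
have bead_inj g g' j j' : (g < m)%N -> (g' < m)%N -> bead g j = bead g' j' -> g = g' /\ j = j'.
  by move=> gm gm' E; rewrite -(grp_bead j gm) -{2}(lvl_bead j gm) E grp_bead // lvl_bead.
move=> im im'; rewrite /pos /necklace_pos.
case: (i =P 0%N) => [->|i0]; case: (i' =P 0%N) => [->|i0'] //.
- case: (i' =P 1%N) => [->|i1'].
    by move=> /(bead_inj _ _ _ _ g0m g0m)[_]; case: dir; lia.
  case: ifP => oi'; last by move/esym/hub_bead => /(_ (md _)).
  by move=> /(bead_inj _ _ _ _ g0m (md _))[/esym/(not_g0 _ oi' i1' im')].
- case: (i =P 1%N) => [->|i1].
    by move=> /(bead_inj _ _ _ _ g0m g0m)[_]; case: dir; lia.
  case: ifP => oi; last by move/hub_bead => /(_ (md _)).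
  by move=> /(bead_inj _ _ _ _ (md _) g0m)[/(not_g0 _ oi i1 im)].
case: (i =P 1%N) => [->|i1]; case: (i' =P 1%N) => [->|i1'] //.
- case: ifP => oi'; last by move/esym/hub_bead => /(_ (md _)).
  by move=> /(bead_inj _ _ _ _ g0m (md _))[/esym/(not_g0 _ oi' i1' im')].
- case: ifP => oi; last by move/hub_bead => /(_ (md _)).
  by move=> /(bead_inj _ _ _ _ (md _) g0m)[/(not_g0 _ oi i1 im)].
have gt1 a : a <> 0%N -> a <> 1%N -> (1 < a)%N by lia.
case oi: (odd i); case oi': (odd i').
- move=> /(bead_inj _ _ _ _ (md _) (md _))[E _]; apply: half_inj E; rewrite ?oi ?oi' ?gt1 //; lia.
- by move/esym/hub_bead => /(_ (md _)).
- by move/hub_bead => /(_ (md _)).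
- by move=> E; apply: half_inj E; rewrite ?oi ?oi' ?gt1.
Qed.

Lemma necklace_map_inj : injective necklace_map.
Proof.
move=> i i' /(congr1 val); rewrite !necklace_mapE => E; apply: val_inj.
by apply: necklace_pos_inj E; rewrite -ltnS.
Qed.

Lemma necklace_pos_edge i : (i <= 2 * m)%N ->
  let i' := (i.+1 %% (2 * m).+1)%N in isedge (pos i) (pos i') || isedge (pos i') (pos i).
Proof.
move=> im /=; have md q : ((g0 + q) %% m < m)%N by rewrite ltn_mod.
have [i2m|iN] := eqVneq i (2 * m)%N.
  rewrite i2m modnn /pos /necklace_pos /= (_ : (2 * m == 0)%N = false); last by lia.
  rewrite (_ : (2 * m == 1)%N = false) ?mul2n ?odd_double ?doubleK; last by lia.
  by rewrite addnC modnDl modn_small // isedge_from.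
rewrite modn_small; last by lia.
case: i im iN => [|[|i]] im iN.
- rewrite /pos /necklace_pos /=; case: dir; rewrite ?addn0 ?addn1 isedge_rail ?orbT //.
- by rewrite /pos /necklace_pos /= addn1 isedge_to ?orbT.
rewrite /pos /necklace_pos /=; case oi: (odd i) => /=.
  rewrite uphalf_half oi add1n; apply/orP; right.
  have -> : ((g0 + i./2.+2) %% m = ((g0 + i./2.+1) %% m).+1 %% m)%N.
    by rewrite -[((_ %% _).+1)%N]addn1 modnDml addn1 -addnS.
  exact: isedge_to.
by rewrite uphalf_half oi add0n isedge_from.
Qed.

End OneCopy.

End Necklace.

Section NecklaceCopies.

Variables (m n' k : nat).
Hypothesis m_gt2 : (2 < m)%N.
Hypothesis k_n : (m + k * m <= n'.+1)%N.

Let m_gt0 : (0 < m)%N. Proof. exact: ltnW (ltnW m_gt2). Qed.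

Lemma cycle_copy_edge (V : finType) (N : nat) (f : {ffun 'I_N.+1 -> V}) E :
  E \in (cycle_copy f).2 -> exists i, E = [set f i; f (ordS i)].
Proof.
case/imsetP=> _ /imsetP[i _ ->] ->; exists i.
by rewrite imsetU1 imset_set1.
Qed.

Lemma cycle_copy_edge_mem (V : finType) (N : nat) (f : {ffun 'I_N.+1 -> V}) i : i != ordS i ->
  [set f i; f (ordS i)] \in (cycle_copy f).2.
Proof.
move=> ni; apply/imsetP; exists [set i; ordS i]; last by rewrite imsetU1 imset_set1.
by apply: imset_f; rewrite finset.inE.
Qed.

Definition valid_pos (tau : nat -> nat) g0 :=
  [/\ (g0 < m)%N, forall g, (tau g < k)%N & ((tau g0).+1 < k)%N].

Lemma necklace_copy_sub tau g0 dir : valid_pos tau g0 ->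
  is_subgraph (necklace n' m_gt2) (cycle_copy (necklace_map m n' tau g0 dir)).
Proof.
case=> g0m tauk tau0; apply/andP; split.
  apply/fintype.subsetP => E /cycle_copy_edge[i ->].
  have posE j : val (necklace_map m n' tau g0 dir j) = necklace_pos m tau g0 dir j.
    exact: (necklace_mapE m_gt2 k_n).
  have := necklace_pos_edge m_gt2 k_n dir g0m tau0 (i := i); rewrite -ltnS => /(_ (ltn_ord i)) /=.
  rewrite -!posE -[(i.+1 %% _)%N]/(val (ordS i)) -posE.
  by case/orP => h; [|rewrite finset.setUC]; apply: necklace_adj.
apply/forall_inP => _ /imsetP[E _ ->].
exact/finset.imsetS/finset.subsetT.
Qed.

Lemma necklace_copy_is_copy tau g0 dir : valid_pos tau g0 ->
  is_copy (cycle_graph (2 * m).+1) (cycle_copy (necklace_map m n' tau g0 dir)).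
Proof.
case=> g0m tauk tau0; apply/existsP; exists (necklace_map m n' tau g0 dir).
by rewrite !eqxx !andbT; apply/injectiveP; apply: (necklace_map_inj m_gt2 k_n).
Qed.

Lemma necklace_pos_bead tau g0 dir g j : valid_pos tau g0 -> (g < m)%N ->
  (exists2 i, (i <= 2 * m)%N & necklace_pos m tau g0 dir i = bead m g j) <->
  (j = tau g \/ g = g0 /\ j = (tau g0).+1).
Proof.
move=> [g0m _ _] gm.
have hub_bead g1 g2 j2 : (g1 < m)%N -> g1 <> bead m g2 j2 by rewrite /bead; lia.
have md q : ((g0 + q) %% m < m)%N by rewrite ltn_mod.
have bead_inj g1 g2 j1 j2 : (g1 < m)%N -> (g2 < m)%N -> bead m g1 j1 = bead m g2 j2 -> g1 = g2 /\ j1 = j2.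
  by move=> gm1 gm2 E; rewrite -(grp_bead j1 gm1) -{2}(lvl_bead m_gt2 j1 gm1) E grp_bead // lvl_bead.
split.
  case=> i im; rewrite /necklace_pos.
  case: (i =P 0%N) => [_|_].
    by move=> /(bead_inj _ _ _ _ g0m gm)[<- <-]; case: dir; rewrite ?addn0 ?addn1; [left|right].
  case: (i =P 1%N) => [_|_].
    by move=> /(bead_inj _ _ _ _ g0m gm)[<- <-]; case: dir; rewrite ?addn0 ?addn1; [right|left].
  case: ifP => _; last by move/hub_bead => /(_ (md _)).
  by move=> /(bead_inj _ _ _ _ (md _) gm)[<- <-]; left.
case=> [->|[-> ->]]; last first.
  by exists dir; [case: dir; lia|rewrite /necklace_pos; case: dir; rewrite ?addn1].
have [->|gN] := eqVneq g g0.
  by exists (~~ dir); [case: dir; lia|rewrite /necklace_pos; case: dir; rewrite ?addn0].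
pose q := ((g + (m - g0)) %% m)%N.
have qg : ((g0 + q) %% m = g)%N.
  by rewrite /q modnDmr addnCA subnKC ?modnDr ?modn_small // ltnW.
have q0 : q <> 0%N by move=> q0; move: qg; rewrite q0 addn0 modn_small // => gE; rewrite gE eqxx in gN.
have qm : (q < m)%N by rewrite ltn_mod.
exists (q.*2.+1); first by lia.
rewrite /necklace_pos /= odd_double /= uphalf_double qg.
by case: eqP => // /eqP; rewrite eqSS double_eq0 => /eqP.
Qed.

(** The vertex set determines [g0] as the group with two beads, and then [tau]. The two directions
    share their vertices and differ by exchanging positions 0 and 1; the edge from position 2m to
    position 0 separates them, since positions 2m and 1 are not consecutive. *)
Lemma necklace_copy_inj tau g0 dir tau' g0' dir' : valid_pos tau g0 -> valid_pos tau' g0' ->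
  cycle_copy (necklace_map m n' tau g0 dir) = cycle_copy (necklace_map m n' tau' g0' dir') ->
  [/\ forall g, (g < m)%N -> tau g = tau' g, g0 = g0' & dir = dir'].
Proof.
move=> v v' E.
have [g0m tauk tau0] := v; have [g0m' tauk' tau0'] := v'.
have posE j : val (necklace_map m n' tau g0 dir j) = necklace_pos m tau g0 dir j.
  exact: (necklace_mapE m_gt2 k_n).
have posE' j : val (necklace_map m n' tau' g0' dir' j) = necklace_pos m tau' g0' dir' j.
  exact: (necklace_mapE m_gt2 k_n).
have sub i : (i <= 2 * m)%N -> exists2 i', (i' <= 2 * m)%N & necklace_pos m tau' g0' dir' i' = necklace_pos m tau g0 dir i.
  rewrite -ltnS => im; have := congr1 fst E => /= /setP /(_ (necklace_map m n' tau g0 dir (Ordinal im))).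
  rewrite imset_f // => /esym/imsetP[i' _ /(congr1 val)]; rewrite posE posE' => ->.
  by exists i' => //; rewrite -ltnS ltn_ord.
have sub' i : (i <= 2 * m)%N -> exists2 i', (i' <= 2 * m)%N & necklace_pos m tau g0 dir i' = necklace_pos m tau' g0' dir' i.
  rewrite -ltnS => im; have := congr1 fst E => /= /setP /(_ (necklace_map m n' tau' g0' dir' (Ordinal im))).
  rewrite [X in _ = X -> _]imset_f // => /imsetP[i' _ /(congr1 val)]; rewrite posE posE' => ->.
  by exists i' => //; rewrite -ltnS ltn_ord.
have inc g j : (g < m)%N -> (j = tau g \/ g = g0 /\ j = (tau g0).+1) -> (j = tau' g \/ g = g0' /\ j = (tau' g0').+1).
  move=> gm /(necklace_pos_bead dir j v gm)[i im iE]; apply/(necklace_pos_bead dir' j v' gm).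
  by have [i' im' iE'] := sub i im; exists i'; rewrite ?iE'.
have inc' g j : (g < m)%N -> (j = tau' g \/ g = g0' /\ j = (tau' g0').+1) -> (j = tau g \/ g = g0 /\ j = (tau g0).+1).
  move=> gm /(necklace_pos_bead dir' j v' gm)[i im iE]; apply/(necklace_pos_bead dir j v gm).
  by have [i' im' iE'] := sub' i im; exists i'; rewrite ?iE'.
have gE : g0 = g0'.
  have [//|gN] := eqVneq g0 g0'.
  have [h1|[h1]] := inc g0 (tau g0) g0m (or_introl erefl); last by rewrite h1 eqxx in gN.
  have [h2|[h2]] := inc g0 (tau g0).+1 g0m (or_intror (conj erefl erefl)); first by lia.
  by rewrite h2 eqxx in gN.
have tE g : (g < m)%N -> tau g = tau' g.
  move=> gm; have [h1|[h1 h2]] := inc g (tau g) gm (or_introl erefl) => //.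
  have [h3|[h3 h4]] := inc' g (tau' g) gm (or_introl erefl) => //.
  by rewrite h1 in h2 h4 *; move: h2 h4; rewrite -gE; lia.
split=> //; subst g0'.
have [//|dN] := eqVneq dir dir'.
have {}dN : dir' = ~~ dir by clear -dN; case: dir dir' dN => -[].
have pswap i : necklace_pos m tau' g0 dir' i =
    necklace_pos m tau g0 dir (if i == 0 then 1 else if i == 1 then 0 else i).
  rewrite /necklace_pos dN; case: (i =P 0%N) => [_|i0] /=.
    by rewrite negbK tE.
  case: (i =P 1%N) => [_|i1] /=; first by rewrite tE.
  by rewrite (negbTE (introN eqP i0)) (negbTE (introN eqP i1)) tE ?ltn_mod.
have nS : ord_max != ordS (ord_max : 'I_(2 * m).+1).
  by rewrite -val_eqE /= modnn; lia.
have := cycle_copy_edge_mem (necklace_map m n' tau g0 dir) nS; rewrite E.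
move=> /cycle_copy_edge[i]; set A := [set _; _]; set B := [set _; _] => AB.
have pin a b : (a <= 2 * m)%N -> (b <= 2 * m)%N -> necklace_pos m tau g0 dir a = necklace_pos m tau g0 dir b -> a = b.
  exact: (necklace_pos_inj m_gt2 k_n).
have im : (i <= 2 * m)%N by rewrite -ltnS.
pose sw a := (if a == 0 then 1 else if a == 1 then 0 else a)%N.
have swm a : (a <= 2 * m)%N -> (sw a <= 2 * m)%N by clear -m_gt2; rewrite /sw; case: ifP; [lia|case: ifP; lia].
have val_in (x : 'I_(2 * m).+1) : necklace_map m n' tau g0 dir x \in B ->
    val x = sw i \/ val x = sw (val (ordS i)).
  rewrite !finset.inE => /orP[] /eqP /(congr1 val); rewrite posE posE' pswap => h; [left|right];
  by apply: pin h; [rewrite -ltnS|apply: swm; rewrite -ltnS].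
have h1 := val_in ord_max; have h2 := val_in (ordS ord_max).
move: h1 h2; rewrite -AB finset.set21 finset.set22 => /(_ isT) h1 /(_ isT) h2.
have sw0 a : 0%N = sw a -> a = 1%N by rewrite /sw; case: eqP => // a0; case: eqP => // _ /esym.
have sw2m a : (2 * m)%N = sw a -> a = (2 * m)%N by clear -m_gt2; rewrite /sw; case: eqP => [_|_]; [lia|case: eqP; lia].
have {}h2 : val i = 1%N \/ val (ordS i) = 1%N.
  by move: h2; rewrite /= modnn => -[/sw0|/sw0] h; [left|right]; exact: h.
have {}h1 : val i = (2 * m)%N \/ val (ordS i) = (2 * m)%N by case: h1 => [/sw2m|/sw2m] h; [left|right]; exact: h.
exfalso; have {}im : (nat_of_ord i <= 2 * m)%N by [].
move: h1 h2; rewrite /=; have [->|/eqP iN] := eqVneq (val i) (2 * m)%N.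
  by rewrite modnn; clear -m_gt2; lia.
have {}iN : nat_of_ord i <> (2 * m)%N by [].
by rewrite modn_small ?ltnS; clear -m_gt2 im iN; lia.
Qed.

Lemma card_below_pred : #|[pred j : 'I_k | (j.+1 < k)%N]| = k.-1.
Proof.
case: k => [|k'] /=; first by apply: eq_card0 => -[].
rewrite -sum1_card big_mkcond big_ord_recr /= inE ltnn addn0.
rewrite (eq_bigr (fun=> 1%N)) => [|i _]; last by rewrite inE /= ltnS ltn_ord.
by rewrite sum_nat_const card_ord muln1.
Qed.

(** There are m groups to hold the rail, 2 directions, k - 1 rails within k levels and k beads in
    each of the other m - 1 groups. *)
Theorem necklace_copies :
  (2 * m * (k.-1 * k ^ m.-1) <= num_copies (necklace n' m_gt2) (cycle_graph (2 * m).+1))%N.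
Proof.
pose ext (tau : {ffun 'I_m -> 'I_k}) (g : nat) : nat := oapp (fun i => val (tau i)) 0%N (insub g).
pose P := [set p : ('I_m * bool) * {ffun 'I_m -> 'I_k} | ((p.2 p.1.1).+1 < k)%N].
pose F (p : ('I_m * bool) * {ffun 'I_m -> 'I_k}) :=
  cycle_copy (necklace_map m n' (ext p.2) p.1.1 p.1.2).
have extE tau (i : 'I_m) : ext tau i = tau i by rewrite /ext valK.
have Pv p : p \in P -> valid_pos (ext p.2) p.1.1.
  case: p => [[g0 d] tau]; rewrite inE /= => h; split=> //=; last by rewrite extE.
  by move=> g; rewrite /ext; case: insubP => [i _ _ /=|_ /=]; [|apply: leq_ltn_trans h].
have F_inj : {in P &, injective F}.
  move=> p p' /Pv v /Pv v' /(necklace_copy_inj v v').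
  case: p p' v v' => [[g0 d] tau] [[g0' d'] tau'] /= _ _ [tE gE ->].
  congr (_, _, _); first exact: val_inj.
  by apply/ffunP => i; apply: val_inj; have := tE i (ltn_ord i); rewrite !extE.
have <- : #|P| = (2 * m * (k.-1 * k ^ m.-1))%N.
  rewrite -sum1_card.
  rewrite (eq_bigl (fun p => predT p.1 && (fun q (tau : {ffun 'I_m -> 'I_k}) => (tau q.1).+1 < k)%N p.1 p.2));
    last by move=> p; rewrite inE.
  rewrite -(pair_big_dep predT (fun q (tau : {ffun 'I_m -> 'I_k}) => (tau q.1).+1 < k)%N (fun _ _ => 1%N)) /=.
  rewrite (eq_bigr (fun=> (k.-1 * k ^ m.-1)%N)) => [|[g0 d] _].
    by rewrite sum_nat_const card_prod card_bool card_ord [(m * 2)%N]mulnC.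
  rewrite sum1dep_card /=.
  pose A (g : 'I_m) := if g == g0 then [pred j : 'I_k | (j.+1 < k)%N] else predT.
  have -> : #|[set tau : {ffun 'I_m -> 'I_k} | ((tau g0).+1 < k)%N]| = #|family A|.
    apply: eq_card => tau; rewrite inE; apply/idP/familyP => [h i|/(_ g0)].
      by rewrite /A; case: eqP => [->|].
    by rewrite /A eqxx.
  rewrite card_family foldrE big_map big_enum /= (bigD1 g0) //= {1}/A eqxx card_below_pred.
  congr (_ * _)%N; rewrite (eq_bigr (fun=> k)) => [|g gN].
    by rewrite prod_nat_const cardC1 card_ord.
  by rewrite /A (negbTE gN) card_ord.
rewrite -(card_in_imset F_inj); apply: subset_leq_card; apply/fintype.subsetP => _ /imsetP[p /Pv v ->].
by rewrite finset.inE necklace_copy_sub // necklace_copy_is_copy.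
Qed.

End NecklaceCopies.

(** * Straight-line drawing of the necklace *)

Section NecklaceDrawing.

Local Open Scope ring_scope.

Variables (R : realType) (m n' : nat).
Hypothesis m_gt2 : (2 < m)%N.

Local Notation n := n'.+1.
Local Notation l g := ((lhub m g)%:R : R).
Local Notation r g := ((rhub m g)%:R : R).

(** The hubs lie on a horizontal axis. The group that closes the ring is drawn above it, all others
    below. *)
Definition side (g : nat) : R := if g == m.-1 then 1 else -1.

Definition necklace_pt (v : nat) : R * R :=
  if (v < m)%N then (2 * v%:R, 0)
  else (l (grp m v) + r (grp m v), side (grp m v) * (lvl m v).+1%:R).

Definition segment (u v : nat) (t : R) : R * R :=
  ((necklace_pt u).1 + t * ((necklace_pt v).1 - (necklace_pt u).1),
   (necklace_pt u).2 + t * ((necklace_pt v).2 - (necklace_pt u).2)).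

(** An open half-strip reserved for each group. These regions are pairwise disjoint, so crossings
    need to be excluded only within one group. *)
Definition in_region (g : nat) (p : R * R) : Prop :=
  [/\ 2 * l g < p.1, p.1 < 2 * r g & 0 < side g * p.2].

Lemma pair_inj (a b c d : R) : (a, b) = (c, d) -> a = c /\ b = d.
Proof. by case. Qed.

Lemma side2 g : side g * side g = 1.
Proof. by rewrite /side; case: ifP; rewrite ?mul1r // mulrNN mul1r. Qed.

Lemma side_neq0 g : side g != 0.
Proof. by rewrite /side; case: ifP; rewrite ?oppr_eq0 oner_eq0. Qed.

Lemma in_region_uniq g g' p : in_region g p -> in_region g' p -> g = g'.
Proof.
rewrite /in_region /side /lhub /rhub; have [->|gN] := eqVneq g m.-1; have [->|gN'] := eqVneq g' m.-1 => //.
- by move=> [_ _ h1] [_ _ h2]; exfalso; lra.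
- by move=> [_ _ h1] [_ _ h2]; exfalso; lra.
move=> [h1 h2 _] [h3 h4 _].
have a1 : (g%:R : R) < g'.+1%:R by clear -h1 h4; lra.
have a2 : (g'%:R : R) < g.+1%:R by clear -h2 h3; lra.
by move: a1 a2; rewrite !ltr_nat; lia.
Qed.

Lemma width_gt0 v : 0 < r (grp m v) - l (grp m v).
Proof.
by rewrite subr_gt0 ltr_nat; case/andP: (hubs_neq m_gt2 (grp_lt m_gt2 v)).
Qed.

Lemma necklace_pt_bead v : (m <= v)%N ->
  necklace_pt v = (l (grp m v) + r (grp m v), side (grp m v) * (lvl m v).+1%:R).
Proof. by move=> mv; rewrite /necklace_pt ltnNge mv. Qed.

Lemma in_region_bead v : (m <= v)%N -> in_region (grp m v) (necklace_pt v).
Proof.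
move=> mv; rewrite necklace_pt_bead //; have := width_gt0 v => w0.
by split=> /=; [lra|lra|rewrite mulrA side2 mul1r ltr0n].
Qed.

Lemma same_bead v v' : (m <= v)%N -> (m <= v')%N -> grp m v = grp m v' -> lvl m v = lvl m v' -> v = v'.
Proof. by move=> mv mv' gE lE; rewrite -(beadK mv) -(beadK mv') gE lE. Qed.

Lemma necklace_pt_inj u v : necklace_pt u = necklace_pt v -> u = v.
Proof.
have aux u' v' : (u' < m)%N -> (m <= v')%N -> necklace_pt u' <> necklace_pt v'.
  move=> um mv E; have [_ _] := in_region_bead mv.
  by rewrite -E /necklace_pt um /= mulr0 ltxx.
have [um|mu] := ltnP u m; have [vm|mv] := ltnP v m.
- rewrite /necklace_pt um vm => -[E]; apply/eqP.
  by rewrite -(eqr_nat R); apply/eqP; lra.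
- by move/aux => /(_ um mv).
- by move/esym/aux => /(_ vm mu).
move=> E; have := in_region_bead mu; rewrite E => /in_region_uniq /(_ (in_region_bead mv)) gE.
apply: same_bead => //; move: E; rewrite !necklace_pt_bead // gE => -[] /(mulfI (side_neq0 _)) /eqP.
by rewrite eqr_nat eqSS => /eqP.
Qed.

Lemma segmentP u v t : isedge m u v ->
  let g := grp m v in let w := r g - l g in
  [\/ u = lhub m g /\ segment u v t = (2 * l g + t * w, side g * (t * (lvl m v).+1%:R)),
      u = rhub m g /\ segment u v t = (2 * r g - t * w, side g * (t * (lvl m v).+1%:R)) |
      (u + m)%N = v /\ segment u v t = (l g + r g, side g * ((lvl m v)%:R + t))].
Proof.
move=> /andP[mv uv] g w; have /andP[lr rm] := hubs_neq m_gt2 (grp_lt m_gt2 v).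
rewrite /segment (necklace_pt_bead mv) -/g.
case/or3P: uv => [/eqP->|/eqP->|/andP[mu /eqP uv]].
- apply: Or31; split=> //; rewrite /necklace_pt (ltn_trans lr rm) /= -/g /w; congr (_, _); ring.
- apply: Or32; split=> //; rewrite /necklace_pt rm /= -/g /w; congr (_, _); ring.
apply: Or33; split=> //; rewrite (necklace_pt_bead mu) /=.
have -> : grp m u = g by rewrite /g /grp -uv -addnBAC // modnDr.
have -> : lvl m v = (lvl m u).+1.
  by rewrite /lvl -uv -addnBAC // divnDr ?dvdnn // divnn (ltnW (ltnW m_gt2)) addn1.
rewrite -[(lvl m u).+2%:R]natr1; congr (_, _); ring.
Qed.

Lemma in_region_segment u v t : isedge m u v -> 0 < t -> t < 1 ->
  in_region (grp m v) (segment u v t).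
Proof.
move=> uv t0 t1; have w0 := width_gt0 v.
have tw0 := mulr_gt0 t0 w0; have tw1 : t * (r (grp m v) - l (grp m v)) < r (grp m v) - l (grp m v).
  by rewrite gtr_pMl.
have J0 : (0 : R) < (lvl m v).+1%:R by rewrite ltr0n.
have j0 : (0 : R) <= (lvl m v)%:R by rewrite ler0n.
by case: (segmentP t uv) => -[_ ->]; split=> /=; rewrite ?mulrA ?side2 ?mul1r; try lra;
  rewrite ?mulr_gt0 // ltr_wpDl.
Qed.

Lemma level_uniq (j j' : nat) (s t : R) : 0 < s -> s < 1 -> 0 < t -> t < 1 ->
  j%:R + s = j'%:R + t -> j = j'.
Proof.
move=> s0 s1 t0 t1 E; have a1 : (j%:R : R) < j'.+1%:R by rewrite -natr1; lra.
have a2 : (j'%:R : R) < j.+1%:R by rewrite -natr1; lra.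
by move: a1 a2; rewrite !ltr_nat; lia.
Qed.

Lemma segment_vertex u v w t : isedge m u v -> 0 < t -> t < 1 -> segment u v t <> necklace_pt w.
Proof.
move=> uv t0 t1 E; have reg := in_region_segment uv t0 t1.
have [wm|mw] := ltnP w m.
  by case: reg => _ _; rewrite E /necklace_pt wm /= mulr0 ltxx.
have gE : grp m v = grp m w by apply: in_region_uniq reg _; rewrite E; apply: in_region_bead.
have w0 := width_gt0 v; have tw1 : t * (r (grp m v) - l (grp m v)) < r (grp m v) - l (grp m v).
  by rewrite gtr_pMl.
move: E; rewrite necklace_pt_bead // -gE; case: (segmentP t uv) => -[_ ->] /pair_inj[E1 E2]; try lra.
move/(mulfI (side_neq0 _)): E2 => E2.
have a1 : ((lvl m v)%:R : R) < (lvl m w).+1%:R by lra.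
have a2 : ((lvl m w).+1%:R : R) < (lvl m v).+1%:R by rewrite -[(lvl m v).+1%:R]natr1; lra.
by move: a1 a2; rewrite !ltr_nat; lia.
Qed.

(** Within a half-strip, edges at the left hub stay left of the middle line, those at the right hub
    stay right of it, and rails lie on it. For two edges at one hub the abscissa fixes the parameter
    and the height then fixes the level. *)
Lemma segment_uniq u v u' v' s t : isedge m u v -> isedge m u' v' ->
  0 < s -> s < 1 -> 0 < t -> t < 1 -> segment u v s = segment u' v' t -> u = u' /\ v = v'.
Proof.
move=> uv uv' s0 s1 t0 t1 E; have reg := in_region_segment uv s0 s1.
have gE : grp m v = grp m v'.
  by apply: in_region_uniq reg _; rewrite E; apply: in_region_segment.
have mv : (m <= v)%N by case/andP: uv. have mv' : (m <= v')%N by case/andP: uv'.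
have w0 := width_gt0 v.
set w := r (grp m v) - l (grp m v) in w0.
have sw0 : 0 < s * w by rewrite mulr_gt0. have sw1 : s * w < w by rewrite gtr_pMl.
have tw0 : 0 < t * w by rewrite mulr_gt0. have tw1 : t * w < w by rewrite gtr_pMl.
have wE : r (grp m v) = l (grp m v) + w by rewrite /w; ring.
have spoke : s = t -> side (grp m v) * (s * (lvl m v).+1%:R) = side (grp m v) * (t * (lvl m v').+1%:R) -> v = v'.
  move=> -> /(mulfI (side_neq0 _)) /(mulfI (lt0r_neq0 t0)) /eqP.
  by rewrite eqr_nat eqSS => /eqP; apply: same_bead.
move: E; case: (segmentP s uv) => -[uE ->]; case: (segmentP t uv') => -[uE' ->];
  rewrite -gE -/w in uE' * => /pair_inj[E1 E2]; try (exfalso; lra).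
- have st : s = t by apply: (mulIf (lt0r_neq0 w0)); lra.
  by rewrite uE uE' (spoke st E2).
- have st : s = t by apply: (mulIf (lt0r_neq0 w0)); lra.
  by rewrite uE uE' (spoke st E2).
have vv : v = v'.
  by apply: same_bead => //; move/(mulfI (side_neq0 _)): E2; apply: level_uniq.
by split=> //; apply/eqP; rewrite -(eqn_add2r m) uE uE' vv.
Qed.

Lemma segment_inj u v s t : isedge m u v -> segment u v s = segment u v t -> s = t.
Proof.
move=> uv [E1 E2]; apply/eqP; rewrite -subr_eq0; apply: contraT => st.
have a1 : (s - t) * ((necklace_pt v).1 - (necklace_pt u).1) = 0 by rewrite mulrBl; lra.
have a2 : (s - t) * ((necklace_pt v).2 - (necklace_pt u).2) = 0 by rewrite mulrBl; lra.
have : u = v.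
  apply: necklace_pt_inj; rewrite [LHS]surjective_pairing [RHS]surjective_pairing.
  by move/eqP: a1; move/eqP: a2; rewrite !mulf_eq0 (negbTE st) !subr_eq0 => /eqP-> /eqP->.
by move/isedge_ltn: uv => /(_ m_gt2) h E; rewrite E ltnn in h.
Qed.

Lemma segment_continuous u v : continuous (segment u v).
Proof.
have affine (a b : R) : continuous (fun x : R => a + x * b).
  by move=> x; apply: cvgD; [exact: cvg_cst|apply: cvgM; [exact: cvg_id|exact: cvg_cst]].
by move=> t; apply: (cvg_pair (affine _ _ t) (affine _ _ t)).
Qed.

Definition necklace_arc (E : {set 'I_n}) : R -> R * R :=
  if [pick p : 'I_n * 'I_n | isedge m p.1 p.2 && (E == [set p.1; p.2])] is Some p
  then segment p.1 p.2 else fun=> (0, 0).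

Lemma necklace_arcE E : E \in edges (necklace n' m_gt2) ->
  exists u v : 'I_n, [/\ isedge m u v, E = [set u; v] & necklace_arc E = segment u v].
Proof.
case/imsetP=> -[u v]; rewrite finset.inE /= => uv EE; rewrite /necklace_arc.
case: pickP => [[u' v'] /= /andP[uv' /eqP EE']|/(_ (u, v))]; first by exists u', v'.
by rewrite /= uv EE eqxx.
Qed.

Theorem necklace_planar : planar R (necklace n' m_gt2).
Proof.
exists (fun v : 'I_n => necklace_pt v), necklace_arc; split.
- by move=> u v /necklace_pt_inj/val_inj.
- move=> E /necklace_arcE[u [v [uv EE ->]]]; split.
  + exact/continuous_subspaceT/segment_continuous.
  + by move=> s t _ _; apply: segment_inj.
  + exists u, v; split=> //; rewrite /segment ?mul0r ?mul1r ?addr0 -?surjective_pairing //.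
    by rewrite ![_ + (_ - _)]addrC !subrK -surjective_pairing.
- move=> E /necklace_arcE[u [v [uv EE ->]]] t w; rewrite in_itv /= => /andP[t0 t1].
  exact: segment_vertex.
move=> E F /necklace_arcE[u [v [uv EE ->]]] /necklace_arcE[u' [v' [uv' FE ->]]] EF s t.
rewrite !in_itv /= => /andP[s0 s1] /andP[t0 t1] /(segment_uniq uv uv' s0 s1 t0 t1)[/val_inj uE /val_inj vE].
by rewrite EE FE uE vE eqxx in EF.
Qed.

End NecklaceDrawing.

Local Open Scope ring_scope.

(** Bernoulli's inequality in homogeneous form. *)
Lemma exprB_ge (R : realDomainType) (x c : R) (m : nat) : 0 <= c -> c <= x ->
  x ^+ m.+1 - c * m.+1%:R * x ^+ m <= (x - c) ^+ m.+1.
Proof.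
move=> c0 cx; have x0 := le_trans c0 cx.
elim: m => [|m IH]; first by rewrite !expr1 expr0 !mulr1.
rewrite [leRHS]exprS; apply: le_trans (ler_wpM2l _ IH); last by rewrite subr_ge0.
rewrite -subr_ge0 (_ : _ - _ = c * c * m.+1%:R * x ^+ m).
  by rewrite !mulr_ge0 // exprn_ge0.
by rewrite ![x ^+ m.+2]exprS ![x ^+ m.+1]exprS -[m.+2%:R]natr1; ring.
Qed.

Lemma max_planar_cycles_ge (R : realType) (m : nat) : (2 < m)%N ->
  exists C : R, 0 <= C /\ forall n : nat, (0 < n)%N ->
    2 * m%:R * (n%:R / m%:R) ^+ m <=
    (max_planar_copies R n (cycle_graph (2 * m).+1))%:R + C * n%:R ^+ m.-1.
Proof.
move=> m_gt2; have m0 : (0 < m)%N by lia.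
have mR0 : (0 : R) < m%:R by rewrite ltr0n.
have mR1 : (1 : R) <= m%:R by rewrite ler1n.
(* The first summand covers n < 3m, where the main term is bounded; the second is the linear loss in
   replacing x by x - 3. *)
exists (2 * m%:R * 3 ^+ m + 2 * m%:R * (3 * m%:R)); split.
  by rewrite addr_ge0 // !mulr_ge0 // exprn_ge0.
case=> [//|n'] _; set n := n'.+1; set x : R := n%:R / m%:R.
have nR1 : (1 : R) <= n%:R by rewrite ler1n.
have x0 : 0 <= x by rewrite divr_ge0.
have xn : x <= n%:R by rewrite ler_pdivrMr // ler_peMr.
have pn1 : 1 <= (n%:R : R) ^+ m.-1 by rewrite exprn_ege1.
rewrite [in leRHS](mulrDl (2 * m%:R * 3 ^+ m)); have [x3|x3] := ltP x 3.
  apply: (@le_trans _ _ (2 * m%:R * 3 ^+ m * n%:R ^+ m.-1)).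
    apply: (@le_trans _ _ (2 * m%:R * 3 ^+ m)).
      by apply: ler_wpM2l; [rewrite mulr_ge0|rewrite lerXn2r ?nnegrE // ltW].
    by rewrite ler_peMr // !mulr_ge0 // exprn_ge0.
  by rewrite addrCA lerDl addr_ge0 // !mulr_ge0 // exprn_ge0.
pose k := ((n - m) %/ m)%N.
have mn : (3 * m <= n)%N.
  by move: x3; rewrite ler_pdivlMr // -natrM ler_nat.
have k_n : (m + k * m <= n)%N.
  by have := leq_divM (n - m) m; rewrite -/k; lia.
(* One level is lost to the hubs, one to the rail and at most one to rounding, so the number k - 1
   of rails exceeds n / m - 3. *)
have kx : x - 3 <= k.-1%:R.
  have : (n < (k.-1 + 3) * m)%N.
    have := ltn_ceil (n - m) m0; rewrite -/k; have : (0 < k)%N by rewrite divn_gt0 //; lia.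
    by clear -mn; nia.
  rewrite -(ltr_nat R) natrM -ltr_pdivrMr // -/x natrD; lra.
have copies := necklace_copies m_gt2 k_n.
have le_max : (num_copies (necklace n' m_gt2) (cycle_graph (2 * m).+1) <=
    max_planar_copies R n (cycle_graph (2 * m).+1))%N.
  by apply: leq_bigmax_cond; apply/asboolP/necklace_planar.
have low : 2 * m%:R * (x - 3) ^+ m <= (max_planar_copies R n (cycle_graph (2 * m).+1))%:R.
  apply: (@le_trans _ _ (2 * m * k.-1 ^ m)%N%:R).
    rewrite !natrM natrX; apply: ler_wpM2l; first by rewrite mulr_ge0.
    by rewrite lerXn2r ?nnegrE ?subr_ge0.
  rewrite ler_nat; apply: leq_trans le_max; apply: leq_trans copies.
  rewrite leq_mul2l; apply/orP; right; rewrite -{1}(prednK m0) expnS leq_mul2l.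
  by apply/orP; right; rewrite leq_exp2r ?leq_pred //; lia.
have bern : x ^+ m - 3 * m%:R * x ^+ m.-1 <= (x - 3) ^+ m.
  by have := @exprB_ge _ x 3 m.-1; rewrite (prednK m0) => -> //.
have mm0 : 0 <= 2 * m%:R :> R by rewrite mulr_ge0.
have xnm : x ^+ m.-1 <= n%:R ^+ m.-1 by rewrite lerXn2r ?nnegrE.
have := ler_wpM2l mm0 bern.
have : 2 * m%:R * (3 * m%:R * x ^+ m.-1) <= 2 * m%:R * (3 * m%:R) * n%:R ^+ m.-1 :> R.
  by rewrite mulrA; apply: ler_wpM2l => //; rewrite !mulr_ge0.
have : 0 <= 2 * m%:R * 3 ^+ m * n%:R ^+ m.-1 :> R by rewrite !mulr_ge0 // exprn_ge0.
by rewrite mulrBr; lra.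
Qed.

Theorem corollary1p4 (R : realType) (m : nat) (hm : (3 <= m)%N) :
  exists C : R, forall n : nat, (0 < n)%N ->
    `| (max_planar_copies R n (cycle_graph (2 * m + 1)))%:R
       - (2 * m)%:R * (n%:R / m%:R) ^+ m |
    <= C * n%:R `^ (m%:R - 1 / 5%:R).
Proof.
have [C1 upper] := planar_copies_le R hm.
have [C2 [C2_ge0 lower]] := max_planar_cycles_ge R hm.
exists (Num.max `|C1| C2) => n n0; rewrite addn1 natrM.
have P0 : 0 <= n%:R `^ (m%:R - 1 / 5%:R) :> R by exact: powR_ge0.
(* The lower bound has error n^(m-1), which is absorbed because n >= 1 and m - 1 <= m - 1/5. *)
have nP : n%:R ^+ m.-1 <= n%:R `^ (m%:R - 1 / 5%:R) :> R.
  rewrite -powR_mulrn //; apply: ler_powR; first by rewrite ler1n.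
  have : m.-1.+1%:R = m%:R :> R by rewrite prednK //; lia.
  by rewrite -natr1; lra.
have up : (max_planar_copies R n (cycle_graph (2 * m).+1))%:R <=
    2 * m%:R * (n%:R / m%:R) ^+ m + `|C1| * n%:R `^ (m%:R - 1 / 5%:R).
  rewrite /max_planar_copies; elim/big_ind: _ => [|a b ha hb|G /asboolP /(upper n n0) h].
  - by rewrite addr_ge0 // !mulr_ge0 // exprn_ge0 // divr_ge0.
  - by rewrite /maxn; case: ifP.
  by apply: le_trans h _; rewrite lerD2l ler_wpM2r // ler_norm.
rewrite ler_distlC.
have := lower n n0; have := ler_wpM2l C2_ge0 nP.
have : `|C1| * n%:R `^ (m%:R - 1 / 5%:R) <= Num.max `|C1| C2 * n%:R `^ (m%:R - 1 / 5%:R).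
  by rewrite ler_wpM2r // le_max lexx.
have : C2 * n%:R `^ (m%:R - 1 / 5%:R) <= Num.max `|C1| C2 * n%:R `^ (m%:R - 1 / 5%:R).
  by rewrite ler_wpM2r // le_max lexx orbT.
move=> *; apply/andP; split; lra.
Qed.
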